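(* Let $K \subset \mathbb{C}$ be a compact, non-polar and polynomially convex set. Suppose the equilibrium measure $\omega$ of $K$ satisfies $\omega(\overline{V}) = 0$ for every connected component $V$ of the interior of $K$. Let $(q_k)_{k>0}$ be a sequence of complex polynomials of degrees $n_k>0$ with $n_k\to\infty$. If $(q_k)_k$ is $K$-regular and weakly centers on $K$, then $(q_k)_k$ weakly centers on $J := \partial K$.
   Context: A compact set $K\subset\mathbb{C}$ is polynomially convex if and only if $\Omega := \mathbb{C}\setminus K$ is connected; non-polar means of positive logarithmic capacity. Write $I(\omega)=\iint \log|z-w|\,d\omega(z)\,d\omega(w)$ for the energy of the equilibrium measure. The Green's function of $\Omega$ with pole at $\infty$ is $g_\Omega(z) = \int \log|z-w|\,d\omega(w) - I(\omega)$. Write $\mathbb{D}(R)=\mathbb{D}(0,R)=\{z:|z|<R\}$. Root distribution: for a polynomial $q$ of degree $n\geq 1$ with roots $z_1,\dots,z_n$ repeated according to multiplicity, $\mu_q = \frac1n\sum_{j=1}^n\delta_{z_j}$; put $\mu_k:=\mu_{q_k}$. $K$-regularity: $(q_k)_{k>0}$ is $K$-regular if for some $R>0$ (which may be enlarged so that $K\subset \mathbb{D}(0,R)$), $\lim_{k\to\infty}\frac{1}{n_k}\log|q_k(z)| = g_\Omega(z)$ uniformly on $\mathbb{C}\setminus\mathbb{D}(0,R)$. Weak centering: $(q_k)_{k>0}$ weakly centers on a compact set $C$ if (1) there exist $N$ and $R>0$ such that $q_k^{-1}(\{0\})\subset\mathbb{D}(R)$ for all $k\ge N$; and (2) for every closed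 set $L\subset\mathbb{C}$ with $L\cap C=\emptyset$, $\mu_k(L)\to 0$ as $k\to\infty$. *)

(* Defs.v *)
From HB Require Import structures.
From mathcomp Require Import all_boot all_order all_algebra.
From mathcomp Require Import complex.
From mathcomp Require Import all_classical all_reals all_analysis.

Set Implicit Arguments.
Unset Strict Implicit.
Unset Printing Implicit Defensive.

Import Order.TTheory GRing.Theory Num.Theory.
Import numFieldNormedType.Exports.

Local Open Scope classical_set_scope.
Local Open Scope ring_scope.

(* MathComp-Analysis gives the topology of the norm to every numFieldType, but
   not to the concrete type R[i]; this is the usual topology of the complex
   plane. *)
HB.instance Definition _ (R : rcfType) := NormedModule.copy R[i] R[i]^o.

(* The complex plane with its Borel sigma-algebra. *)
Notation borelC R := (g_sigma_algebraType (@open R[i])).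

(* In MathComp, `|z| lives in R[i]; the real-valued modulus is normc. *)
Local Notation normc := ComplexField.Normc.normc.

Section Definitions.
Context {R : realType}.
Implicit Types (K C : set R[i]) (mu omega : probability (borelC R) R).
Implicit Types (p : {poly R[i]}) (q : nat -> {poly R[i]}).

Definition disk (r : R) : set R[i] := [set z | normc z < r].

Definition boundary C : set R[i] := closure C `\` C°.

Definition components C : set (set R[i]) := connected_component C @` C.

(* For compact K: a compact set of the plane is polynomially convex iff its
   complement is connected. *)
Definition polynomially_convex K : Prop := connected (~` K).

(* log |z|, with log 0 = -oo *)
Definition log_mod (z : R[i]) : \bar R := lne (normc z)%:E.

(* Sign convention: potentials and energies are taken with +log, so that they
   are bounded above on compact sets and -oo is a possible value. *)
Definition potential mu (z : R[i]) : \bar R :=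
  (\int[mu]_w log_mod (z - w)%R)%E.

Definition energy mu : \bar R := (\int[mu]_z potential mu z)%E.

(* For compact K, a probability measure has its support in K iff the
   complement of K is a null set. *)
Definition prob_on K : set (probability (borelC R) R) :=
  [set mu | mu (~` K) = 0%E].

Definition max_energy K : \bar R := ereal_sup (energy @` prob_on K).

(* Logarithmic capacity of a compact set; it is 0 for the empty set, as
   ereal_sup set0 = -oo. *)
Definition capacity K : \bar R := expeR (max_energy K).

Definition non_polar K : Prop := (0 < capacity K)%E.

Definition equilibrium_measure K omega : Prop :=
  prob_on K omega /\ energy omega = max_energy K.

(* Green's function with pole at infinity of the complement of the set with
   equilibrium measure omega *)
Definition green omega (z : R[i]) : \bar R :=
  (potential omega z - energy omega)%E.

Definition degree p : nat := (size p).-1.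

(* The roots of p, repeated according to multiplicity. *)
Definition roots_mult p : seq R[i] := sval (closed_field_poly_normal p).

Definition root_distribution p : {measure set (borelC R) -> \bar R} :=
  mscale ((degree p)%:R^-1)%:nng
    (msum (fun j => dirac ((roots_mult p)`_j : borelC R)) (degree p)).

(* The uniform convergence is stated in \bar R: at a root of q k, log_mod is
   -oo and the distance below is +oo. *)
Definition K_regular K omega q : Prop :=
  exists r : R, [/\ 0 < r, K `<=` disk r &
    forall eps : R, 0 < eps -> \forall k \near \oo,
      forall z, ~ disk r z ->
        (`| ((degree (q k))%:R^-1)%:E * log_mod (q k).[z] - green omega z |
           < eps%:E)%E].

Definition weakly_centers q C : Prop :=
  [/\ compact C,
      exists (N : nat) (r : R), 0 < r /\
        forall k, (N <= k)%N -> [set z | root (q k) z] `<=` disk r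
    & forall L : set R[i], closed L -> L `&` C = set0 ->
        root_distribution (q k) L @[k --> \oo] --> 0%E].

End Definitions.

(* Main.v *)
(* Let V be a component of the interior of K. Regularity makes the averages of
   Re Q over the roots of q_k converge to the integral of Re Q against omega for
   every polynomial Q; since the complement Omega of K is connected, the same
   holds for log|z - .| for every z in Omega. Hence the difference u_k of the
   (regularised, at scale h) potentials of omega and of the roots is small near
   the closure of Omega: Omega meets every small circle around such a point, so
   log|z - .| is within O(1) of a mean of kernels with poles in Omega, and the
   error is concentrated near z, where neither omega (finite energy) nor the
   roots carry much mass. Deep inside K the maximum principle gives a lower
   bound for u_k.
   Now let phi be a cutoff equal to 1 on V and supported near V, and sum phi
   times the discrete Laplacian of u_k over a grid of mesh h. Summation by parts,
   Kato's inequality for the truncation of u_k on the other components, and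
   phi = 1 on V bound the mass of the roots in V by the omega-mass of a
   neighbourhood of the closure of V, which is arbitrarily small by hypothesis. *)
Require Import Defs.
From mathcomp Require Import all_boot all_order all_algebra.
From mathcomp Require Import complex.
From mathcomp Require Import all_classical all_reals all_analysis.
From mathcomp Require Import measurable_realfun ring lra.

Set Implicit Arguments.
Unset Strict Implicit.
Unset Printing Implicit Defensive.

Import Order.TTheory GRing.Theory Num.Theory.
Import numFieldNormedType.Exports.

Local Open Scope classical_set_scope.
Local Open Scope ring_scope.

Local Notation normc := ComplexField.Normc.normc.

Local Notation re := complex.Re.
Local Notation im := complex.Im.

(** * The complex plane and the discrete Laplacian *)

(** The interior of [K] has countably many components, so the hypothesis makes it [omega]-null and
    [omega] is carried by [K] minus its interior. Deep inside [K] the potential of [omega] is then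
    harmonic and that of the roots subharmonic, which bounds [u_k] from below. There is no upper
    bound there: interior roots push [u_k] up without control. This is the obstacle. After summation
    by parts [u_k] is multiplied by the Laplacian of [phi], whose sign varies. On [V] this Laplacian
    vanishes at deep points, but other components may accumulate at the boundary of [V], and there
    the positive part of [u_k] has to be carried along rather than estimated.

    The mesh equals the regularisation scale [h]. The discrete Laplacian of the kernel is then
    nonnegative, sums to at most an absolute constant over the grid, and exceeds an absolute
    constant near its pole, so grid sums count roots up to fixed factors. The choices are made in
    the order: width [r] of [phi], tolerance [c] for [u_k], scale [h], index [k]. *)

Lemma normc_ge0 (R : realType) (z : R[i]) : 0 <= normc z.
Proof. by case: z => x y; rewrite /normc sqrtr_ge0. Qed.

Ltac posi := repeat lazymatch goal with
| |- is_true (0 <= _ ^+ 2) => exact: sqr_ge0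
| |- is_true (0 <= _ ^+ _) => apply: exprn_ge0
| |- is_true (0 <= _ * _) => apply: mulr_ge0
| |- is_true (0 <= _ + - _) => fail
| |- is_true (0 <= _ + _) => apply: addr_ge0
| |- is_true (0 <= _ ^-1) => rewrite invr_ge0
| |- is_true (0 < _ * _) => apply: mulr_gt0
| |- is_true (0 < _ ^+ _) => apply: exprn_gt0
| |- is_true (0 < _ ^-1) => rewrite invr_gt0
| |- is_true (0 <= _) => first [exact: ler0n | exact: ltW | exact: normc_ge0 | assumption | done]
| |- is_true (0 < _) => first [assumption | done]
end.

Section ComplexPlane.
Context {R : realType}.
Implicit Types (z w : R[i]) (x y h t s : R).

Lemma normc_sqr z : normc z ^+ 2 = re z ^+ 2 + im z ^+ 2.
Proof. by case: z => x y; rewrite /normc /= sqr_sqrtr // addr_ge0 // sqr_ge0. Qed.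

Lemma normc_distC z w : normc (z - w) = normc (w - z).
Proof. by rewrite -normcN opprB. Qed.

Lemma normc_triangle v z w : normc (z - w) <= normc (z - v) + normc (v - w).
Proof. by have := le_normcD (z - v) (v - w); rewrite addrA subrK. Qed.

Lemma normc_sub_ge z w : normc z - normc w <= normc (z - w).
Proof. by rewrite lerBlDr; have := le_normcD (z - w) w; rewrite subrK. Qed.

Lemma normc_real x : normc (x%:C)%C = `|x|.
Proof. by rewrite /normc /= expr0n /= addr0 sqrtr_sqr. Qed.

Lemma normc_nat n : normc (n%:R : R[i]) = n%:R.
Proof. by rewrite -(rmorph_nat (real_complex R)) normc_real ger0_norm. Qed.

Lemma normr_re z : `|re z| <= normc z.
Proof.
by case: z => x y /=; rewrite -sqrtr_sqr; apply: ler_wsqrtr; rewrite lerDl sqr_ge0.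
Qed.

Lemma normc_gt0 z : (0 < normc z) = (z != 0).
Proof.
rewrite lt_neqAle normc_ge0 andbT eq_sym; apply/idP/idP; apply: contraNneq.
  by move->; rewrite ComplexField.Normc.normc0.
by move/ComplexField.Normc.eq0_normc => ->.
Qed.

Lemma normcX z n : normc (z ^+ n) = normc z ^+ n.
Proof.
elim: n => [|n IH]; first by rewrite !expr0 ComplexField.Normc.normc1.
by rewrite !exprS ComplexField.Normc.normcM IH.
Qed.

Lemma nbhsCP z (A : set R[i]) :
  nbhs z A <-> exists2 e : R, 0 < e & forall w, normc (w - z) < e -> A w.
Proof.
split.
- move=> /nbhs_normP[e /= e0 H].
  have er : e = ((re e)%:C)%C.
    move: e0; rewrite ltcE /= => /andP[/eqP h _].
    by apply/eqP; rewrite eq_complex /= h !eqxx.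
  exists (re e); first by move: e0; rewrite er ltcR.
  by move=> w h; apply: H; rewrite /ball_ /= er distrC ltcR.
- move=> [e e0 H]; apply/nbhs_normP; exists ((e%:C)%C); first by rewrite /= ltcR.
  by move=> w /=; rewrite distrC ltcR; apply: H.
Qed.

Lemma continuousCP (f : R[i] -> R) :
  (forall z e, 0 < e -> exists2 d, 0 < d &
     forall w, normc (w - z) < d -> `|f w - f z| < e) -> continuous f.
Proof.
move=> H z A /nbhs_ballP[e /= e0 eA]; have [d d0 dH] := H z e e0.
apply/nbhsCP; exists d => // w /dH wz; apply: eA.
by rewrite -ball_normE /ball_ /= distrC.
Qed.

Lemma lipschitzC_continuous (k : R) (f : R[i] -> R) :
  (forall z w, f w - f z <= k * normc (w - z)) -> continuous f.
Proof.
move=> H; apply: continuousCP => z e e0.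
exists (e / (`|k| + 1)); first by rewrite divr_gt0 // ltr_wpDl.
move=> w; rewrite ltr_pdivlMr ?ltr_wpDl // => wz.
apply: le_lt_trans wz; rewrite mulrC.
have kk : k * normc (w - z) <= (`|k| + 1) * normc (w - z).
  by rewrite ler_wpM2r ?normc_ge0 // ler_wpDr ?ler_norm.
rewrite ler_norml; apply/andP; split; last exact: le_trans (H _ _) kk.
by rewrite lerNl opprB (le_trans (H _ _)) // normc_distC.
Qed.

Lemma continuous_dist z : continuous (fun w => normc (w - z)).
Proof.
apply: (@lipschitzC_continuous 1) => a b.
by rewrite mul1r; have := normc_sub_ge (b - z) (a - z); rewrite opprB addrA subrK.
Qed.

Lemma contD (f g : R[i] -> R) : continuous f -> continuous g ->
  continuous (fun w => f w + g w).
Proof. by move=> cf cg z; exact: cvgD (cf z) (cg z). Qed.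

Lemma contZ (c : R) (f : R[i] -> R) : continuous f -> continuous (fun w => c * f w).
Proof. by move=> cf z; exact: cvgM (cvg_cst c) (cf z). Qed.

Lemma cont_cst (c : R) : continuous (fun _ : R[i] => c).
Proof. by move=> z; exact: cst_continuous. Qed.

Lemma cont_sum (I : Type) (r : seq I) (F : I -> R[i] -> R) :
  (forall i, continuous (F i)) -> continuous (fun w => \sum_(i <- r) F i w).
Proof.
move=> cF; elim: r => [|i r IH].
  by rewrite (_ : (fun w => _) = fun=> 0); [exact: cont_cst|apply/funext => w; rewrite big_nil].
rewrite (_ : (fun w => _) = fun w => F i w + \sum_(i <- r) F i w).
  exact: contD (cF i) IH.
by apply/funext => w; rewrite big_cons.
Qed.

Lemma ln_sub_le (d x y : R) : 0 < d -> d <= x -> d <= y ->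
  ln x - ln y <= d^-1 * `|x - y|.
Proof.
move=> d0 dx dy; have y0 : 0 < y by exact: lt_le_trans dy.
have x0 : 0 < x by exact: lt_le_trans dx.
rewrite -ln_div ?posrE // (_ : x / y = 1 + (x - y) / y); last by field; rewrite gt_eqF.
apply: (@le_trans _ _ ((x - y) / y)).
  apply: le_ln1Dx; rewrite mulrBl divff ?gt_eqF //.
  have : 0 < x / y by exact: divr_gt0.
  by lra.
rewrite mulrC; apply: (@le_trans _ _ (y^-1 * `|x - y|)).
  by rewrite ler_pM2l ?invr_gt0 // ler_norm.
by rewrite ler_wpM2r // lef_pV2 ?posrE.
Qed.

(** Integrals against [omega] are compared only for functions continuous on the whole plane, hence
    the truncation at distance [d] from the pole; it is invisible on a set at distance at least [d]
    from [u]. *)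
Lemma continuous_ln_max (d : R) u : 0 < d ->
  continuous (fun w => ln (Num.max (normc (w - u)) d)).
Proof.
move=> d0; apply: (@lipschitzC_continuous d^-1) => z w.
have dm v : d <= Num.max (normc (v - u)) d by rewrite le_max lexx orbT.
apply: (le_trans (ln_sub_le d0 (dm w) (dm z))).
rewrite ler_pM2l ?invr_gt0 //.
have h1 := normc_triangle z w u; have h2 := normc_triangle w z u.
rewrite (normc_distC z w) in h2.
have n0 := normc_ge0 (w - z).
by rewrite ler_norml; case: (leP (normc (w - u)) d) => ?; case: (leP (normc (z - u)) d) => ?;
  apply/andP; split; lra.
Qed.

Definition cball z (r : R) : set R[i] := [set w | normc (w - z) < r].

Lemma nbhs_cball z r : 0 < r -> nbhs z (cball z r).
Proof. by move=> r0; apply/nbhsCP; exists r. Qed.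

Lemma openCP (A : set R[i]) :
  (forall z, A z -> exists2 e : R, 0 < e & cball z e `<=` A) -> open A.
Proof.
by move=> H; rewrite openE => z /H[e e0 zA]; apply/nbhsCP; exists e.
Qed.

Lemma open_cball z r : open (cball z r).
Proof.
apply: openCP => w wz; exists (r - normc (w - z)); first by rewrite subr_gt0.
move=> v; rewrite /cball /= => vw; apply: le_lt_trans (normc_triangle w v z) _.
by rewrite addrC -ltrBrDl.
Qed.

Lemma closed_dist_gt0 (A : set R[i]) z : closed A -> ~ A z ->
  exists2 d : R, 0 < d & forall w, A w -> d <= normc (w - z).
Proof.
move=> /closed_openC; rewrite openE => /(_ z) cA Az.
have /nbhsCP[d d0 H] := cA Az; exists d => // w Aw; rewrite leNgt.
by apply/negP => /H.
Qed.

Lemma grid_near (g X : R) : 0 < g -> 0 <= X -> exists M : nat,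
  [/\ X < g * M%:R, g * M%:R <= X + g & forall x, `|x| <= X ->
    exists2 a : 'I_(M + M).+1, true & `|x - g * (a%:R - M%:R)| <= g].
Proof.
move=> g0 X0; have Xg0 : 0 <= X / g by rewrite divr_ge0 // ltW.
pose M := (Num.truncn (X / g)).+1; exists M.
have M1 : X < g * M%:R by rewrite mulrC -ltr_pdivrMr // truncnS_gt.
have M2 : g * M%:R <= X + g.
  have := Num.Theory.truncn_le (X / g); rewrite Xg0 ler_pdivlMr //.
  by rewrite /M -natr1; lra.
split=> // x; rewrite ler_norml => /andP[x1 x2].
set y := (x + g * M%:R) / g.
have y0 : 0 <= y by rewrite divr_ge0 //; lra.
have yE : y * g = x + g * M%:R by rewrite mulfVK ?gt_eqF.
have := Num.Theory.truncn_le y; rewrite y0 => a1.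
have a2 := truncnS_gt y.
have aM : (Num.truncn y < (M + M).+1)%N.
  rewrite ltnS -(@ler_nat R) natrD; apply: (le_trans a1).
  by rewrite ler_pdivrMr //; lra.
exists (Ordinal aM) => //=; rewrite -natr1 in a2.
have g1 : (Num.truncn y)%:R * g <= y * g by rewrite ler_pM2r.
have g2 : y * g < ((Num.truncn y)%:R + 1) * g by rewrite ltr_pM2r.
by rewrite yE in g1 g2; rewrite ler_norml; apply/andP; split; lra.
Qed.

Definition gpt (g : R) (M a b : nat) : R[i] :=
  Complex (g * (a%:R - M%:R)) (g * (b%:R - M%:R)).

Lemma normc_le_add z : normc z <= `|re z| + `|im z|.
Proof.
case: z => x y /=; have p : 0 <= `|x| + `|y| by rewrite addr_ge0.
rewrite -[leRHS]ger0_norm // -sqrtr_sqr; apply: ler_wsqrtr.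
rewrite sqrrD !real_normK ?num_real //.
have : 0 <= `|x| * `|y| by rewrite mulr_ge0.
by rewrite -mulr_natr; lra.
Qed.

Lemma normr_im z : `|im z| <= normc z.
Proof. by case: z => x y /=; rewrite -sqrtr_sqr; apply: ler_wsqrtr; rewrite lerDr sqr_ge0. Qed.

(** The five-point Laplacian without the factor [1 / h^2]: for smooth [f] it is [h^2] times the
    Laplacian up to terms of fourth order. *)
Definition step4 h (f : R[i] -> R) z : R :=
  f (z + Complex h 0) + f (z - Complex h 0) + f (z + Complex 0 h)
  + f (z - Complex 0 h) - 4 * f z.

Lemma normc_hstep h : 0 <= h -> normc (Complex h 0) = h.
Proof. by move=> h0; rewrite /normc /= expr0n addr0 sqrtr_sqr ger0_norm. Qed.
Lemma normc_vstep h : 0 <= h -> normc (Complex 0 h) = h.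
Proof. by move=> h0; rewrite /normc /= expr0n add0r sqrtr_sqr ger0_norm. Qed.

(** The logarithm of [|z|] regularised at scale [h]: smooth and subharmonic, with Laplacian
    [2 h^2 / (|z|^2 + h^2)^2]. *)
Definition kap h z : R := ln (normc z ^+ 2 + h ^+ 2) / 2.

Lemma ln_step4 a b c d s : 0 < a -> 0 < b -> 0 < c -> 0 < d -> 0 < s ->
  ln a / 2 + ln b / 2 + ln c / 2 + ln d / 2 - 4 * (ln s / 2)
  = ln (a * b * c * d / s ^+ 4) / 2.
Proof.
move=> a0 b0 c0 d0 s0.
by rewrite ln_div ?posrE ?mulr_gt0 ?exprn_gt0 // lnXn // !lnM ?posrE ?mulr_gt0 //; field.
Qed.

(** With [z = x + i y], the arguments of [ln] at the neighbours are [s + T +- 2 t x] and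
    [s + T +- 2 t y]; their product is [((s + T)^2 - 4 T x^2) ((s + T)^2 - 4 T y^2)]. *)
Lemma step4_kapE h t z (s := normc z ^+ 2 + h ^+ 2) (T := t ^+ 2) : 0 < h ->
  step4 t (kap h) z = ln (((s + T) ^+ 4 - 4 * T * (s + T) ^+ 2 * (normc z ^+ 2)
     + 16 * T ^+ 2 * (re z ^+ 2 * im z ^+ 2)) / s ^+ 4) / 2.
Proof.
move=> h0; rewrite /step4 /kap.
have p w : 0 < normc w ^+ 2 + h ^+ 2 by rewrite ltr_wpDl ?sqr_ge0 // exprn_gt0.
rewrite ln_step4 ?p // -/s; congr (ln (_ / _) / 2).
rewrite /s /T !normc_sqr; case: z {s} => x y /=; ring.
Qed.

(** The term added to 1 is [t^2] times the Laplacian of [kap h]. The excess of the numerator over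
    [s^4 + 2 T h^2 s^2] is a sum of nonnegative terms, one of which has the factor [h^2 - T]; this
    is where [t <= h] enters. *)
Lemma step4_kap_ge h t z : 0 < h -> t ^+ 2 <= h ^+ 2 ->
  ln (1 + 2 * t ^+ 2 * h ^+ 2 / (normc z ^+ 2 + h ^+ 2) ^+ 2) / 2
    <= step4 t (kap h) z.
Proof.
move=> h0 th; rewrite step4_kapE //.
set s := normc z ^+ 2 + h ^+ 2; set T := t ^+ 2.
have s0 : 0 < s by rewrite ltr_wpDl ?sqr_ge0 // exprn_gt0.
have T0 : 0 <= T by rewrite sqr_ge0.
have h20 : 0 < h ^+ 2 by rewrite exprn_gt0.
rewrite ler_pM2r ?invr_gt0 // ler_ln ?posrE; last 2 first.
- by rewrite ltr_wpDr // divr_ge0 ?sqr_ge0 // mulr_ge0 ?sqr_ge0 // mulr_ge0.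
- apply: divr_gt0; last exact: exprn_gt0.
  apply: ltr_wpDr; first by posi.
  have -> : normc z ^+ 2 = s - h ^+ 2 by rewrite /s; ring.
  rewrite (_ : _ - _ = (s + T) ^+ 2 * ((s - T) ^+ 2 + 4 * T * h ^+ 2)); last by ring.
  apply: mulr_gt0; first by apply: exprn_gt0; apply: ltr_wpDr.
  move: T0; rewrite le_eqVlt => /orP[/eqP <-|Tp].
    by rewrite !(mulr0, mul0r, subr0, addr0) exprn_gt0.
  by apply: ltr_wpDl; [exact: sqr_ge0|posi].
rewrite ler_pdivlMr ?exprn_gt0 //.
rewrite (_ : _ * s ^+ 4 = s ^+ 4 + 2 * T * h ^+ 2 * s ^+ 2); last by field; apply/eqP => E; rewrite E ltxx in s0.
have -> : normc z ^+ 2 = s - h ^+ 2 by rewrite /s; ring.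
have H : 0 <= 16 * T ^+ 2 * (re z ^+ 2 * im z ^+ 2).
  by posi.
rewrite -subr_ge0.
rewrite (_ : _ - _ = 16 * T ^+ 2 * (re z ^+ 2 * im z ^+ 2) + T ^+ 4
   + 2 * T * s ^+ 2 * (h ^+ 2 - T) + 8 * T ^+ 2 * s * h ^+ 2 + 4 * T ^+ 3 * h ^+ 2); last by ring.
by posi; rewrite subr_ge0.
Qed.

Lemma ln1D_le (x : R) : 0 <= x -> ln (1 + x) <= x.
Proof. by move=> x0; apply: le_ln1Dx; apply: lt_le_trans x0; rewrite ltrN10. Qed.

(** The decay of order [|z|^-4] makes the sum over a lattice of mesh [h] bounded independently of
    [h]. *)
Lemma step4_kap_le h z : 0 < h ->
  step4 h (kap h) z <= 8 * (h ^+ 2 / (normc z ^+ 2 + h ^+ 2)) ^+ 2.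
Proof.
move=> h0; rewrite step4_kapE //.
set s := normc z ^+ 2 + h ^+ 2; set T := h ^+ 2.
have s0 : 0 < s by rewrite ltr_wpDl ?sqr_ge0 // exprn_gt0.
have T0 : 0 < T by rewrite exprn_gt0.
have Ts : T <= s by rewrite /s lerDr sqr_ge0.
set y := T / s; have y0 : 0 <= y by rewrite divr_ge0 ?ltW.
have y1 : y <= 1 by rewrite ler_pdivrMr // mul1r.
have y2 : y ^+ 2 <= 1 by rewrite expr_le1.
suff H : ((s + T) ^+ 4 - 4 * T * (s + T) ^+ 2 * normc z ^+ 2
   + 16 * T ^+ 2 * (re z ^+ 2 * im z ^+ 2)) / s ^+ 4 <= 1 + (6 * y ^+ 2 + 9 * y ^+ 4).
  have b0 : 0 <= 6 * y ^+ 2 + 9 * y ^+ 4 by rewrite addr_ge0 // mulr_ge0 // exprn_ge0.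
  rewrite ler_pdivrMr //.
  have L : ln (1 + (6 * y ^+ 2 + 9 * y ^+ 4)) <= 16 * y ^+ 2.
    apply: (le_trans (ln1D_le b0)).
    rewrite (_ : y ^+ 4 = y ^+ 2 * y ^+ 2); last by ring.
    have := sqr_ge0 y; nra.
  apply: (@le_trans _ _ (16 * y ^+ 2)); last by lra.
  apply: le_trans L.
  set A := (X in ln X) in H *.
  have [A0|A0] := ltP 0 A; last by rewrite (ln0 A0) ln_ge0 // lerDl.
  by rewrite ler_ln ?posrE // ltr_wpDr.
have n2 : normc z ^+ 2 = s - T by rewrite /s /T; ring.
have xy : 4 * (re z ^+ 2 * im z ^+ 2) <= (s - T) ^+ 2.
  rewrite -n2 normc_sqr; have := sqr_ge0 (re z ^+ 2 - im z ^+ 2); nra.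
rewrite ler_pdivrMr ?exprn_gt0 // n2.
have -> : (1 + (6 * y ^+ 2 + 9 * y ^+ 4)) * s ^+ 4
    = s ^+ 4 + 6 * T ^+ 2 * s ^+ 2 + 9 * T ^+ 4.
  rewrite /y; clear -s0; clearbody s T; field.
  by rewrite gt_eqF.
apply: (@le_trans _ _ ((s + T) ^+ 4 - 4 * T * (s + T) ^+ 2 * (s - T) + 4 * T ^+ 2 * (s - T) ^+ 2)).
  by have := sqr_ge0 T; nra.
rewrite le_eqVlt; apply/orP; left; apply/eqP; ring.
Qed.

(** Off the origin [log |z|] is harmonic, so the second-order terms cancel and a fourth-order one
    remains. For small [t] it loses against the second-order gain in [step4_kap_ge]. *)
Lemma step4_ln_normc_le t z : 0 <= t -> t < normc z ->
  step4 t (fun w => ln (normc w)) z <= (t ^+ 2 / normc z ^+ 2) ^+ 2.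
Proof.
move=> t0 tz.
have n0 : 0 < normc z := le_lt_trans t0 tz.
have hE w : ln (normc w) = ln (normc w ^+ 2) / 2.
  have [w0|w0] := ltP 0 (normc w); last first.
    have -> : normc w = 0 by apply/eqP; rewrite eq_le w0 normc_ge0.
    by rewrite expr0n /= ln0 // mul0r.
  by rewrite lnXn // -mulr_natr; field.
have P v : normc v = t -> 0 < normc (z + v).
  by move=> vt; have := normc_sub_ge z (- v); rewrite normcN opprK vt; lra.
have P1 : 0 < normc (z + Complex t 0) by apply: P; rewrite normc_hstep.
have P2 : 0 < normc (z - Complex t 0) by apply: P; rewrite normcN normc_hstep.
have P3 : 0 < normc (z + Complex 0 t) by apply: P; rewrite normc_vstep.
have P4 : 0 < normc (z - Complex 0 t) by apply: P; rewrite normcN normc_vstep.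
rewrite /step4 !hE ln_step4; try by apply: exprn_gt0.
set s := normc z ^+ 2; set T := t ^+ 2.
have s0 : 0 < s by rewrite exprn_gt0.
have T0 : 0 <= T by rewrite sqr_ge0.
set A := (X in ln X / 2).
have A0 : 0 < A.
  by rewrite /A; posi.
have AE : A = ((s + T) ^+ 4 - 4 * T * (s + T) ^+ 2 * s
     + 16 * T ^+ 2 * (re z ^+ 2 * im z ^+ 2)) / s ^+ 4.
  rewrite /A; congr (_ / _); rewrite /s /T !normc_sqr.
  case: z {A A0 P P1 P2 P3 P4 n0 tz s s0} => x y /=; ring.
have xy : 4 * (re z ^+ 2 * im z ^+ 2) <= s ^+ 2.
  rewrite /s normc_sqr; have := sqr_ge0 (re z ^+ 2 - im z ^+ 2); nra.
have Ale : A <= (1 + (T / s) ^+ 2) ^+ 2.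
  rewrite AE ler_pdivrMr ?exprn_gt0 //.
  have -> : (1 + (T / s) ^+ 2) ^+ 2 * s ^+ 4 = (s ^+ 2 + T ^+ 2) ^+ 2.
    by clear -s0; clearbody s T; field; rewrite gt_eqF.
  apply: (@le_trans _ _ ((s + T) ^+ 4 - 4 * T * (s + T) ^+ 2 * s + 4 * T ^+ 2 * s ^+ 2)).
    by have := sqr_ge0 T; nra.
  rewrite le_eqVlt; apply/orP; left; apply/eqP; ring.
have L : ln A <= 2 * (T / s) ^+ 2.
  apply: (@le_trans _ _ (ln ((1 + (T / s) ^+ 2) ^+ 2))).
    by rewrite ler_ln ?posrE // exprn_gt0 // ltr_wpDr // sqr_ge0.
  rewrite lnXn ?ltr_wpDr ?sqr_ge0 // mulr2n.
  by have := ln1D_le (sqr_ge0 (T / s)); lra.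
by rewrite ler_pdivrMr // mulrC.
Qed.

End ComplexPlane.

(** * Uniform approximation by polynomials on K *)

Section PolynomialApproximation.
Context {R : realType}.
Implicit Types (z w g : R[i]) (K : set R[i]) (p : {poly R[i]}).

Lemma horner_bounded p (B : R) :
  exists2 M : R, 0 <= M & forall w, normc w < B -> normc p.[w] <= M.
Proof.
elim/poly_ind: p => [|p c [M M0 H]].
  by exists 0 => // w _; rewrite horner0 ComplexField.Normc.normc0.
exists (M * `|B| + normc c) => [|w wB]; first by rewrite addr_ge0 ?mulr_ge0 ?normc_ge0.
rewrite hornerMXaddC (le_trans (le_normcD _ _)) // lerD2r ComplexField.Normc.normcM.
by rewrite ler_pM ?normc_ge0 ?H // (le_trans (ltW wB)) // ler_norm.
Qed.

(** With [x = 2 Re g + |g|^2] one has [|1 + g|^2 = 1 + x]. The bounds [x - 4 x^2 <= ln (1 + x) <= x]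
    and [|x| <= 5/2 |g|] leave an error of at most [2 x^2 + |g|^2 / 2], whence 25/2 + 1/2 = 13. *)
Lemma ln_normc_1D_bound g : normc g <= 1 / 2 ->
  `|ln (normc (1 + g)) - re g| <= 13 * normc g ^+ 2.
Proof.
move=> g2; have g0 := normc_ge0 g.
have reg : `|re g| <= normc g := normr_re g.
have n0 : 0 < normc (1 + g).
  have := normc_sub_ge 1 (- g).
  by rewrite opprK normcN ComplexField.Normc.normc1; lra.
set x := 2 * re g + normc g ^+ 2.
have xE : normc (1 + g) ^+ 2 = 1 + x.
  rewrite /x !normc_sqr; case: (g) => a b /=; ring.
have lnE : ln (normc (1 + g)) = ln (1 + x) / 2.
  by rewrite -xE lnXn // mulr2n; field.
have x1 : 0 < 1 + x by rewrite -xE exprn_gt0.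
have xl : 1 + x >= 1 / 4.
  have := normc_sub_ge 1 (- g).
  by rewrite opprK normcN ComplexField.Normc.normc1 -xE => H; nra.
have up : ln (1 + x) <= x by apply: le_ln1Dx; lra.
have lo : x - 4 * x ^+ 2 <= ln (1 + x).
  have i0 : 0 < (1 + x)^-1 by rewrite invr_gt0.
  have h1 : ln ((1 + x)^-1) <= - x / (1 + x).
    have -> : - x / (1 + x) = (1 + x)^-1 - 1 by field; rewrite gt_eqF.
    by rewrite -{1}[(1 + x)^-1](subrKC 1) le_ln1Dx // ; lra.
  rewrite lnV ?posrE // in h1.
  have h2 : x / (1 + x) >= x - 4 * x ^+ 2.
    rewrite ler_pdivlMr //; have := sqr_ge0 x; nra.
  by rewrite mulNr in h1; lra.
move: reg; rewrite lnE !ler_norml => /andP[r1 r2].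
have nn : 0 <= normc g * (1 / 2 - normc g) by apply: mulr_ge0; lra.
have xb : x ^+ 2 <= (5 / 2 * normc g) ^+ 2.
  have : 0 <= (5 / 2 * normc g - x) * (5 / 2 * normc g + x).
    by apply: mulr_ge0; rewrite /x; have := sqr_ge0 (normc g); lra.
  by move=> H; rewrite -subr_ge0 (le_trans H) // le_eqVlt; apply/orP; left; apply/eqP; ring.
apply/andP; split; rewrite /x in up lo *; nra.
Qed.

Definition papx K (f : R[i] -> R[i]) := forall e : R, 0 < e ->
  exists p, forall w, K w -> normc (f w - p.[w]) <= e.

Definition rapx K (f : R[i] -> R) := forall e : R, 0 < e ->
  exists p, forall w, K w -> `|f w - re p.[w]| <= e.

Lemma papx_ext K f1 f2 : (forall w, K w -> f1 w = f2 w) -> papx K f1 -> papx K f2.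
Proof.
by move=> E H e /H[p pP]; exists p => w Kw; rewrite -E // pP.
Qed.

Lemma papx_poly K p : papx K (horner p).
Proof. by move=> e e0; exists p => w _; rewrite subrr ComplexField.Normc.normc0 ltW. Qed.

Lemma papx_cst K z : papx K (fun=> z).
Proof.
by move=> e e0; exists z%:P => w _; rewrite hornerC subrr ComplexField.Normc.normc0 ltW.
Qed.

Lemma papxD K f1 f2 : papx K f1 -> papx K f2 -> papx K (fun w => f1 w + f2 w).
Proof.
move=> H1 H2 e e0; have e2 : 0 < e / 2 by rewrite divr_gt0.
have [p1 P1] := H1 _ e2; have [p2 P2] := H2 _ e2; exists (p1 + p2) => w Kw.
rewrite hornerD opprD addrACA (le_trans (le_normcD _ _)) //.
by rewrite [e]splitr lerD ?P1 ?P2.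
Qed.

Lemma papx_sum K n (f : nat -> R[i] -> R[i]) : (forall i, (i < n)%N -> papx K (f i)) ->
  papx K (fun w => \sum_(i < n) f i w).
Proof.
elim: n => [|n IH] H.
  by apply: papx_ext (papx_cst K 0) => w _; rewrite big_ord0.
have {}IH := IH (fun i ni => H i (ltnW ni)).
by apply: papx_ext (papxD IH (H n (ltnSn n))) => w _; rewrite big_ord_recr.
Qed.

Lemma papx_lim K f : (forall e : R, 0 < e -> exists2 h, papx K h &
  forall w, K w -> normc (f w - h w) <= e) -> papx K f.
Proof.
move=> H e e0; have e2 : 0 < e / 2 by rewrite divr_gt0.
have [h hK fh] := H _ e2; have [p P] := hK _ e2; exists p => w Kw.
rewrite (le_trans (normc_triangle (h w) _ _)) //.
by rewrite [e]splitr lerD ?P ?fh.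
Qed.

Section Bounded.
Variables (K : set R[i]) (B : R).
Hypothesis KB : K `<=` disk B.

Lemma papx_bounded f : papx K f ->
  exists2 M : R, 0 < M & forall w, K w -> normc (f w) <= M.
Proof.
move=> /(_ 1 ltr01)[p P]; have [M M0 H] := horner_bounded p B.
exists (1 + M) => [|w Kw]; first by rewrite ltr_pwDl.
have := le_normcD (f w - p.[w]) p.[w]; rewrite subrK => /le_trans -> //.
by rewrite lerD ?P // H //; exact: KB.
Qed.

Lemma papxM f1 f2 : papx K f1 -> papx K f2 -> papx K (fun w => f1 w * f2 w).
Proof.
move=> H1 H2 e e0.
have [M M0 MP] := papx_bounded H1.
have e2 : 0 < e / (2 * M) by rewrite divr_gt0 // mulr_gt0.
have [p2 P2] := H2 _ e2; have [M2 M20 M2P] := horner_bounded p2 B.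
have e1 : 0 < e / (2 * (M2 + 1)) by rewrite divr_gt0 // mulr_gt0 // ltr_wpDl.
have [p1 P1] := H1 _ e1; exists (p1 * p2) => w Kw.
rewrite hornerM (_ : _ - _ = f1 w * (f2 w - p2.[w]) + (f1 w - p1.[w]) * p2.[w]); last by ring.
rewrite (le_trans (le_normcD _ _)) // !ComplexField.Normc.normcM [e]splitr lerD //.
- rewrite (_ : e / 2 = M * (e / (2 * M))); last by field; rewrite gt_eqF.
  by rewrite ler_pM ?normc_ge0 ?MP ?P2.
- rewrite (_ : e / 2 = e / (2 * (M2 + 1)) * (M2 + 1)); last by field; rewrite gt_eqF // ltr_wpDl.
  rewrite ler_pM ?normc_ge0 ?P1 // (le_trans (M2P _ (KB Kw))) //.
  by rewrite lerDl.
Qed.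

Lemma papxX f n : papx K f -> papx K (fun w => f w ^+ n).
Proof.
move=> H; elim: n => [|n IH].
  by apply: papx_ext (papx_cst K 1) => w _; rewrite expr0.
by apply: papx_ext (papxM H IH) => w _; rewrite exprS.
Qed.

Lemma papx_geom f : papx K f -> (forall w, K w -> normc (f w) <= 1 / 2) ->
  papx K (fun w => (1 - f w)^-1).
Proof.
move=> H f2; apply: papx_lim => e e0.
have [n nP] : exists n, 2 * (1 / 2) ^+ n <= e.
  exists (Num.truncn (2 / e)).+1.
  have := truncnS_gt (2 / e); set n := (Num.truncn _).+1 => ne.
  have n2 : n%:R <= 2 ^+ n :> R by rewrite -natrX ler_nat ltnW // ltn_expl.
  have n20 : (0 : R) < 2 ^+ n by rewrite exprn_gt0.
  rewrite mul1r exprVn ler_pdivrMr // mulrC -ler_pdivrMr //.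
  exact: le_trans (ltW ne) n2.
exists (fun w => \sum_(i < n) f w ^+ i).
  by apply: (@papx_sum K n (fun i w => f w ^+ i)) => i _; exact: papxX.
move=> w Kw.
have f1 : 1 / 2 <= normc (1 - f w).
  have := normc_sub_ge 1 (f w); have := f2 w Kw.
  by rewrite ComplexField.Normc.normc1; lra.
have n0 : 1 - f w != 0 by rewrite -normc_gt0; apply: lt_le_trans f1; lra.
have -> : (1 - f w)^-1 - \sum_(i < n) f w ^+ i = f w ^+ n / (1 - f w).
  apply: (mulIf n0); rewrite mulrBl mulVf // mulfVK //.
  by rewrite [_ * (1 - f w)]mulrC -[1 - f w]opprB mulNr -subrX1; ring.
rewrite ComplexField.Normc.normcM ComplexField.Normc.normcV normcX mulrC.
apply: le_trans nP; apply: ler_pM; rewrite ?invr_ge0 ?normc_ge0 ?exprn_ge0 ?normc_ge0 //.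
  by rewrite -[2]invrK lef_pV2 ?posrE ?normc_gt0 ?invr_gt0 //; lra.
by rewrite lerXn2r ?nnegrE ?normc_ge0 ?f2 //; lra.
Qed.

Lemma rapx_re f (F : R[i] -> R[i]) : papx K F ->
  (forall w, K w -> f w = re (F w)) -> rapx K f.
Proof.
move=> H E e /H[p P]; exists p => w Kw; rewrite E //.
apply: le_trans (P w Kw); apply: le_trans (normr_re _).
by case: (F w) => a b; case: (p.[w]).
Qed.

Lemma rapxD f1 f2 : rapx K f1 -> rapx K f2 -> rapx K (fun w => f1 w + f2 w).
Proof.
move=> H1 H2 e e0; have e2 : 0 < e / 2 by rewrite divr_gt0.
have [p1 P1] := H1 _ e2; have [p2 P2] := H2 _ e2; exists (p1 + p2) => w Kw.
rewrite hornerD raddfD opprD addrACA (le_trans (ler_normD _ _)) //.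
by rewrite [e]splitr lerD ?P1 ?P2.
Qed.

Lemma rapxZ (c : R) f : rapx K f -> rapx K (fun w => c * f w).
Proof.
move=> H e e0; have c0 : 0 < `|c| + 1 by rewrite ltr_wpDl.
have [p P] := H (e / (`|c| + 1)) (divr_gt0 e0 c0).
exists ((c%:C)%C *: p) => w Kw.
rewrite hornerZ (_ : re _ = c * re p.[w]); last first.
  by case: (p.[w]) => a b /=; rewrite mul0r subr0.
rewrite -mulrBr normrM; have := P w Kw; rewrite ler_pdivlMr // => h.
by apply: le_trans h; rewrite mulrC ler_wpM2l // lerDl.
Qed.

Lemma rapx_sum n (f : 'I_n -> R[i] -> R) : (forall i, rapx K (f i)) ->
  rapx K (fun w => \sum_(i < n) f i w).
Proof.
elim: n f => [|n IH] f H.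
  by move=> e e0; exists 0 => w _; rewrite big_ord0 horner0 subr0 normr0 ltW.
have H1 := IH (fun i => f (widen_ord (leqnSn n) i)) (fun i => H _).
by move=> e /(rapxD H1 (H ord_max))[p P]; exists p => w Kw; rewrite big_ord_recr P.
Qed.

Lemma rapx_ext f1 f2 : (forall w, K w -> f1 w = f2 w) -> rapx K f1 -> rapx K f2.
Proof.
by move=> E H e /H[p pP]; exists p => w Kw; rewrite -E // pP.
Qed.

Lemma rapx_lim f : (forall e : R, 0 < e -> exists2 h, papx K h &
  forall w, K w -> `|f w - re (h w)| <= e) -> rapx K f.
Proof.
move=> H e e0; have e2 : 0 < e / 2 by rewrite divr_gt0.
have [h hK fh] := H _ e2; have [p P] := rapx_re hK (fun _ _ => erefl) e2.
exists p => w Kw; rewrite -(subrKA (re (h w))).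
rewrite (le_trans (ler_normD _ _)) //.
by rewrite [e]splitr lerD ?P ?fh.
Qed.

(* Telescoping: with [h_i = (f/N) / (1 - i f/N)], the product of the [1 - h_i]
   is [1 - f], and each [ln |1 - h_i|] is [- Re h_i] up to [O(1/N^2)]. *)
Lemma rapx_ln_normc f : papx K f -> (forall w, K w -> normc (f w) <= 1 / 2) ->
  rapx K (fun w => ln (normc (1 - f w))).
Proof.
move=> H f2; apply: rapx_lim => e e0.
(* Each of the [N] factors costs [13 / N^2], so [13 / N <= e] suffices. The second successor gives
   [N >= 2], hence [|h i w| <= 1 / N <= 1 / 2]. *)
pose N := (Num.truncn (13 / e)).+2.
have N0 : (0 : R) < N%:R by rewrite ltr0n.
have NC0 : (N%:R : R[i]) != 0 by rewrite pnatr_eq0.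
have Ne : 13 / N%:R <= e.
  rewrite ler_pdivrMr // mulrC -ler_pdivrMr // ltW // (lt_trans (truncnS_gt _)) //.
  by rewrite ltr_nat.
pose c i w := i%:R * (N%:R^-1 * f w) : R[i].
pose h i w := (N%:R^-1 * f w) / (1 - c i w).
have nN : normc (N%:R^-1 : R[i]) = N%:R^-1.
  by rewrite ComplexField.Normc.normcV normc_nat.
have cb i w : (i <= N)%N -> K w -> normc (c i w) <= 1 / 2.
  move=> iN Kw; rewrite /c !ComplexField.Normc.normcM nN normc_nat mulrA.
  rewrite -[1 / 2]mul1r; apply: ler_pM; [by posi|exact: normc_ge0| |exact: f2].
  by rewrite ler_pdivrMr // mul1r ler_nat.
have c1 i w : (i <= N)%N -> K w -> 1 / 2 <= normc (1 - c i w).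
  move=> iN Kw; have := normc_sub_ge 1 (c i w); have := cb i w iN Kw.
  by rewrite ComplexField.Normc.normc1; lra.
have Kf a : papx K (fun w => a * f w) by exact: papxM (papx_cst K a) H.
exists (fun w => \sum_(i < N) - h i w).
  apply: (@papx_sum K N (fun i w => - h i w)) => i iN.
  have Ki : papx K (c i) by exact: papxM (papx_cst K _) (Kf _).
  have := papxM (Kf (- N%:R^-1)) (papx_geom Ki (fun w => @cb i w (ltnW iN))).
  by apply: papx_ext => w _; rewrite !mulNr.
have hb i w : (i < N)%N -> K w -> normc (h i w) <= N%:R^-1.
  move=> iN Kw; have c2 := c1 i w (ltnW iN) Kw.
  rewrite /h !ComplexField.Normc.normcM nN ComplexField.Normc.normcV.
  rewrite ler_pdivrMr; last by lra.
  by rewrite ler_pM2l ?invr_gt0 //; apply: le_trans (f2 w Kw) c2.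
move=> w Kw.
have tel n : (n <= N)%N -> `|ln (normc (1 - c n w)) - re (\sum_(i < n) - h i w)|
   <= n%:R * (13 * N%:R^-1 ^+ 2).
  elim: n => [_|n IH nN1].
    by rewrite big_ord0 /c mulr0n !mul0r !subr0 ComplexField.Normc.normc1 ln1 normr0.
  have c2 := c1 n w (ltnW nN1) Kw; have c3 := c1 n.+1 w nN1 Kw.
  have cn0 : 1 - c n w != 0 by rewrite -normc_gt0; apply: lt_le_trans c2.
  have E : 1 - c n.+1 w = (1 - c n w) * (1 - h n w).
    rewrite /h; rewrite mulrBr mulr1 [_ * (_ / _)]mulrCA mulfV // mulr1.
    by rewrite /c -natr1; ring.
  have hn := hb n w nN1 Kw.
  have h0 : 0 < normc (1 - h n w).
    rewrite normc_gt0; apply: contraTneq c3 => E0.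
    by rewrite E E0 mulr0 ComplexField.Normc.normc0 -ltNge.
  rewrite E ComplexField.Normc.normcM lnM ?posrE ?(lt_le_trans _ c2) //.
  rewrite big_ord_recr /= raddfD opprD addrACA -natr1 mulrDl mul1r.
  apply: (le_trans (ler_normD _ _)); apply: lerD; first exact: IH (ltnW nN1).
  have N2 : N%:R^-1 <= 1 / 2 :> R.
    by rewrite div1r lef_pV2 ?posrE ?ltr0n // ler_nat.
  have hh : normc (- h n w) <= 1 / 2 by rewrite normcN (le_trans hn).
  apply: (le_trans (ln_normc_1D_bound hh)).
  by rewrite ler_pM2l ?ltr0n // normcN ler_sqr ?nnegrE ?normc_ge0 // invr_ge0.
have := tel N (leqnn N).
have -> : c N w = f w by rewrite /c mulrA mulfV // mul1r.
move=> /le_trans -> //; apply: le_trans Ne.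
by rewrite le_eqVlt; apply/orP; left; apply/eqP; field; rewrite pnatr_eq0.
Qed.

(** Both properties are carried together because moving the pole of the logarithm away from [z1]
    uses the approximation of [1 / (w - z1)]. *)
Let pole z := papx K (fun w => (w - z)^-1) /\ rapx K (fun w => ln (normc (w - z))).

(** Pole pushing as in Runge's theorem: [w - z = (w - z1) (1 - g w)] with
    [g w = (z - z1) / (w - z1)] of modulus at most 1/2 on [K], so the geometric series handles the
    reciprocal and [rapx_ln_normc] the logarithm. *)
Lemma pole_step z1 z : pole z1 -> ~ K z1 ->
  (forall w, K w -> normc (z - z1) <= 1 / 2 * normc (w - z1)) -> pole z.
Proof.
move=> [H1 H2] Kz1 H.
have n1 w : K w -> w - z1 != 0.
  by move=> Kw; rewrite subr_eq0; apply: contra_not_neq Kz1 => <-.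
pose g w := (z - z1) * (w - z1)^-1.
have Kg : papx K g by exact: papxM (papx_cst K _) H1.
have g2 w : K w -> normc (g w) <= 1 / 2.
  move=> Kw; rewrite /g ComplexField.Normc.normcM ComplexField.Normc.normcV.
  by rewrite ler_pdivrMr ?normc_gt0 ?n1 // H.
have E w : K w -> w - z = (w - z1) * (1 - g w).
  by move=> Kw; rewrite /g mulrBr mulr1 mulrCA mulfV ?n1 // mulr1; ring.
split.
  apply: papx_ext (papxM H1 (papx_geom Kg g2)) => w Kw.
  by rewrite E // invfM.
apply: rapx_ext (rapxD H2 (rapx_ln_normc Kg g2)) => w Kw.
rewrite E // ComplexField.Normc.normcM lnM ?posrE ?normc_gt0 ?n1 //.
rewrite -normc_gt0; have := normc_sub_ge 1 (g w); have := g2 w Kw.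
by rewrite ComplexField.Normc.normc1; lra.
Qed.

Lemma pole_far : 0 < B -> pole ((2 * B)%:C)%C.
Proof.
move=> B0; set z := (_%:C)%C.
have z0 : z != 0.
  by rewrite -normc_gt0 normc_real normr_gt0 mulf_neq0 // gt_eqF.
pose g w := z^-1 * w.
have Kg : papx K g.
  by apply: papx_ext (papx_poly K (z^-1 *: 'X)) => w _; rewrite hornerZ hornerX.
have g2 w : K w -> normc (g w) <= 1 / 2.
  move=> /KB /ltW wB; rewrite /g ComplexField.Normc.normcM ComplexField.Normc.normcV.
  rewrite normc_real ger0_norm; last by rewrite mulr_ge0 // ltW.
  by rewrite mulrC ler_pdivrMr ?mulr_gt0 // mul1r mulrA mulVf // mul1r.
have E w : w - z = - z * (1 - g w).
  by rewrite /g mulrBr mulr1 mulrA mulNr mulfV //; ring.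
split.
  have := papxM (papx_cst K (- z)^-1) (papx_geom Kg g2).
  by apply: papx_ext => w Kw; rewrite E invfM.
have := rapxD (rapx_re (papx_cst K ((ln (normc z))%:C)%C) (fun _ _ => erefl)) (rapx_ln_normc Kg g2).
apply: rapx_ext => w Kw /=.
rewrite E ComplexField.Normc.normcM normcN lnM ?posrE ?normc_gt0 ?z0 //.
rewrite -normc_gt0; have := normc_sub_ge 1 (g w); have := g2 w Kw.
by rewrite ComplexField.Normc.normc1; lra.
Qed.

(* The set of good poles is clopen in the complement of [K]. *)
Lemma rapx_ln_dist z : closed K -> connected (~` K) -> ~ K z ->
  rapx K (fun w => ln (normc (w - z))).
Proof.
move=> cK conK Kz.
have [B0|B0] := ltP 0 B; last first.
  exists 0 => w /KB; rewrite /disk /= => /lt_le_trans /(_ B0).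
  by rewrite ltNge normc_ge0.
pose Z := [set z | ~ K z /\ pole z].
have oZ : open Z.
  apply: openCP => z1 [Kz1 pz1].
  have [d d0 dP] := closed_dist_gt0 cK Kz1.
  exists (d / 2); first by rewrite divr_gt0.
  move=> v; rewrite /cball /= => vz1; split.
    by move=> /dP; apply/negP; rewrite -ltNge (lt_le_trans vz1) //; lra.
  apply: pole_step pz1 Kz1 _ => w /dP dw.
  by apply: (le_trans (ltW vz1)); lra.
have oZc : open (~` K `&` ~` Z).
  apply: openCP => z1 [Kz1 nz1].
  have [d d0 dP] := closed_dist_gt0 cK Kz1.
  (* The pole now moves from [v] back to [z1], so the distance from [v] to [K] has to be twice
     [|v - z1|]: a third of [d] is needed where half sufficed above. *)
  exists (d / 3); first by rewrite divr_gt0.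
  move=> v; rewrite /cball /= => vz1; split.
    by move=> /dP; apply/negP; rewrite -ltNge (lt_le_trans vz1) //; lra.
  move=> [Kv pv]; apply: nz1; split=> //; apply: pole_step pv Kv _ => w /dP dw.
  by have := normc_triangle v w z1; rewrite (normc_distC z1 v); lra.
have ZE : Z = ~` K.
  apply: conK.
  - exists ((2 * B)%:C)%C; split; last exact: pole_far.
    by move=> /KB; rewrite /disk /mkset normc_real ger0_norm => [h|]; lra.
  - exists Z => //; apply/seteqP; split => [x Zx|x []//]; by split=> //; case: Zx.
  - exists (~` (~` K `&` ~` Z)); first exact: open_closedC.
    apply/seteqP; split => [x [Kx px]|x [Kx]].
      by split=> // -[_]; apply.
    by move=> /not_andP[|/contrapT].
have : Z z by rewrite ZE.
by case=> _ [].
Qed.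

End Bounded.
End PolynomialApproximation.

(** * Averages of logarithmic kernels over rings *)

Section SquareRootSum.
Context {R : realType}.
Implicit Types (x y a : R).

(** The odd square root, a primitive of [1 / (2 sqrt |x|)]: sums of inverse square roots telescope
    against it. *)
Definition ssqrt x : R := if 0 <= x then Num.sqrt x else - Num.sqrt (- x).

Lemma ssqrt_sub_le x y : x <= y -> ssqrt y - ssqrt x <= 2 * Num.sqrt (y - x).
Proof.
move=> xy; rewrite /ssqrt.
have s (u v : R) : 0 <= u -> u <= v -> Num.sqrt u <= Num.sqrt v.
  by move=> _ uv; exact: ler_wsqrtr.
have sub (u v : R) : 0 <= u -> u <= v -> Num.sqrt v - Num.sqrt u <= Num.sqrt (v - u).
  move=> u0 uv; rewrite lerBlDr.
  have p : 0 <= Num.sqrt (v - u) + Num.sqrt u by rewrite addr_ge0 ?sqrtr_ge0.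
  rewrite -[leRHS]ger0_norm // -sqrtr_sqr ler_wsqrtr //.
  rewrite sqrrD !sqr_sqrtr ?subr_ge0 //.
  have : 0 <= Num.sqrt (v - u) * Num.sqrt u by rewrite mulr_ge0 ?sqrtr_ge0.
  by rewrite -mulr_natr; lra.
have [x0|x0] := leP 0 x.
  rewrite (le_trans x0 xy); have := sub x y x0 xy.
  have := sqrtr_ge0 (y - x); lra.
have [y0|y0] := leP 0 y.
  have := s y (y - x); have := s (- x) (y - x); lra.
have := sub (- y) (- x); have -> : - x - - y = y - x by ring.
have := sqrtr_ge0 (y - x); lra.
Qed.

Lemma ssqrt_succ x : (Num.sqrt (Num.max `|x| 1))^-1 <= 3 * (ssqrt (x + 1) - ssqrt x).
Proof.
have pos (u : R) : 1 <= u -> 0 < Num.sqrt u by move=> u1; rewrite sqrtr_gt0; lra.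
have M1 : 1 <= Num.max `|x| 1 by rewrite le_max lexx orbT.
have m0 := pos _ M1.
have [x0|x0] := leP 0 x.
  have x10 : 0 <= x + 1 by lra.
  rewrite /ssqrt x0 x10.
  set p := Num.sqrt (x + 1); set q := Num.sqrt x; set m := Num.sqrt (Num.max _ _) in m0 *.
  have p2 : p ^+ 2 = x + 1 by rewrite sqr_sqrtr.
  have q2 : q ^+ 2 = x by rewrite sqr_sqrtr.
  have m2 : m ^+ 2 = Num.max x 1 by rewrite sqr_sqrtr ?(le_trans ler01 M1) // ger0_norm.
  have q0 : 0 <= q by exact: sqrtr_ge0.
  have p0 : 0 < p by rewrite /p sqrtr_gt0; lra.
  have xm : x <= m ^+ 2 by rewrite m2 le_max lexx.
  have om : 1 <= m ^+ 2 by rewrite m2 le_max lexx orbT.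
  have qm : q <= m by apply: ler_wsqrtr; rewrite le_max ger0_norm // lexx.
  have pm : p <= 2 * m.
    by rewrite leNgt; apply/negP => H; nra.
  have E : (p - q) * (p + q) = 1 by rewrite -subr_sqr p2 q2; ring.
  rewrite -[leLHS]mul1r ler_pdivrMr //.
  have pq : 0 < p - q.
    by rewrite ltNge; apply/negP => H; nra.
  have h3 : 0 <= 3 * m - (p + q) by lra.
  by have := mulr_ge0 (ltW pq) h3; rewrite mulrBr E; lra.
have x0F : (0 <= x) = false by rewrite leNgt x0.
have [x1|x1] := leP 0 (x + 1); rewrite /ssqrt x0F ?x1.
  have [y0 y1] : 0 <= - x /\ - x <= 1 by lra.
  have le (u : R) : 0 <= u -> u <= 1 -> u <= Num.sqrt u.
    move=> u0 u1; rewrite -{1}[u]ger0_norm // -sqrtr_sqr ler_wsqrtr //; nra.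
  have x2 : x + 1 <= 1 by lra.
  have := le _ x1 x2; have := le _ y0 y1.
  have : (Num.sqrt (Num.max `|x| 1))^-1 <= 1.
    by rewrite invf_le1 // -{1}[1]sqrtr1; exact: ler_wsqrtr.
  lra.
have -> : (0 <= x + 1) = false by rewrite leNgt x1.
rewrite ltr0_norm //.
have -> : Num.max (- x) 1 = - x by apply/max_idPl; lra.
set p := Num.sqrt (- x); set q := Num.sqrt (- (x + 1)).
have p2 : p ^+ 2 = - x by rewrite sqr_sqrtr //; lra.
have q2 : q ^+ 2 = - x - 1 by rewrite sqr_sqrtr //; lra.
have q0 : 0 <= q by exact: sqrtr_ge0.
have p0 : 0 < p by rewrite /p sqrtr_gt0; lra.
have qp : q <= p by rewrite ler_wsqrtr //; lra.
have E : (p - q) * (p + q) = 1 by rewrite -subr_sqr p2 q2; ring.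
rewrite -[leLHS]mul1r ler_pdivrMr //.
have h3 : 0 <= 3 * p - (p + q) by lra.
have pq : 0 <= p - q by lra.
by have := mulr_ge0 pq h3; rewrite mulrBr E; lra.
Qed.

(** The logarithmic singularity is replaced by an integrable power: [ln (m / n) = - 2 ln v >= - 2 v]
    with [v = sqrt (n / m)]. Telescoping with [ssqrt] bounds the sum of these by
    [2 sqrt n * 3 * 2 sqrt n = 12 n], whatever the position [a] of the singularity. *)
Lemma sum_ln_max_ge a n : (0 < n)%N ->
  - 12 * n%:R <= \sum_(i < n) ln (Num.max `|i%:R - a| 1 / n%:R).
Proof.
move=> n0; have nR : (0 : R) < n%:R by rewrite ltr0n.
have s0 : 0 < Num.sqrt n%:R :> R by rewrite sqrtr_gt0.
have term i : - (2 * Num.sqrt n%:R) * (Num.sqrt (Num.max `|i%:R - a| 1))^-1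
    <= ln (Num.max `|i%:R - a| 1 / n%:R).
  set m := Num.max _ _; have m0 : 0 < m by rewrite lt_max ltr01 orbT.
  set r := Num.sqrt m; have r0 : 0 < r by rewrite sqrtr_gt0.
  have r2 : m = r ^+ 2 by rewrite sqr_sqrtr ?ltW.
  have n2 : n%:R = Num.sqrt n%:R ^+ 2 :> R by rewrite sqr_sqrtr ?ltW.
  set v := Num.sqrt n%:R / r; have v0 : 0 < v by rewrite divr_gt0.
  have -> : m / n%:R = (v ^+ 2)^-1.
    by rewrite {1}r2 {1}n2 /v; field; rewrite !gt_eqF.
  rewrite lnV ?posrE ?exprn_gt0 // lnXn // mulr2n.
  have : ln v <= v.
    by have := @le_ln1Dx R (v - 1); rewrite subrKC => /(_ _); lra.
  by rewrite mulNr -mulrA -/v; lra.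
apply: (@le_trans _ _ (\sum_(i < n) - (2 * Num.sqrt n%:R)
    * (Num.sqrt (Num.max `|i%:R - a| 1))^-1)); last by apply: ler_sum => i _; exact: term.
rewrite -mulr_sumr mulNr mulNr lerN2.
have tel : \sum_(i < n) (Num.sqrt (Num.max `|i%:R - a| 1))^-1
    <= 3 * (ssqrt (n%:R - a) - ssqrt (- a)).
  elim: n {n0 nR s0 term} => [|n IH]; first by rewrite big_ord0 sub0r subrr mulr0.
  rewrite big_ord_recr /=; apply: (le_trans (lerD IH (ssqrt_succ _))).
  rewrite -[n.+1%:R]natr1 (_ : n%:R - a + 1 = n%:R + 1 - a); last by ring.
  by lra.
have le1 : - a <= n%:R - a by lra.
have H := ssqrt_sub_le le1.
have E : n%:R - a - - a = n%:R by ring.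
rewrite E in H.
have nE : n%:R = Num.sqrt n%:R * Num.sqrt n%:R :> R by rewrite -expr2 sqr_sqrtr ?ltW.
by rewrite [X in _ <= 12 * X]nE; nra.
Qed.

End SquareRootSum.

(** * Rings of poles off [K] *)

Section Ring.
Context {R : realType}.
Variables (K : set R[i]) (B : R).
Hypotheses (KB : K `<=` disk B) (cK : closed K) (conK : connected (~` K)).
Implicit Types (z w : R[i]).

(** If the circle lay in [K], its open disk would cut out a nonempty clopen part of the connected
    complement, hence all of it; but the complement of the bounded set [K] contains points
    arbitrarily far away. *)
Lemma circle_meets_compl z z1 t : ~ K z1 -> normc (z1 - z) < t ->
  exists2 u, normc (u - z) = t & ~ K u.
Proof.
move=> Kz1 zt; apply: contrapT => /forall2NP H.
have {}H u : ~ K u -> normc (u - z) <> t.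
  by move=> Ku ut; case: (H u) => // /contrapT.
have t0 : 0 < t := le_lt_trans (normc_ge0 _) zt.
have E : ~` K `&` cball z t = ~` K.
  apply: conK.
  - by exists z1; split.
  - by exists (cball z t) => //; exact: open_cball.
  - exists (~` [set u | t < normc (u - z)]).
      apply: open_closedC; apply: openCP => u /= ut.
      exists (normc (u - z) - t); first by rewrite subr_gt0.
      move=> v; rewrite /cball /= => vu.
      by have := normc_triangle v u z; rewrite (normc_distC u v); lra.
    apply/seteqP; split => u [Ku ut]; split=> //.
      by move=> /= /(lt_trans ut); rewrite ltxx.
    rewrite /cball /= lt_neqAle; apply/andP; split; first exact/eqP/H.
    by rewrite leNgt; apply/negP.
pose s := t + `|B| + normc z + 1.
have s0 : 0 <= s by rewrite /s; have := normc_ge0 z; have := normr_ge0 B; lra.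
have : (~` K `&` cball z t) (z + (s%:C)%C).
  rewrite E => /KB; rewrite /disk /mkset => h.
  have := normc_sub_ge (s%:C)%C (- z); rewrite opprK addrC normcN normc_real.
  by move: h; rewrite (ger0_norm s0) [z + _]addrC /s; have := ler_norm B; lra.
case=> _; rewrite /cball /mkset addrC addKr normc_real ger0_norm // /s => h.
by have := normc_ge0 z; have := normr_ge0 B; lra.
Qed.

(** A point off [K] on one circle is carried to circles of nearby radii by scaling from [z] and
    keeps half of its distance to [K]. Compactness of the interval of radii makes the clearance
    uniform. *)
Lemma ring_clearance z z1 rho : ~ K z1 -> normc (z1 - z) < rho ->
  exists2 d, 0 < d < rho & forall t, rho <= t <= 2 * rho ->
    exists2 u, normc (u - z) = t & forall w, K w -> d <= normc (w - u).
Proof.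
move=> Kz1 z1r.
have rho0 : 0 < rho := le_lt_trans (normc_ge0 _) z1r.
pose P (d t : R) := exists2 u, normc (u - z) = t & forall w, K w -> d <= normc (w - u).
have cI : compact `[rho, 2 * rho] by exact: segment_compact.
have near_P t : `[rho, 2 * rho]%classic t ->
    \forall t' \near t & d \near 0^'+, P d t'.
  rewrite /= in_itv /= => /andP[t1 t2].
  have t0 : 0 < t by lra.
  have [u ut Ku] := circle_meets_compl Kz1 (lt_le_trans z1r t1).
  have [e e0 eP] := closed_dist_gt0 cK Ku.
  exists ([set t' : R | `|t - t'| < Num.min (e / 2) t], [set d | d < e / 2]) => /=.
    split; last by apply: nbhs_right_lt; rewrite divr_gt0.
    apply/nbhs_normP; exists (Num.min (e / 2) t) => //=.
    by rewrite lt_min divr_gt0.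
  move=> [t' d] /= [+ dlt]; rewrite lt_min => /andP[tt te].
  have t'0 : 0 < t' by move: te; rewrite ltr_norml => /andP[]; lra.
  exists (z + ((t' / t)%:C)%C * (u - z)).
    rewrite addrC addKr ComplexField.Normc.normcM ut normc_real gtr0_norm ?divr_gt0 //.
    by field; rewrite gt_eqF.
  move=> w /eP wu.
  set v := z + _.
  have vu : normc (v - u) = `|t - t'|.
    have -> : v - u = (((t' - t) / t)%:C)%C * (u - z).
      rewrite /v mulrBl divff ?gt_eqF // rmorphB rmorph1; ring.
    rewrite ComplexField.Normc.normcM normc_real ut normrM normfV (gtr0_norm t0).
    by rewrite mulfVK ?gt_eqF // distrC.
  by have := normc_triangle v w u; lra.
have := (iffLR (compact_near_coveringP _) cI) _ _ _ _ near_P.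
move=> H.
near (0 : R)^'+ => d.
exists d.
  by apply/andP; split; near: d; [exact: nbhs_right_gt|exact: nbhs_right_lt].
move=> t tI; have : `[rho, 2 * rho] `<=` P d by near: d; exact: H.
by apply; rewrite /= in_itv.
Unshelve. all: by end_near. Qed.

(* [l] is an average of [ln |. - u_i|] over points [u_i] off [K] whose
   distances to [z] are evenly spread over [[rho, 2 rho]]; such points exist
   since the complement of [K] is connected. *)
Lemma ring_potential z z1 rho : ~ K z1 -> normc (z1 - z) < rho ->
  exists l : R[i] -> R, [/\ continuous l, rapx K l,
    forall w, l w <= ln (normc (w - z) + 2 * rho),
    forall w, ln (Num.max (normc (w - z)) rho) - 15 <= l w &
    forall w, 4 * rho <= normc (w - z) -> ln (normc (w - z) - 2 * rho) <= l w].
Proof.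
move=> Kz1 z1r.
have rho0 : 0 < rho := le_lt_trans (normc_ge0 _) z1r.
have [d /andP[d0 dr] H] := ring_clearance Kz1 z1r.
(* The spacing [rho / N] of the radii is at most [d], so truncating the kernels at [d] never spoils
   the lower bound, which allows for one spacing around the singularity. *)
pose N := (Num.truncn (rho / d)).+1.
have N0 : (0 : R) < N%:R by rewrite ltr0n.
have Nd : rho / N%:R <= d.
  by rewrite ler_pdivrMr // mulrC -ler_pdivrMr // ltW // truncnS_gt.
pose t (i : nat) := rho * (1 + i%:R / N%:R) : R.
have tb (i : 'I_N) : rho <= t i <= 2 * rho.
  have i0 : 0 <= i%:R / N%:R :> R by rewrite divr_ge0.
  have i1 : i%:R / N%:R <= 1 :> R by rewrite ler_pdivrMr // mul1r ler_nat ltnW.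
  by rewrite /t; apply/andP; split; nra.
have /choice[u uP] (i : 'I_N) : exists u : R[i], normc (u - z) = t i /\
    forall w, K w -> d <= normc (w - u).
  by have [v ? ?] := H _ (tb i); exists v.
pose l w := N%:R^-1 * \sum_(i < N) ln (Num.max (normc (w - u i)) d).
have avg_le (F : 'I_N -> R) c : (forall i, F i <= c) -> N%:R^-1 * \sum_(i < N) F i <= c.
  move=> Fc; rewrite mulrC ler_pdivrMr // mulr_natr -[X in _ *+ X]card_ord -sumr_const.
  by apply: ler_sum => i _.
have avg_ge (F : 'I_N -> R) c : (forall i, c <= F i) -> c <= N%:R^-1 * \sum_(i < N) F i.
  move=> Fc; rewrite mulrC ler_pdivlMr // mulr_natr -[X in _ *+ X]card_ord -sumr_const.
  by apply: ler_sum => i _.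
have m0 w i : 0 < Num.max (normc (w - u i)) d by rewrite lt_max d0 orbT.
have up w : l w <= ln (normc (w - z) + 2 * rho).
  apply: avg_le => i; rewrite ler_ln ?posrE //; last first.
    by have := normc_ge0 (w - z); lra.
  rewrite ge_max; have := normc_ge0 (w - z) => wz0.
  apply/andP; split; last by lra.
  have := normc_triangle z w (u i); rewrite (normc_distC z).
  by have [-> _] := uP i; have /andP[_] := tb i; lra.
have lo w : ln rho - 12 <= l w.
  (* The fractional index at which the radius equals [|w - z|]:
     [t i - |w - z| = (rho / N) (i - a)]. *)
  pose a := N%:R * (normc (w - z) / rho - 1).
  have := sum_ln_max_ge a (ltn0Sn (Num.truncn (rho / d))); rewrite -/N => S.
  have : \sum_(i < N) (ln rho + ln (Num.max `|i%:R - a| 1 / N%:R))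
     <= \sum_(i < N) ln (Num.max (normc (w - u i)) d).
    apply: ler_sum => i _.
    have p0 : 0 < Num.max `|i%:R - a| 1 by rewrite lt_max ltr01 orbT.
    rewrite -lnM ?posrE ?divr_gt0 // ler_ln ?posrE ?mulr_gt0 ?divr_gt0 ?invr_gt0 //.
    rewrite le_max; have [h|h] := leP `|i%:R - a| 1.
      by apply/orP; right; rewrite mul1r.
    apply/orP; left; have [ui _] := uP i.
    have -> : rho * (`|i%:R - a| / N%:R) = `|t i - normc (w - z)|.
      have -> : t i - normc (w - z) = rho / N%:R * (i%:R - a).
        by rewrite /t /a; field; rewrite !gt_eqF.
      by rewrite normrM gtr0_norm ?divr_gt0 //; ring.
    rewrite ler_norml -ui; have := normc_triangle w (u i) z.
    by have := normc_triangle (u i) w z; rewrite (normc_distC (u i) w); lra.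
  rewrite big_split /= sumr_const card_ord => S2.
  rewrite /l mulrC ler_pdivlMr //.
  by apply: le_trans S2; rewrite -[ln rho *+ N]mulr_natr; lra.
have far w : 4 * rho <= normc (w - z) -> ln (normc (w - z) - 2 * rho) <= l w.
  move=> wz; apply: avg_ge => i; rewrite ler_ln ?posrE //; last by lra.
  rewrite le_max; apply/orP; left.
  have := normc_triangle (u i) w z; have [-> _] := uP i.
  by have /andP[_] := tb i; lra.
exists l; split=> //.
- by apply/contZ/cont_sum => i; exact: continuous_ln_max.
- apply/rapxZ/rapx_sum => i; have [_ uK] := uP i.
  have Ku : ~ K (u i).
    by move=> /uK; rewrite subrr ComplexField.Normc.normc0 leNgt d0.
  apply: rapx_ext (rapx_ln_dist KB cK conK Ku) => w Kw.
  by rewrite (max_idPl _) // uK.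
- move=> w; have [h|h] := leP (4 * rho) (normc (w - z)).
    rewrite (max_idPl _); last by lra.
    apply: le_trans (far w h).
    have h2 : normc (w - z) / 2 <= normc (w - z) - 2 * rho by lra.
    have wz0 : 0 < normc (w - z) by lra.
    apply: (@le_trans _ _ (ln (normc (w - z) / 2))); last first.
      by rewrite ler_ln ?posrE //; lra.
    rewrite ln_div ?posrE //; have := @ln1D_le R 1 ler01.
    by rewrite (_ : 1 + 1 = 2) //; lra.
  (* The constant 15 is the 12 of [lo] plus the bound 3 for [ln 4]. *)
  apply: le_trans (lo w).
  have : ln (Num.max (normc (w - z)) rho) <= ln (4 * rho).
    rewrite ler_ln ?posrE ?mulr_gt0 ?lt_max ?rho0 ?orbT //.
    by rewrite ge_max (ltW h); lra.
  rewrite lnM ?posrE //; have := @ln1D_le R 3 (ler0n _ _).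
  by rewrite (_ : 1 + 3 = 4); [lra|ring].
Qed.

End Ring.

(** * Root averages and integrals *)

Ltac case_max :=
  repeat match goal with |- context[Order.max ?x ?y] => case: (leP x y) => ? end.

Section Functionals.
Context {R : realType}.
Implicit Types (z w : R[i]) (f g : R[i] -> R).

Lemma horner_continuous (p : {poly R[i]}) z (e : R) : 0 < e ->
  exists2 d, 0 < d & forall w, normc (w - z) < d -> normc (p.[w] - p.[z]) < e.
Proof.
move=> e0; have /factor_theorem[q qE] : root (p - p.[z]%:P) z.
  by rewrite rootE hornerD hornerN hornerC subrr.
have [M M0 MP] := horner_bounded q (normc z + 1).
exists (Num.min 1 (e / (M + 1))).
  by rewrite lt_min ltr01 divr_gt0 // ltr_wpDl.
move=> w; rewrite lt_min => /andP[w1 we].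
have -> : p.[w] - p.[z] = q.[w] * (w - z).
  have := congr1 (horner^~ w) qE.
  by rewrite hornerM hornerD hornerN hornerC hornerXsubC.
have wB : normc w < normc z + 1 by have := normc_sub_ge w z; lra.
rewrite ComplexField.Normc.normcM.
apply: (@le_lt_trans _ _ ((M + 1) * normc (w - z))).
  by rewrite ler_wpM2r ?normc_ge0 // (le_trans (MP _ wB)) // lerDl.
by rewrite mulrC -ltr_pdivlMr // ltr_wpDl.
Qed.

Lemma re_horner_continuous (p : {poly R[i]}) : continuous (fun w => re p.[w]).
Proof.
apply: continuousCP => z e e0; have [d d0 dP] := horner_continuous p z e0.
exists d => // w /dP; apply: le_lt_trans; apply: le_trans (normr_re _).
by case: (p.[w]) => a b; case: (p.[z]).
Qed.

Definition avg (s : seq R[i]) f : R := (size s)%:R^-1 * \sum_(z <- s) f z.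

Lemma avgD s f g : avg s (fun w => f w + g w) = avg s f + avg s g.
Proof. by rewrite /avg big_split mulrDr. Qed.

Lemma avgZ s (c : R) f : avg s (fun w => c * f w) = c * avg s f.
Proof. by rewrite /avg -mulr_sumr mulrCA. Qed.

Lemma avg_cst s (c : R) : (0 < size s)%N -> avg s (fun=> c) = c.
Proof.
move=> s0; rewrite /avg big_const_seq count_predT iter_addr_0 -[c *+ _]mulr_natl.
by rewrite mulKf // pnatr_eq0 -lt0n.
Qed.

Lemma avg_le s f g : (forall w, w \in s -> f w <= g w) -> avg s f <= avg s g.
Proof.
move=> fg; rewrite /avg ler_wpM2l ?invr_ge0 //.
by rewrite big_seq [leRHS]big_seq ler_sum.
Qed.

Lemma avg_sum s n (F : 'I_n -> R[i] -> R) :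
  avg s (fun w => \sum_(i < n) F i w) = \sum_(i < n) avg s (F i).
Proof. by rewrite /avg exchange_big mulr_sumr. Qed.

(** An integral against a probability measure, reduced to its action on continuous functions;
    comparison on [S] alone expresses that the measure is carried by [S]. *)
Record functional (S : set R[i]) (E : (R[i] -> R) -> R) : Prop := Functional {
  funD : forall f g, continuous f -> continuous g ->
    E (fun w => f w + g w) = E f + E g;
  funZ : forall (c : R) f, continuous f -> E (fun w => c * f w) = c * E f;
  fun_le : forall f g, continuous f -> continuous g ->
    (forall w, S w -> f w <= g w) -> E f <= E g;
  fun1 : E (fun=> 1) = 1 }.

Section FunctionalTheory.
Variables (S : set R[i]) (E : (R[i] -> R) -> R).
Hypothesis fE : functional S E.

Lemma fun_cst (c : R) : E (fun=> c) = c.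
Proof.
have H : E (fun=> c * 1) = c * E (fun=> 1) := funZ fE c (@cont_cst R 1).
by rewrite (fun1 fE) !mulr1 in H.
Qed.

Lemma funB f g : continuous f -> continuous g ->
  E (fun w => f w - g w) = E f - E g.
Proof.
move=> cf cg; have c' := @contZ R (-1) _ cg.
have := funD fE cf c'; rewrite (funZ fE) // mulN1r => <-.
by congr E; apply/funext => w; rewrite mulN1r.
Qed.

Lemma fun_sum n (F : 'I_n -> R[i] -> R) : (forall i, continuous (F i)) ->
  E (fun w => \sum_(i < n) F i w) = \sum_(i < n) E (F i).
Proof.
elim: n F => [|n IH] F cF.
  by rewrite big_ord0 -[RHS](fun_cst 0); congr E; apply/funext => w; rewrite big_ord0.
rewrite big_ord_recr /= -IH // -(funD fE) //; last exact: cont_sum.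
by congr E; apply/funext => w; rewrite big_ord_recr.
Qed.

Lemma fun_norm_le f g : continuous f -> continuous g ->
  (forall w, S w -> `|f w| <= g w) -> `|E f| <= E g.
Proof.
move=> cf cg H; rewrite ler_norml; apply/andP; split; last first.
  by apply: (fun_le fE) => // w /H; apply: le_trans; exact: ler_norm.
rewrite lerNl -mulN1r -(funZ fE) //; apply: (fun_le fE) => //.
  exact: contZ.
by move=> w /H; rewrite mulN1r ler_norml => /andP[]; lra.
Qed.

End FunctionalTheory.

Lemma contB f g : continuous f -> continuous g -> continuous (fun w => f w - g w).
Proof. by move=> cf cg z; exact: cvgB (cf z) (cg z). Qed.

Lemma cont_norm f : continuous f -> continuous (fun w => `|f w|).
Proof. by move=> cf z; exact: cvg_norm (cf z). Qed.

Lemma avg_norm_le s f g : (forall w, w \in s -> `|f w| <= g w) -> `|avg s f| <= avg s g.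
Proof.
move=> H; rewrite ler_norml; apply/andP; split; last first.
  by apply: avg_le => w /H; apply: le_trans; exact: ler_norm.
rewrite lerNl -mulN1r -avgZ; apply: avg_le => w /H.
by rewrite mulN1r ler_norml => /andP[]; lra.
Qed.

Definition tent z (r : R) w : R := Num.max 0 (Num.min 1 (2 - normc (w - z) / r)).

Lemma tent_ge0 z r w : 0 <= tent z r w.
Proof. by rewrite le_max lexx. Qed.

Lemma tent_le1 z r w : tent z r w <= 1.
Proof. by rewrite ge_max ler01 ge_min lexx. Qed.

Lemma tent_in z r w : 0 < r -> normc (w - z) <= r -> tent z r w = 1.
Proof.
move=> r0 wr; have : normc (w - z) / r <= 1 by rewrite ler_pdivrMr // mul1r.
rewrite /tent => h; rewrite (min_idPl _); last by lra.
by apply/max_idPr.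
Qed.

Lemma tent_out z r w : 0 < r -> 2 * r <= normc (w - z) -> tent z r w = 0.
Proof.
move=> r0 wr; have : 2 <= normc (w - z) / r by rewrite ler_pdivlMr.
by move=> h; apply/max_idPl; rewrite ge_min; apply/orP; right; lra.
Qed.

Lemma tent_continuous z r : 0 < r -> continuous (tent z r).
Proof.
move=> r0; apply: (@lipschitzC_continuous R r^-1) => u w.
have h1 : normc (u - z) / r <= normc (w - u) / r + normc (w - z) / r.
  rewrite -mulrDl ler_pM2r ?invr_gt0 //.
  by have := normc_triangle w u z; rewrite (normc_distC u w).
have n0 : 0 <= normc (w - u) / r by rewrite divr_ge0 ?normc_ge0 // ltW.
rewrite mulrC /tent.
set a := normc (w - z) / r in h1 *; set b := normc (u - z) / r in h1 *.
set c := normc (w - u) / r in h1 n0 *.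
case: (leP 1 (2 - a)) => ?; case: (leP 1 (2 - b)) => ?;
  case_max; lra.
Qed.

Lemma tent_mono z r r' w : 0 < r -> r <= r' -> tent z r w <= tent z r' w.
Proof.
move=> r0 rr; have h : normc (w - z) / r' <= normc (w - z) / r.
  by rewrite ler_wpM2l ?normc_ge0 // lef_pV2 ?posrE // (lt_le_trans r0).
rewrite /tent.
case: (leP 1 (2 - normc (w - z) / r)) => ?; case: (leP 1 (2 - normc (w - z) / r')) => ?;
  case_max; lra.
Qed.

Definition good (s : nat -> seq R[i]) (E : (R[i] -> R) -> R) f : Prop :=
  forall e : R, 0 < e -> \forall k \near \oo, `|avg (s k) f - E f| <= e.

(* [s k] is the sequence of roots of the [k]-th polynomial, [E] the integral
   against the equilibrium measure and [S] a set carrying that measure. *)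
Record setting (K S : set R[i]) (B : R) (s : nat -> seq R[i])
    (E : (R[i] -> R) -> R) : Prop := Setting {
  set_gt0 : 0 < B;
  set_disk : K `<=` disk B;
  set_sub : S `<=` K;
  set_closed : closed K;
  set_connected : connected (~` K);
  set_functional : functional S E;
  set_roots : \forall k \near \oo, (0 < size (s k))%N /\
    forall z, z \in s k -> normc z < B;
  set_centers : forall L : set R[i], closed L -> L `&` K = set0 ->
    forall e : R, 0 < e -> \forall k \near \oo, avg (s k) (\1_L : R[i] -> R) <= e;
  set_poly : forall p : {poly R[i]}, good s E (fun w => re p.[w]);
  set_no_atom : forall e : R, 0 < e ->
    exists2 d : R, 0 < d & forall z, E (tent z d) <= e }.

Section Limits.
Variables (K S : set R[i]) (B : R) (s : nat -> seq R[i]) (E : (R[i] -> R) -> R).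
Hypothesis H : setting K S B s E.
Let B0 := set_gt0 H.
Let KB := set_disk H.
Let SK := set_sub H.
Let cK := set_closed H.
Let conK := set_connected H.
Let fE := set_functional H.
Let sP := set_roots H.
Let sK := set_centers H.
Let poly_good := set_poly H.
Let no_atom := set_no_atom H.

(** Approximation on [K] says nothing at roots outside [K]. By continuity the error is still small
    near [K], the set [L] where it is not is closed and disjoint from [K], and weak centering makes
    the mass of the roots in [L] vanish, so the crude bound [M'] is enough there. *)
Lemma good_rapx f M : continuous f -> (forall w, normc w < B -> `|f w| <= M) ->
  rapx K f -> good s E f.
Proof.
move=> cf fM rf e e0; have e4 : 0 < e / 6 by rewrite divr_gt0.
have [p pP] := rf _ e4.
pose h w := f w - re p.[w].
have ch : continuous h by apply: contB => //; exact: re_horner_continuous.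
have [Mp Mp0 MpP] := horner_bounded p B.
pose M' := `|M| + Mp + 1.
have M'0 : 0 < M' by rewrite /M'; have := normr_ge0 M; lra.
pose L := [set w | e / 3 <= `|h w|].
have cL : closed L.
  rewrite (_ : L = (fun w => `|h w|) @^-1` [set x | e / 3 <= x]) //.
  apply: closed_comp; last exact: closed_ge.
  by move=> w _; apply: cont_norm.
have LK : L `&` K = set0.
  by apply/seteqP; split => w // -[wL /pP wK]; move: wL; rewrite /L /mkset /h; lra.
have e6 : 0 < e / (6 * M') by rewrite divr_gt0 ?mulr_gt0.
near=> k.
have [s0 sB] : (0 < size (s k))%N /\ forall z, z \in s k -> normc z < B by near: k.
have g1 : `|avg (s k) (fun w => re p.[w]) - E (fun w => re p.[w])| <= e / 6.
  by near: k; exact: poly_good.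
have g2 : avg (s k) (\1_L : R[i] -> R) <= e / (6 * M') by near: k; exact: sK.
have fhE : f = (fun w => h w + re p.[w]).
  by apply/funext => w; rewrite /h subrK.
have E1 : `|E h| <= e / 6.
  apply: (le_trans (fun_norm_le fE ch (@cont_cst R (e / 6)) _)).
    by move=> w /SK /pP.
  by rewrite (fun_cst fE).
have A1 : `|avg (s k) h| <= e / 3 + M' * (e / (6 * M')).
  apply: (@le_trans _ _ (avg (s k) (fun w => e / 3 + M' * \1_L w))).
    apply: avg_norm_le => w /sB wB.
    have [wL|wL] := ltP `|h w| (e / 3).
      by rewrite (le_trans (ltW wL)) // lerDl mulr_ge0 ?(ltW M'0) // indicE ler0n.
    rewrite indicE mem_set // mulr1.
    have := fM w wB; have := MpP w wB; have := normr_re p.[w].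
    have := ler_normB (f w) (re p.[w]); have := ler_norm M; rewrite -/(h w) /M'; lra.
  by rewrite avgD avg_cst // lerD2l avgZ; apply: ler_wpM2l => //; exact: ltW.
have ME : M' * (e / (6 * M')) = e / 6 by field; rewrite gt_eqF.
rewrite fhE avgD (funD fE) //; last exact: re_horner_continuous.
move: g1 E1 A1; rewrite ME !ler_norml => /andP[? ?] /andP[? ?] /andP[? ?].
apply/andP; split; lra.
Unshelve. all: by end_near. Qed.

Lemma good_ring z z1 rho : ~ K z1 -> normc (z1 - z) < rho ->
  exists l : R[i] -> R, [/\ continuous l, good s E l,
    forall w, l w <= ln (normc (w - z) + 2 * rho),
    forall w, ln (Num.max (normc (w - z)) rho) - 15 <= l w &
    forall w, 4 * rho <= normc (w - z) -> ln (normc (w - z) - 2 * rho) <= l w].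
Proof.
move: (B0) => B0' Kz1 zr; have rho0 : 0 < rho := le_lt_trans (normc_ge0 _) zr.
have [l [cl rl up lo far]] := ring_potential KB cK conK Kz1 zr.
exists l; split=> //; apply: (@good_rapx l (`|ln (B + normc z + 2 * rho)| + `|ln rho - 15|)) => //.
move=> w wB; have wz : normc (w - z) <= B + normc z.
  by have := le_normcD w (- z); rewrite normcN; lra.
have n0 := normc_ge0 (w - z).
have l1 : l w <= ln (B + normc z + 2 * rho).
  by apply: le_trans (up w) _; rewrite ler_ln ?posrE; lra.
have l2 : ln rho - 15 <= l w.
  by apply: le_trans (lo w); rewrite lerB // ler_ln ?posrE ?lt_max ?rho0 ?orbT // le_max lexx orbT.
have := ler_norm (ln (B + normc z + 2 * rho)); have := ler_norm (- (ln rho - 15)).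
rewrite normrN.
have := normr_ge0 (ln (B + normc z + 2 * rho)); have := normr_ge0 (ln rho - 15).
by rewrite ler_norml => ? ? ? ?; apply/andP; split; lra.
Qed.

(* The upper bound [ln (4 rho)] of the ring potential near its centre turns a
   concentration of roots there into a very negative average, while the
   average of the ring potential for [E] is controlled by [no_atom]. *)
Lemma no_concentration (e : R) : 0 < e -> exists2 r : R, 0 < r &
  (forall z, E (tent z r) <= e) /\
  (forall z z1, normc z < B + 3 -> ~ K z1 -> normc (z1 - z) < r ->
    \forall k \near \oo, avg (s k) (tent z r) <= e).
Proof.
move: (B0) => B0' e0; have e4 : 0 < e / 4 by rewrite divr_gt0.
have [d0 d00 d0P] := no_atom e4.
pose d := Num.min d0 1.
have dp : 0 < d by rewrite lt_min d00 ltr01.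
have d1 : d <= 1 by rewrite ge_min lexx orbT.
have bc z r : 0 < r -> continuous (tent z r) by move=> r0; exact: tent_continuous.
have dP z : E (tent z d) <= e / 4.
  apply: le_trans (d0P z); apply: (fun_le fE); try exact: bc.
  by move=> w _; apply: tent_mono => //; rewrite ge_min lexx.
have lnd : ln d <= 0 by rewrite ln_le0.
(* Bounds the ring potential at every root: [|w - z| + 2 r] is at most [B + (B + 3) + 2]. *)
pose C := ln (2 * B + 5).
have C0 : 0 <= C by apply: ln_ge0; lra.
have CE : C = ln (2 * B + 5) by []; clearbody C.
(* With [r = exp (- La)], the summand 6 gives [ln (4 r) <= - La / 2], the summand [- ln d] gives
   [r <= d], and the quotient lets [e / 4 * La] absorb all constants: the 15 of the ring potential,
   the error 1 in [gk], and [C - ln d]. *)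
pose La := 6 - ln d + (C - ln d + 16) / (e / 4).
have La6 : 6 <= La.
  have : 0 <= (C - ln d + 16) / (e / 4) by rewrite divr_ge0 //; lra.
  by rewrite /La; lra.
have Lad : - ln d <= La.
  have : 0 <= (C - ln d + 16) / (e / 4) by rewrite divr_ge0 //; lra.
  by rewrite /La; lra.
have LaC : C - ln d + 16 <= e / 4 * La.
  have h : e / 4 * ((C - ln d + 16) / (e / 4)) = C - ln d + 16.
    by field; rewrite gt_eqF.
  have h2 : 0 <= e / 4 * (6 - ln d) by rewrite mulr_ge0 //; lra.
  by rewrite /La mulrDr h; lra.
pose r := expR (- La).
have r0 : 0 < r := expR_gt0 _.
have lnr : ln r = - La by rewrite /r expRK.
have rd : r <= d by rewrite -ler_ln ?posrE // lnr; lra.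
have ln4 : ln 4 <= 3 :> R.
  by have := @ln1D_le R 3 (ler0n _ _); rewrite (_ : 1 + 3 = 4) //; ring.
clearbody La.
have ln4r : ln (4 * r) <= - La / 2 by rewrite lnM ?posrE // lnr; lra.
exists r => //; split.
  move=> z; apply: (@le_trans _ _ (E (tent z d))).
    by apply: (fun_le fE); [exact: bc|exact: bc|move=> w _; exact: tent_mono].
  by apply: le_trans (dP z) _; lra.
move=> z z1 zB Kz1 zr.
have [l [cl gl up lo far]] := good_ring Kz1 zr.
near=> k.
have [s0 sB] : (0 < size (s k))%N /\ forall z, z \in s k -> normc z < B by near: k.
have gk : `|avg (s k) l - E l| <= 1 by near: k; exact: gl.
have E1 : ln r * (e / 4) + ln d - 15 <= E l.
  have cg : continuous (fun w => ln r * tent z d w + (ln d - 15)).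
    by apply: contD; [exact/contZ/bc|exact: cont_cst].
  have : E (fun w => ln r * tent z d w + (ln d - 15)) <= E l.
    apply: (fun_le fE) => // w _; apply: le_trans (lo w).
    rewrite addrA lerD2r; have [h|h] := leP (normc (w - z)) d.
      rewrite tent_in // mulr1; apply: (@le_trans _ _ (ln r)); first lra.
      by rewrite ler_ln ?posrE ?lt_max ?r0 ?orbT // le_max lexx orbT.
    apply: (@le_trans _ _ (ln d)); last first.
      by rewrite ler_ln ?posrE ?lt_max ?r0 ?orbT // le_max (ltW h).
    by rewrite gerDr lnr mulNr oppr_le0 mulr_ge0 ?tent_ge0 //; lra.
  rewrite (funD fE) ?(funZ fE) ?(fun_cst fE); try exact: cont_cst; try exact: bc; last first.
    by apply/contZ/bc.
  have : ln r * (e / 4) <= ln r * E (tent z d) by rewrite lnr !mulNr lerN2 ler_wpM2l //; lra.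
  by lra.
have A1 : avg (s k) l <= ln (4 * r) * avg (s k) (tent z r) + C.
  rewrite -avgZ -[C in leRHS](@avg_cst (s k) C) // -avgD; apply: avg_le => w /sB wB.
  apply: (le_trans (up w)).
  have n0 := normc_ge0 (w - z).
  have [h|h] := leP (2 * r) (normc (w - z)).
    rewrite tent_out // mulr0 add0r CE ler_ln ?posrE; [|lra|lra].
    have := le_normcD w (- z); rewrite normcN; lra.
  apply: (@le_trans _ _ (ln (4 * r))); first by rewrite ler_ln ?posrE; lra.
  have := tent_le1 z r w; have := tent_ge0 z r w => b0 b1.
  have : 0 <= - ln (4 * r) * (1 - tent z r w) by rewrite mulr_ge0 //; lra.
  by lra.
have a0 : 0 <= avg (s k) (tent z r).
  by rewrite -(@avg_cst (s k) 0) //; apply: avg_le => w _; exact: tent_ge0.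
have A2 : La / 2 * avg (s k) (tent z r) <= La / 2 * e.
  have : ln (4 * r) * avg (s k) (tent z r) <= - La / 2 * avg (s k) (tent z r).
    by rewrite ler_wpM2r.
  move: gk E1; rewrite lnr ler_norml => /andP[g1 g2]; lra.
by rewrite ler_pM2l in A2; lra.
Unshelve. all: by end_near. Qed.

End Limits.
End Functionals.

(** * Potentials near the complement of K *)

Section LogLike.
Context {R : realType}.
Implicit Types (z w u : R[i]) (f g l : R[i] -> R).

(** Covers both regularisations in use: [kap h] for the roots and the truncated logarithm in the
    maximum principle for [omega]. *)
Definition log_like z (h : R) f : Prop := continuous f /\
  forall w, ln (Num.max (normc (w - z)) h) <= f w <= ln (normc (w - z) + h).

(** Within [r] of [u] the two kernels differ by at most 15 + [ln 2] one way and [ln 12] the other.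
    Farther away the poles are displaced by [O(h)], which changes the logarithm by [O(h / r)]. The
    ring has radius [5 h] because it is centred at a grid point within [h] of [z], while a point off
    [K] lies within [4 h] of [z]. *)
Lemma log_like_sub_ring z u (h r : R) f l w : 0 < h -> 40 * h <= r ->
  normc (z - u) <= h -> log_like z h f ->
  (forall w, l w <= ln (normc (w - u) + 2 * (5 * h))) ->
  (forall w, ln (Num.max (normc (w - u)) (5 * h)) - 15 <= l w) ->
  (forall w, 4 * (5 * h) <= normc (w - u) -> ln (normc (w - u) - 2 * (5 * h)) <= l w) ->
  `|f w - l w| <= 16 * tent u r w + 16 * h / r.
Proof.
move=> h0 hr zu [_ /(_ w)/andP[f1 f2]] /(_ w) up /(_ w) lo /(_ w) far.
set t := normc (w - u) in up lo far; set x := normc (w - z) in f1 f2.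
have r0 : 0 < r by lra.
have t0 : 0 <= t := normc_ge0 _; have x0 : 0 <= x := normc_ge0 _.
have tx : t <= x + h by have := normc_triangle z w u; rewrite /t /x; lra.
have xt : x <= t + h.
  by have := normc_triangle u w z; rewrite (normc_distC u z) /t /x; lra.
have hr0 : 0 <= 16 * h / r by rewrite divr_ge0 //; lra.
have fu : f w <= ln (t + 2 * h) by apply: (le_trans f2); rewrite ler_ln ?posrE; lra.
have [tr|tr] := leP t r.
  rewrite tent_in // mulr1.
  have h1 : f w - l w <= 16.
    have m0 : 0 < Num.max t (5 * h) by rewrite lt_max; apply/orP; right; lra.
    have : ln (t + 2 * h) <= ln 2 + ln (Num.max t (5 * h)).
      rewrite -lnM ?posrE // ler_ln ?posrE; [|lra|by rewrite mulr_gt0].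
      by case: (leP t (5 * h)) => ?; lra.
    have := @ln1D_le R 1 ler01; rewrite (_ : 1 + 1 = 2) //; lra.
  have h2 : l w - f w <= 16.
    have m0 : 0 < Num.max x h by rewrite lt_max h0 orbT.
    have : ln (t + 2 * (5 * h)) <= ln 12 + ln (Num.max x h).
      rewrite -lnM ?posrE // ler_ln ?posrE; [|lra|by rewrite mulr_gt0].
      by case: (leP x h) => ?; lra.
    have := @ln1D_le R 11 (ler0n _ _); rewrite (_ : 1 + 11 = 12); [lra|ring].
  by rewrite ler_norml; apply/andP; split; lra.
have b0 := tent_ge0 u r w.
have {}far : ln (t - 2 * (5 * h)) <= l w by apply: far; lra.
have h1 : f w - l w <= 16 * h / r.
  apply: (@le_trans _ _ (ln (t + 2 * h) - ln (t - 2 * (5 * h)))); first by lra.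
  have p : 0 < t - 2 * (5 * h) by lra.
  rewrite -ln_div ?posrE //; last lra.
  have -> : (t + 2 * h) / (t - 2 * (5 * h)) = 1 + 12 * h / (t - 2 * (5 * h)).
    by field; rewrite gt_eqF.
  apply: le_trans (ln1D_le _) _; first by rewrite divr_ge0 //; lra.
  rewrite ler_pdivrMr // mulrAC ler_pdivlMr //.
  have : 0 <= h * (t - 2 * (5 * h) - 3 / 4 * r) by apply: mulr_ge0; lra.
  by lra.
have h2 : l w - f w <= 16 * h / r.
  have p : 0 < t - h by lra.
  have fl : ln (t - h) <= f w.
    apply: le_trans f1; rewrite ler_ln ?posrE //; last by rewrite lt_max h0 orbT.
    by rewrite le_max; apply/orP; left; lra.
  apply: (@le_trans _ _ (ln (t + 2 * (5 * h)) - ln (t - h))); first by lra.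
  rewrite -ln_div ?posrE //; last lra.
  have -> : (t + 2 * (5 * h)) / (t - h) = 1 + 11 * h / (t - h).
    by field; rewrite gt_eqF.
  apply: le_trans (ln1D_le _) _; first by rewrite divr_ge0 //; lra.
  rewrite ler_pdivrMr // mulrAC ler_pdivlMr //.
  have : 0 <= h * (t - h - 3 / 4 * r) by apply: mulr_ge0; lra.
  have : 0 <= h * r by apply: mulr_ge0; lra.
  by lra.
by rewrite ler_norml; apply/andP; split; lra.
Qed.

End LogLike.

Section Shallow.
Context {R : realType}.
Implicit Types (z w u : R[i]) (f g l : R[i] -> R).
Variables (K S : set R[i]) (B : R) (s : nat -> seq R[i]) (E : (R[i] -> R) -> R).
Hypothesis H : setting K S B s E.
Let B0 := set_gt0 H.
Let fE := set_functional H.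
Let sP := set_roots H.

(** The threshold for [k] must not depend on [z], whereas [good_ring] gives one for each centre.
    Centres are therefore restricted to a finite grid of mesh [h / 2], and a general [z] uses a grid
    point within [h]. The two kernels may differ, since the maximum principle compares a potential
    with [kap] to one with the truncated logarithm. *)
Lemma shallow_uniform (c : R) : 0 < c -> exists2 h0 : R, 0 < h0 &
  forall h, 0 < h -> h <= h0 -> \forall k \near \oo, forall z z1 f1 f2,
    normc z < B + 1 -> ~ K z1 -> normc (z1 - z) < 4 * h ->
    log_like z h f1 -> log_like z h f2 -> `|avg (s k) f1 - E f2| <= c.
Proof.
move: (B0) => B0' c0; have e0 : 0 < c / 100 by rewrite divr_gt0.
have [r r0 [rE rA]] := no_concentration H e0.
pose h0 := Num.min 1 (Num.min (r / 40) (r * (c / 100) / 16)).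
have rc : 0 < r * (c / 100) / 16 by apply: divr_gt0 => //; exact: mulr_gt0.
have r40 : 0 < r / 40 by rewrite divr_gt0.
exists h0; first by rewrite !lt_min ltr01 r40 rc.
move=> h hp; rewrite !le_min => /and3P[h1 hr hrc].
have hr1 : 40 * h <= r by lra.
have hr2 : 16 * h / r <= c / 100 by rewrite ler_pdivrMr //; lra.
have g0 : 0 < h / 2 by rewrite divr_gt0.
have B10 : 0 <= B + 1 by lra.
have [M [M1 M2 Mg]] := grid_near g0 B10.
pose u (ab : 'I_(M + M).+1 * 'I_(M + M).+1) := gpt (h / 2) M ab.1 ab.2.
have key ab : \forall k \near \oo, forall z z1 f1 f2,
    normc z < B + 1 -> normc (z - u ab) <= h -> ~ K z1 -> normc (z1 - z) < 4 * h ->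
    log_like z h f1 -> log_like z h f2 -> `|avg (s k) f1 - E f2| <= c.
  (* A grid point with no point off [K] within [5 h] serves no admissible [z], so the claim for it
     is vacuous. *)
  have [[v Kv vu]|nv] := pselect (exists2 v, ~ K v & normc (v - u ab) < 5 * h);
    last first.
    near=> k => z z1 f1 f2 zB zu Kz1 z1z; case: nv; exists z1 => //.
    by have := normc_triangle z z1 (u ab); lra.
  have [uB|uB] := ltP (normc (u ab)) (B + 3); last first.
    near=> k => z z1 f1 f2 zB zu; exfalso; move: uB.
    by have := normc_triangle z (u ab) 0; rewrite !subr0 (normc_distC (u ab)); lra.
  have [l [cl gl up lo far]] := good_ring H Kv vu.
  have vr : normc (v - u ab) < r by lra.
  near=> k => z z1 f1 f2 zB zu Kz1 z1z f1P f2P.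
  have [s0 sB] : (0 < size (s k))%N /\ forall z, z \in s k -> normc z < B by near: k.
  have gk : `|avg (s k) l - E l| <= c / 100 by near: k; exact: gl.
  have bk : avg (s k) (tent (u ab) r) <= c / 100 by near: k; exact: rA Kv vr.
  have cb : continuous (fun w => 16 * tent (u ab) r w + 16 * h / r).
    by apply: contD; [exact/contZ/tent_continuous|exact: cont_cst].
  have [cf1 _] := f1P; have [cf2 _] := f2P.
  have D1 : `|avg (s k) f1 - avg (s k) l| <= 17 * (c / 100).
    rewrite -mulN1r -avgZ -avgD.
    apply: (@le_trans _ _ (avg (s k) (fun w => 16 * tent (u ab) r w + 16 * h / r))).
      apply: avg_norm_le => w _; rewrite mulN1r.
      exact: log_like_sub_ring f1P up lo far.
    by rewrite avgD avgZ avg_cst //; lra.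
  have D2 : `|E f2 - E l| <= 17 * (c / 100).
    rewrite -(funB fE) //.
    apply: (@le_trans _ _ (E (fun w => 16 * tent (u ab) r w + 16 * h / r))).
      apply: (fun_norm_le fE) => //; first exact: contB.
      by move=> w _; exact: log_like_sub_ring f2P up lo far.
    rewrite (funD fE) ?(funZ fE) ?(fun_cst fE);
      try by [exact: cont_cst|exact: tent_continuous|exact/contZ/tent_continuous].
    by have := rE (u ab); lra.
  move: gk D1 D2; rewrite !ler_norml => /andP[? ?] /andP[? ?] /andP[? ?].
  by apply/andP; split; lra.
have all_key := filter_forall _ key.
near=> k => z z1 f1 f2 zB Kz1 z1z f1P f2P.
have [a _ aP] := Mg (re z) (le_trans (normr_re z) (ltW zB)).
have [b _ bP] := Mg (im z) (le_trans (normr_im z) (ltW zB)).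
have zu : normc (z - u (a, b)) <= h.
  apply: (le_trans (normc_le_add _)); rewrite [h]splitr.
  by rewrite /u /gpt; case: z aP bP {zB z1z f1P f2P} => x y /=; lra.
have : forall ab, forall z z1 f1 f2,
    normc z < B + 1 -> normc (z - u ab) <= h -> ~ K z1 -> normc (z1 - z) < 4 * h ->
    log_like z h f1 -> log_like z h f2 -> `|avg (s k) f1 - E f2| <= c.
  by near: k; exact: all_key.
by move=> /(_ (a, b) z z1 f1 f2); apply.
Unshelve. all: by end_near. Qed.

End Shallow.

(** * Potentials deep inside K *)

Section Deep.
Context {R : realType}.
Implicit Types (z w : R[i]) (h c : R).

Lemma kap_continuous h z : 0 < h -> continuous (fun w => kap h (z - w)).
Proof.
move=> h0; have cn : continuous (fun w => normc (z - w)).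
  rewrite (_ : (fun w => _) = fun w => normc (w - z)); first exact: continuous_dist.
  by apply/funext => v; rewrite normc_distC.
have cs : continuous (fun w => normc (z - w) * normc (z - w)).
  by move=> u; exact: cvgM (cn u) (cn u).
have c1 : continuous (fun w => normc (z - w) * normc (z - w) + h ^+ 2).
  exact: contD cs (@cont_cst R (h ^+ 2)).
have c2 : continuous (fun w => ln (normc (z - w) * normc (z - w) + h ^+ 2)).
  move=> w; have p : 0 < normc (z - w) * normc (z - w) + h ^+ 2.
    by rewrite ltr_wpDl ?exprn_gt0 // mulr_ge0 ?normc_ge0.
  exact: (@continuous_comp _ _ _ _ (@ln R) w (c1 w) (continuous_ln p)).
rewrite (_ : (fun w => _) = fun w =>
  2^-1 * ln (normc (z - w) * normc (z - w) + h ^+ 2)); first exact: contZ.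
by apply/funext => w; rewrite mulrC.
Qed.

Lemma kap_log_like h z : 0 < h -> log_like z h (fun w => kap h (z - w)).
Proof.
move=> h0; split; first exact: kap_continuous.
move=> w; rewrite normc_distC /kap; set x := normc (z - w).
have x0 : 0 <= x := normc_ge0 _.
have half (y : R) : 0 < y -> ln y = ln (y ^+ 2) / 2.
  by move=> y0; rewrite lnXn // mulr2n; field.
have p : 0 < x ^+ 2 + h ^+ 2 by rewrite ltr_wpDl ?sqr_ge0 // exprn_gt0.
have m0 : 0 < Num.max x h by rewrite lt_max h0 orbT.
have xh : 0 < x + h by lra.
have m2 : Num.max x h ^+ 2 <= x ^+ 2 + h ^+ 2.
  by have := sqr_ge0 x; have := sqr_ge0 h; case: (leP x h) => _; lra.
have xh2 : x ^+ 2 + h ^+ 2 <= (x + h) ^+ 2.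
  have : 0 <= x * h by apply: mulr_ge0 => //; exact: ltW.
  by rewrite !expr2; lra.
rewrite (half _ m0) (half _ xh) !ler_pM2r ?invr_gt0 // !ler_ln ?posrE ?exprn_gt0 //.
by rewrite m2 xh2.
Qed.

Lemma ln_max_log_like h z : 0 < h ->
  log_like z h (fun w => ln (Num.max (normc (w - z)) h)).
Proof.
move=> h0; split; first exact: continuous_ln_max.
move=> w; rewrite lexx /=; have n0 := normc_ge0 (w - z).
rewrite ler_ln ?posrE; [|by rewrite lt_max h0 orbT|by lra].
by case: (leP _ h) => _; lra.
Qed.

Lemma step4_sub (t : R) (F G : R[i] -> R) z :
  step4 t (fun z => F z - G z) z = step4 t F z - step4 t G z.
Proof. by rewrite /step4; ring. Qed.

Lemma step4_avg (s : seq R[i]) (t : R) (F : R[i] -> R[i] -> R) z :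
  step4 t (fun z => avg s (F z)) z = avg s (fun w => step4 t (F ^~ w) z).
Proof.
rewrite /step4 -mulNr -!avgZ -!avgD; congr (avg s _); apply/funext => w; ring.
Qed.

Lemma step4_fun (S : set R[i]) E (t : R) (F : R[i] -> R[i] -> R) z :
  functional S E -> (forall z, continuous (F z)) ->
  step4 t (fun z => E (F z)) z = E (fun w => step4 t (F ^~ w) z).
Proof.
move=> fE cF; rewrite /step4 -mulNr -(funZ fE) //.
rewrite -!(funD fE); try by do ?[exact: contD|apply: contD|exact: contZ|exact: cF].
by congr E; apply/funext => w; ring.
Qed.

Lemma step4_continuous (t : R) (F : R[i] -> R[i] -> R) z :
  (forall z, continuous (F z)) -> continuous (fun w => step4 t (F ^~ w) z).
Proof.
move=> cF; apply: contB; last exact: contZ.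
by do 3 apply: contD => //.
Qed.

Lemma step4_max_nbr (t : R) (v : R[i] -> R) z g : 0 <= t -> g <= step4 t v z ->
  exists2 z', normc (z' - z) = t & v z + g / 4 <= v z'.
Proof.
move=> t0 gv; apply: contrapT => /forall2NP H.
have {}H z' : normc (z' - z) = t -> v z' < v z + g / 4.
  by move=> zt; rewrite ltNge; apply/negP; case: (H z').
have := H (z + Complex t 0); have := H (z - Complex t 0).
have := H (z + Complex 0 t); have := H (z - Complex 0 t).
rewrite ![_ + _ - z]addrAC !subrr !add0r !normcN !normc_hstep ?normc_vstep //.
move=> /(_ erefl) ? /(_ erefl) ? /(_ erefl) ? /(_ erefl) ?.
by move: gv; rewrite /step4; lra.
Qed.

Lemma ln1D_ge (x : R) : 0 <= x -> x <= 1 -> x / 2 <= ln (1 + x).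
Proof.
move=> x0 x1; have p : 0 < 1 + x by lra.
have i0 : 0 < (1 + x)^-1 by rewrite invr_gt0.
have : ln ((1 + x)^-1) <= (1 + x)^-1 - 1.
  by rewrite -{1}[(1 + x)^-1](subrKC 1) le_ln1Dx //; lra.
rewrite lnV ?posrE //.
have : (1 + x)^-1 <= 1 - x / 2.
  have h : 0 <= 1 - x by lra.
  by rewrite -[leLHS]mul1r ler_pdivrMr //; have := mulr_ge0 x0 h; lra.
by lra.
Qed.

Variables (K S : set R[i]) (B : R) (s : seq R[i]) (E : (R[i] -> R) -> R).
Hypotheses (B0 : 0 < B) (KB : K `<=` disk B) (S_int : S `&` K° = set0).
Hypothesis fE : functional S E.
Hypotheses (s0 : (0 < size s)%N) (sB : forall z, z \in s -> normc z < B).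

Definition deep h z := forall w, normc (w - z) < 2 * h -> K w.

Lemma deep_far h z w : deep h z -> S w -> 2 * h <= normc (w - z).
Proof.
move=> dz Sw; rewrite leNgt; apply/negP => wz.
suff : (S `&` K°) w by rewrite S_int.
split=> //; apply/nbhsCP; exists (2 * h - normc (w - z)); first by rewrite subr_gt0.
move=> v vw; apply: dz; apply: le_lt_trans (normc_triangle w v z) _.
by rewrite -ltrBrDr.
Qed.

(* The difference [v] of the potential of the roots and of the equilibrium
   potential is strictly subharmonic at deep points, so a value above [c] would
   propagate along an infinite walk through deep points on which [v] is
   unbounded. *)
Lemma deep_upper h c : 0 < h ->
  (forall z z1, normc z < B + 1 -> ~ K z1 -> normc (z1 - z) < 4 * h ->
     avg s (fun w => kap h (z - w)) - E (fun w => ln (Num.max (normc (w - z)) h)) <= c) ->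
  forall z, deep h z ->
     avg s (fun w => kap h (z - w)) - E (fun w => ln (Num.max (normc (w - z)) h)) <= c.
Proof.
move: (B0) => B0' h0 shallow z0 dz0.
(* The kernels differ on purpose: [kap] has a strictly positive discrete Laplacian at every root,
   while the truncated logarithm is the exact one, almost discretely harmonic, at a deep point as
   seen from [S]. *)
set v := fun z => avg s (fun w => kap h (z - w)) - E (fun w => ln (Num.max (normc (w - z)) h)).
rewrite -/(v z0) leNgt; apply/negP => cv.
pose D := (2 * B) ^+ 2 + h ^+ 2.
have h20 : 0 < h ^+ 2 by rewrite exprn_gt0.
have D0 : 0 < D by rewrite ltr_wpDl ?sqr_ge0.
have hD : h ^+ 2 <= D by rewrite lerDr sqr_ge0.
have DE : D = (2 * B) ^+ 2 + h ^+ 2 by [].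
clearbody D.
(* [D] bounds [|z - w|^2 + h^2] for points of the disk. The roots contribute at least
   [x / 4 = t^2 h^2 / (2 D^2)] and [omega] at most [(t / h)^4]; this [t] makes the first exactly
   twice the second, so the gain is [g = (t / h)^4]. *)
pose t := h ^+ 3 / (2 * D).
have t0 : 0 < t by rewrite divr_gt0 ?exprn_gt0 ?mulr_gt0.
have th : t <= h / 2.
  rewrite ler_pdivrMr ?mulr_gt0 //.
  have : 0 <= h * (D - h ^+ 2) by apply: mulr_ge0; lra.
  by rewrite exprS; lra.
have tE : t * (2 * D) = h ^+ 3 by rewrite mulfVK // gt_eqF ?mulr_gt0.
have t2 : t ^+ 2 <= h ^+ 2 / 4.
  rewrite (_ : h ^+ 2 / 4 = (h / 2) ^+ 2); last by field.
  by rewrite ler_sqr ?nnegrE //; lra.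
pose x := 2 * t ^+ 2 * h ^+ 2 / D ^+ 2.
have x0 : 0 < x by rewrite /x; posi.
have x1 : x <= 1.
  rewrite ler_pdivrMr ?exprn_gt0 // mul1r.
  have a1 : 0 <= h ^+ 2 / 4 - t ^+ 2 by lra.
  have a2 := mulr_ge0 (ltW h20) a1.
  have a3 : h ^+ 2 * h ^+ 2 <= D ^+ 2 by rewrite expr2; apply: ler_pM => //; lra.
  by have := mulr_ge0 (ltW h20) (ltW h20); lra.
pose g := x / 4 - (t ^+ 2 / h ^+ 2) ^+ 2.
have g0 : 0 < g.
  have -> : g = (t / h) ^+ 4 * (2 * (h ^+ 3 / (2 * D)) ^+ 2 / t ^+ 2 - 1).
    by rewrite /g /x; field; rewrite !gt_eqF.
  rewrite -/t mulfK ?gt_eqF ?exprn_gt0 //.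
  by apply: mulr_gt0; [apply/exprn_gt0/divr_gt0|lra].
have vstep z : deep h z -> exists2 z', normc (z' - z) = t & v z + g / 4 <= v z'.
  move=> dz; apply: step4_max_nbr; first exact: ltW.
  have cF z' : continuous (fun w => ln (Num.max (normc (w - z')) h)).
    exact: continuous_ln_max.
  rewrite /v step4_sub (step4_avg s t (fun z w => kap h (z - w))).
  rewrite (step4_fun t (F := fun z w => ln (Num.max (normc (w - z)) h)) z fE cF).
  have zB : normc z < B by apply: KB; apply: dz; rewrite subrr ComplexField.Normc.normc0 mulr_gt0.
  rewrite /g; apply: lerB.
    rewrite -[x / 4](@avg_cst _ s) //; apply: avg_le => w /sB wB.
    rewrite (_ : step4 t _ z = step4 t (kap h) (z - w)); last first.
      by rewrite /step4 ![z + _ - w]addrAC.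
    apply: (le_trans _ (step4_kap_ge _ h0 _)); last by lra.
    apply: (@le_trans _ _ (ln (1 + x) / 2)).
      by have := ln1D_ge (ltW x0) x1; lra.
    rewrite ler_pM2r ?invr_gt0 // ler_ln ?posrE; last 2 first.
    - by rewrite ltr_wpDr // ltW.
    - by rewrite ltr_wpDr // divr_ge0 ?sqr_ge0 //; posi; exact: ltW.
    have p2 : 0 < 2 * t ^+ 2 * h ^+ 2 by posi.
    rewrite lerD2l /x ler_pM2l //.
    have q0 : 0 < normc (z - w) ^+ 2 + h ^+ 2 by rewrite ltr_wpDl ?sqr_ge0.
    rewrite lef_pV2 ?posrE ?exprn_gt0 // ler_sqr ?nnegrE ?(ltW q0) ?(ltW D0) //.
    rewrite DE lerD2r ler_sqr ?nnegrE ?normc_ge0 ?mulr_ge0 ?ltW //.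
    by have := le_normcD z (- w); rewrite normcN; lra.
  rewrite -[leRHS](fun_cst fE); apply: (fun_le fE).
  - exact: step4_continuous.
  - exact: cont_cst.
  move=> w /(deep_far dz) wz.
  have nE z' : normc (z' - z) <= t -> Num.max (normc (w - z')) h = normc (z' - w).
    move=> zz'; rewrite normc_distC; apply/max_idPl.
    by have := normc_triangle z' w z; rewrite (normc_distC w z'); lra.
  rewrite (_ : step4 t _ z = step4 t (fun u => ln (normc u)) (z - w)); last first.
    rewrite /step4 !nE ?subrr ?ComplexField.Normc.normc0 ?(ltW t0) //;
      rewrite ?[_ + _ - z]addrAC ?subrr ?add0r ?normcN ?normc_hstep ?normc_vstep ?(ltW t0) //.
    by rewrite ![z + _ - w]addrAC.
  rewrite normc_distC in wz.
  apply: (le_trans (step4_ln_normc_le _ _)); [exact: ltW|lra|].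
  rewrite ler_sqr ?nnegrE ?divr_ge0 ?sqr_ge0 //.
  rewrite ler_pM2l ?exprn_gt0 // lef_pV2 ?posrE ?exprn_gt0 //; last by lra.
  by rewrite ler_sqr ?nnegrE; lra.
have walk n : exists2 z, deep h z & v z0 + n%:R * (g / 4) <= v z.
  elim: n => [|n [z dz vz]]; first by exists z0 => //; rewrite mul0r addr0.
  have [z' zz' vz'] := vstep z dz; exists z'; last by rewrite -natr1; lra.
  have n0 : 0 <= n%:R * (g / 4) by rewrite mulr_ge0 //; lra.
  apply: contrapT => /existsNP[z1 /not_implyP[z1z' Kz1]].
  have z'B : normc z' < B by apply: KB; apply: dz; rewrite zz'; lra.
  have : v z' <= c by apply: shallow Kz1 _; lra.
  by lra.
pose V := `|ln D| - ln h.
have vV z : deep h z -> v z <= V.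
  move=> dz.
  have zB : normc z < B by apply: KB; apply: dz; rewrite subrr ComplexField.Normc.normc0 mulr_gt0.
  have Ek : ln h <= E (fun w => ln (Num.max (normc (w - z)) h)).
    rewrite -[leLHS](fun_cst fE); apply: (fun_le fE); [exact: cont_cst|exact: continuous_ln_max|].
    by move=> w _; rewrite ler_ln ?posrE // ?lt_max ?h0 ?orbT // le_max lexx orbT.
  have Ak : avg s (fun w => kap h (z - w)) <= `|ln D| / 2.
    rewrite -[leRHS](@avg_cst _ s) //; apply: avg_le => w /sB wB.
    rewrite /kap ler_pM2r ?invr_gt0 // (le_trans _ (ler_norm _)) //.
    have q0 : 0 < normc (z - w) ^+ 2 + h ^+ 2 by rewrite ltr_wpDl ?sqr_ge0.
    rewrite ler_ln ?posrE // DE lerD2r ler_sqr ?nnegrE ?normc_ge0 ?mulr_ge0 ?ltW //.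
    by have := le_normcD z (- w); rewrite normcN; lra.
  by have := normr_ge0 (ln D); rewrite /v /V; lra.
pose n := (Num.truncn ((V - v z0) / (g / 4))).+1.
have [z dz] := walk n.
have : (V - v z0) / (g / 4) < n%:R by exact: truncnS_gt.
rewrite ltr_pdivrMr; last by lra.
by have := vV z dz; lra.
Qed.

End Deep.

(** * Lattice sums and summation by parts *)

Section GridSums.
Context {R : realType}.
Implicit Types (z w : R[i]) (f phi : R[i] -> R).

Section Parts1D.
Variables (h X : R) (M : nat) (p q : R -> R).
Hypotheses (h0 : 0 < h) (XM : X < h * M%:R).
Hypothesis p0 : forall x, X < `|x| -> p x = 0.
Let x (a : nat) : R := h * (a%:R - M%:R).

Let xS a : x a.+1 = x a + h.
Proof. by rewrite /x -natr1; ring. Qed.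

Let xlo : x 0 = - (h * M%:R).
Proof. by rewrite /x; ring. Qed.

Let xhi : x (M + M) = h * M%:R.
Proof. by rewrite /x natrD; ring. Qed.

Let hM0 : 0 <= h * M%:R.
Proof. by rewrite mulr_ge0 // ltW. Qed.

Lemma parts_right : \sum_(a < (M + M).+1) p (x a) * q (x a + h)
  = \sum_(a < (M + M).+1) p (x a - h) * q (x a).
Proof.
rewrite big_ord_recr /= xhi p0 ?mul0r ?addr0; last by rewrite ger0_norm.
rewrite [RHS]big_ord_recl /= xlo p0 ?mul0r ?add0r; last first.
  rewrite -opprD normrN ger0_norm ?addr_ge0 ?(ltW h0) //.
  by rewrite (lt_trans XM) // ltrDl.
by apply: eq_bigr => a _; rewrite /bump leq0n add1n xS addrK.
Qed.

Lemma parts_left : \sum_(a < (M + M).+1) p (x a) * q (x a - h)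
  = \sum_(a < (M + M).+1) p (x a + h) * q (x a).
Proof.
rewrite big_ord_recl /= xlo p0 ?mul0r ?add0r; last by rewrite normrN ger0_norm.
rewrite [RHS]big_ord_recr /= xhi p0 ?mul0r ?addr0; last first.
  rewrite ger0_norm ?addr_ge0 ?(ltW h0) //.
  by rewrite (lt_trans XM) // ltrDl.
by apply: eq_bigr => a _; rewrite /bump leq0n add1n xS addrK.
Qed.
End Parts1D.

Definition gsum (h : R) (M : nat) f : R :=
  \sum_(a < (M + M).+1) \sum_(b < (M + M).+1) f (gpt h M a b).

Lemma gsumD h M f1 f2 : gsum h M (fun z => f1 z + f2 z) = gsum h M f1 + gsum h M f2.
Proof. by rewrite /gsum -big_split; apply: eq_bigr => a _; rewrite big_split. Qed.

Lemma gsumZ h M (c : R) f : gsum h M (fun z => c * f z) = c * gsum h M f.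
Proof. by rewrite /gsum mulr_sumr; apply: eq_bigr => a _; rewrite mulr_sumr. Qed.

Lemma eq_gsum h M f1 f2 : f1 =1 f2 -> gsum h M f1 = gsum h M f2.
Proof. by move=> E; apply: eq_bigr => a _; apply: eq_bigr => b _; rewrite E. Qed.

Lemma gsum_le h M f1 f2 : (forall a b : 'I_(M + M).+1, f1 (gpt h M a b) <= f2 (gpt h M a b)) ->
  gsum h M f1 <= gsum h M f2.
Proof. by move=> H; apply: ler_sum => a _; apply: ler_sum => b _; exact: H. Qed.

Lemma gsum_cst h M (c : R) : gsum h M (fun=> c) = (M + M).+1%:R ^+ 2 * c.
Proof.
rewrite /gsum; under eq_bigr do rewrite sumr_const card_ord.
by rewrite sumr_const card_ord -mulrnA -[LHS]mulr_natl natrM expr2.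
Qed.

(** Symmetry of the discrete Laplacian: boundary terms vanish because [phi] is zero on the edge of
    the grid and one step beyond it. *)
Lemma step4_parts h X M phi f : 0 < h -> X < h * M%:R ->
  (forall z, X < `|re z| -> phi z = 0) -> (forall z, X < `|im z| -> phi z = 0) ->
  gsum h M (fun z => phi z * step4 h f z) = gsum h M (fun z => f z * step4 h phi z).
Proof.
move=> h0 XM pr pi.
have C1 (a b : R) : Complex a b + Complex h 0 = Complex (a + h) b.
  by rewrite -[b in RHS]addr0.
have C2 (a b : R) : Complex a b - Complex h 0 = Complex (a - h) b.
  by rewrite -[b in RHS]subr0.
have C3 (a b : R) : Complex a b + Complex 0 h = Complex a (b + h).
  by rewrite -[a in RHS]addr0.
have C4 (a b : R) : Complex a b - Complex 0 h = Complex a (b - h).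
  by rewrite -[a in RHS]subr0.
have s1 : gsum h M (fun z => phi z * f (z + Complex h 0))
    = gsum h M (fun z => f z * phi (z - Complex h 0)).
  rewrite /gsum exchange_big [RHS]exchange_big; apply: eq_bigr => b _ /=.
  have := @parts_right h X M (fun x => phi (Complex x (h * (b%:R - M%:R))))
    (fun x => f (Complex x (h * (b%:R - M%:R)))) h0 XM (fun x => pr (Complex x _)).
  rewrite /gpt; under [X in _ -> X = _]eq_bigr do rewrite C1.
  by under [X in _ -> _ = X]eq_bigr do rewrite C2 mulrC.
have s2 : gsum h M (fun z => phi z * f (z - Complex h 0))
    = gsum h M (fun z => f z * phi (z + Complex h 0)).
  rewrite /gsum exchange_big [RHS]exchange_big; apply: eq_bigr => b _ /=.
  have := @parts_left h X M (fun x => phi (Complex x (h * (b%:R - M%:R))))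
    (fun x => f (Complex x (h * (b%:R - M%:R)))) h0 XM (fun x => pr (Complex x _)).
  rewrite /gpt; under [X in _ -> X = _]eq_bigr do rewrite C2.
  by under [X in _ -> _ = X]eq_bigr do rewrite C1 mulrC.
have s3 : gsum h M (fun z => phi z * f (z + Complex 0 h))
    = gsum h M (fun z => f z * phi (z - Complex 0 h)).
  rewrite /gsum; apply: eq_bigr => b _ /=.
  have := @parts_right h X M (fun x => phi (Complex (h * (b%:R - M%:R)) x))
    (fun x => f (Complex (h * (b%:R - M%:R)) x)) h0 XM (fun x => pi (Complex _ x)).
  rewrite /gpt; under [X in _ -> X = _]eq_bigr do rewrite C3.
  by under [X in _ -> _ = X]eq_bigr do rewrite C4 mulrC.
have s4 : gsum h M (fun z => phi z * f (z - Complex 0 h))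
    = gsum h M (fun z => f z * phi (z + Complex 0 h)).
  rewrite /gsum; apply: eq_bigr => b _ /=.
  have := @parts_left h X M (fun x => phi (Complex (h * (b%:R - M%:R)) x))
    (fun x => f (Complex (h * (b%:R - M%:R)) x)) h0 XM (fun x => pi (Complex _ x)).
  rewrite /gpt; under [X in _ -> X = _]eq_bigr do rewrite C4.
  by under [X in _ -> _ = X]eq_bigr do rewrite C3 mulrC.
have split5 (F G : R[i] -> R) : gsum h M (fun z => F z * step4 h G z)
  = gsum h M (fun z => F z * G (z + Complex h 0)) + gsum h M (fun z => F z * G (z - Complex h 0))
  + gsum h M (fun z => F z * G (z + Complex 0 h)) + gsum h M (fun z => F z * G (z - Complex 0 h))
  - 4 * gsum h M (fun z => F z * G z).
  rewrite -mulNr -gsumZ -!gsumD; apply: eq_gsum => z; rewrite /step4; ring.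
rewrite !split5 s1 s2 s3 s4 (eq_gsum h M (fun z => mulrC (phi z) (f z))); ring.
Qed.

(** A bounded primitive of [1 / (1 + |x|)^2], comparable to [1 / (1 + x^2)]: it bounds the lattice
    sum by telescoping. *)
Definition saw (x : R) : R := x / (1 + `|x|).

Lemma saw_step (x : R) : (1 + x ^+ 2)^-1 <= 4 * (saw (x + 1) - saw x).
Proof.
have p : 0 < 1 + x ^+ 2 by rewrite ltr_pwDl // sqr_ge0.
rewrite -[leLHS]mul1r ler_pdivrMr //.
have [x0|x0] := leP 0 x.
  have x10 : 0 <= x + 1 by lra.
  rewrite /saw !ger0_norm //.
  have -> : (x + 1) / (1 + (x + 1)) - x / (1 + x) = ((1 + (x + 1)) * (1 + x))^-1.
    by field; do ?(apply/andP; split); apply/eqP => ?; lra.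
  have q : 0 < (1 + (x + 1)) * (1 + x) by rewrite mulr_gt0 //; lra.
  rewrite mulrAC ler_pdivlMr //; have := sqr_ge0 (x - 1); have := sqr_ge0 x; lra.
have [x1|x1] := leP 0 (x + 1).
  rewrite /saw (ger0_norm x1) (ltr0_norm x0).
  have q1 : (x + 1) / 2 <= (x + 1) / (1 + (x + 1)).
    by rewrite ler_wpM2l // lef_pV2 ?posrE; lra.
  have q2 : - x / 2 <= - x / (1 - x).
    by rewrite ler_wpM2l ?lef_pV2 ?posrE; lra.
  have q3 : 1 / 2 <= (x + 1) / (1 + (x + 1)) - x / (1 - x) by rewrite mulNr in q2; lra.
  apply: (@le_trans _ _ (4 * (1 / 2) * (1 + x ^+ 2))).
    by have := sqr_ge0 x; lra.
  by rewrite ler_pM2r // ler_pM2l.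
rewrite /saw (ltr0_norm x0) (ltr0_norm x1).
have -> : (x + 1) / (1 - (x + 1)) - x / (1 - x) = (- x * (1 - x))^-1.
  by field; do ?(apply/andP; split); apply/eqP => ?; lra.
have q : 0 < - x * (1 - x) by rewrite mulr_gt0 //; lra.
rewrite mulrAC ler_pdivlMr //; have := sqr_ge0 x; have := sqr_ge0 (x + 1); lra.
Qed.

Lemma saw_bound (x : R) : `|saw x| <= 1.
Proof.
rewrite /saw normrM normfV (ger0_norm (_ : 0 <= 1 + `|x|)); last by rewrite addr_ge0.
by rewrite ler_pdivrMr ?mul1r ?lerDr // ltr_pwDl.
Qed.

Lemma lattice_sum (n : nat) (x : R) : \sum_(a < n) (1 + (a%:R - x) ^+ 2)^-1 <= 8.
Proof.
have H : \sum_(a < n) (1 + (a%:R - x) ^+ 2)^-1 <= 4 * (saw (n%:R - x) - saw (- x)).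
  elim: n => [|n IH]; first by rewrite big_ord0 sub0r subrr mulr0.
  rewrite big_ord_recr /=; apply: (le_trans (lerD IH (saw_step _))).
  rewrite -[n.+1%:R]natr1 (_ : n%:R - x + 1 = n%:R + 1 - x); last by ring.
  by lra.
have := saw_bound (n%:R - x); have := saw_bound (- x).
by rewrite !ler_norml => /andP[? ?] /andP[? ?]; lra.
Qed.

(** In units of [h] the bound [8 / (1 + x^2 + y^2)^2] is at most [8 / ((1 + x^2) (1 + y^2))], so the
    double sum splits into two sums of at most 8 each. *)
Lemma gsum_kap_le (h : R) M w : 0 < h ->
  gsum h M (fun z => step4 h (kap h) (z - w)) <= 512.
Proof.
move=> h0.
apply: (@le_trans _ _ (\sum_(a < (M + M).+1) \sum_(b < (M + M).+1)
   8 * ((1 + (a%:R - (M%:R + re w / h)) ^+ 2)^-1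
        * (1 + (b%:R - (M%:R + im w / h)) ^+ 2)^-1))).
  apply: ler_sum => a _; apply: ler_sum => b _.
  apply: (le_trans (step4_kap_le _ h0)); rewrite ler_pM2l //.
  set x := a%:R - _; set y := b%:R - _.
  have -> : normc (gpt h M a b - w) ^+ 2 + h ^+ 2 = h ^+ 2 * (1 + x ^+ 2 + y ^+ 2).
    rewrite normc_sqr /gpt /x /y; case: (w) => u v /=.
    by field; rewrite gt_eqF.
  have x2 := sqr_ge0 x; have y2 := sqr_ge0 y.
  rewrite invfM mulrA mulfV ?gt_eqF ?exprn_gt0 // mul1r -invfM exprVn.
  have a1 : 0 < 1 + x ^+ 2 by lra.
  have a2 : 0 < 1 + y ^+ 2 by lra.
  have a3 : 0 < 1 + x ^+ 2 + y ^+ 2 by lra.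
  rewrite lef_pV2 ?posrE ?(exprn_gt0 2 a3) ?(mulr_gt0 a1 a2) //.
  rewrite expr2; apply: ler_pM; lra.
under eq_bigr do rewrite -mulr_sumr -mulr_sumr.
rewrite -mulr_sumr -mulr_suml.
have S1 := lattice_sum (M + M).+1 (M%:R + re w / h).
have S2 := lattice_sum (M + M).+1 (M%:R + im w / h).
have P (m : nat) (x : R) : 0 <= \sum_(a < m) (1 + (a%:R - x) ^+ 2)^-1.
  by apply: sumr_ge0 => a _; rewrite invr_ge0 addr_ge0 // sqr_ge0.
have := ler_pM (P _ _) (P _ _) S1 S2; lra.
Qed.

End GridSums.

(** * Kato's inequality *)

Section Kato.
Context {R : realType}.
Implicit Types (z w : R[i]) (h c : R).

Variables (S V : set R[i]) (B X h c : R) (M : nat) (s : seq R[i]).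
Variables (E : (R[i] -> R) -> R) (phi : R[i] -> R) (dp : set R[i]).
Hypotheses (fE : functional S E) (h0 : 0 < h) (XM : X < h * M%:R) (hX : X + h < B + 1).
Hypotheses (c0 : 0 <= c) (phi0 : forall z, 0 <= phi z) (phi1 : forall z, V z -> phi z = 1).
Hypothesis phiX : forall z, X <= normc z -> phi z = 0.
Hypothesis dpV : forall z z', dp z -> normc (z' - z) <= h -> V z <-> V z'.

Let u z := E (fun w => kap h (z - w)) - avg s (fun w => kap h (z - w)).
Hypothesis u_ge : forall z, normc z < B + 1 -> - c <= u z.
Hypothesis u_le : forall z, normc z < B + 1 -> ~ dp z -> u z <= c.

Let W z w := step4 h (kap h) (z - w).

Lemma step4_kap_ge0 z : 0 <= step4 h (kap h) z.
Proof.
apply: le_trans (step4_kap_ge z h0 (lexx _)).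
apply: divr_ge0 => //; apply: ln_ge0; rewrite lerDl.
by posi.
Qed.

Let step4_translate (f : R[i] -> R) z w :
  step4 h (fun z => f (z - w)) z = step4 h f (z - w).
Proof. by rewrite /step4 ![z + _ - w]addrAC. Qed.

Let Du z : step4 h u z = E (W z) - avg s (W z).
Proof.
rewrite /u step4_sub (step4_avg s h (fun z w => kap h (z - w))).
rewrite (step4_fun h (F := fun z w => kap h (z - w)) z fE (fun z => @kap_continuous R h z h0)).
congr (E _ - avg s _); apply/funext => w; exact: step4_translate.
Qed.

Let EW0 z : 0 <= E (W z).
Proof.
rewrite -(fun_cst fE 0); apply: (fun_le fE); first exact: cont_cst.
  rewrite (_ : W z = fun w => step4 h (fun z => kap h (z - w)) z).
    apply: (@step4_continuous R h (fun z w => kap h (z - w)) z) => z'.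
    exact: kap_continuous.
  by apply/funext => w; rewrite step4_translate.
by move=> w _; exact: step4_kap_ge0.
Qed.

Let AW0 z : 0 <= avg s (W z).
Proof.
rewrite /avg mulr_ge0 ?invr_ge0 //; apply: sumr_ge0 => w _; exact: step4_kap_ge0.
Qed.

Let nbr (P : R[i] -> Prop) z : (forall z', normc (z' - z) <= h -> P z') ->
  [/\ P z, P (z + Complex h 0), P (z - Complex h 0), P (z + Complex 0 h) & P (z - Complex 0 h)].
Proof.
have hh := ltW h0.
move=> H; split; apply: H; rewrite ?[_ + _ - z]addrAC ?subrr ?add0r ?normcN.
- by rewrite ComplexField.Normc.normc0.
- by rewrite normc_hstep.
- by rewrite normc_hstep.
- by rewrite normc_vstep.
- by rewrite normc_vstep.
Qed.

(** The uncontrolled part of [u] on the components other than [V]. Extension by zero keeps it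
    discretely subharmonic up to the roots, since [u <= c] at points that are not deep. *)
Let F z := if `[< dp z /\ ~ V z >] then Num.max 0 (u z - c) else 0.

Let F0 z : 0 <= F z.
Proof. by rewrite /F; case: ifP => // _; rewrite le_max lexx. Qed.

Let step4_out z : B + 1 <= normc z -> step4 h phi z = 0.
Proof.
move=> zB; have [] := @nbr (fun z' => phi z' = 0) z.
  move=> z' zz'; apply: phiX; have := normc_triangle z' z 0.
  by rewrite !subr0 normc_distC; move: hX; lra.
by rewrite /step4 => -> -> -> -> ->; rewrite mulr0 subr0 !addr0.
Qed.

(** At deep points off [V], and at points that are not deep, [u] and [F] differ by at most [c]. At
    deep points of [V], where [u] is unknown, [phi] equals 1 on the whole stencil. *)
Let u_step z : F z * step4 h phi z - c * `|step4 h phi z| <= u z * step4 h phi z.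
Proof.
have [zB|zB] := ltP (normc z) (B + 1); last first.
  by rewrite step4_out // normr0 !mulr0 subr0.
have bnd a b : `|a| <= c -> - (c * `|b|) <= a * b.
  move=> ac; rewrite lerNl -mulNr (le_trans (ler_norm _)) // normrM normrN.
  by rewrite ler_wpM2r.
have lo := u_ge zB.
rewrite /F; case: asboolP => [[dz nV]|nd].
  rewrite -subr_ge0 (_ : _ - _ = (u z - Num.max 0 (u z - c)) * step4 h phi z
    - - (c * `|step4 h phi z|)); last by ring.
  rewrite subr_ge0 bnd // ler_norml.
  by move: c0; case: (leP 0 (u z - c)) => ? ?; apply/andP; split; lra.
have [dz|dz] := pselect (dp z); last first.
  by rewrite mul0r sub0r bnd // ler_norml lo u_le.
have Vz : V z by apply: contrapT => nV; apply: nd.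
have [] := @nbr (fun z' => phi z' = 1) z.
  by move=> z' /(dpV dz) VV; apply: phi1; apply/VV.
rewrite /step4 => -> -> -> -> ->.
by rewrite (_ : 1 + 1 + 1 + 1 - 4 * 1 = 0) ?normr0 ?mulr0 ?subr0 //; ring.
Qed.

(** Where [F] vanishes its [step4] is nonnegative. Where it is positive it equals [u - c] and
    dominates [u - c] at the four neighbours, because a step from a deep point neither enters [V]
    nor meets [u > c] outside the deep set. *)
Let F_step z : - (phi z * (if `[< V z >] then 0 else avg s (W z))) <= phi z * step4 h F z.
Proof.
have [zX|zX] := ltP (normc z) X; last by rewrite phiX // !mul0r oppr0.
rewrite -mulrN ler_wpM2l //.
have [Fz|Fz] := ltP 0 (F z); last first.
  have FE : F z = 0 by apply/eqP; rewrite eq_le Fz F0.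
  apply: (@le_trans _ _ 0); first by rewrite oppr_le0; case: ifP.
  by rewrite /step4 FE mulr0 subr0 !addr_ge0.
have [dz nVz] : dp z /\ ~ V z by move: Fz; rewrite /F; case: asboolP => //; rewrite ltxx.
rewrite asboolF //.
have Fu : F z = u z - c.
  move: Fz; rewrite /F asboolT //; case: (leP 0 (u z - c)) => //; by rewrite ltxx.
have N z' : normc (z' - z) <= h -> u z' - c <= F z'.
  move=> zz'; rewrite /F; case: asboolP => [_|nd]; first by rewrite le_max lexx orbT.
  have nV' : ~ V z' by move=> /(dpV dz zz').
  have nd' : ~ dp z' by move=> d'; apply: nd.
  rewrite subr_le0; apply: u_le => //.
  have := normc_triangle z z' 0; rewrite !subr0.
  by have := hX; lra.
have [_ f1 f2 f3 f4] := nbr N.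
have := Du z; have := EW0 z; rewrite /step4 Fu.
by set D1 := E _; set D2 := avg _ _; lra.
Qed.

(* Kato's inequality for the truncation [F] of [u] off the component [V]:
   summing [phi * step4 u] by parts discards the other components. *)
Lemma kato_ineq :
  gsum h M (fun z => if `[< V z >] then avg s (W z) else 0)
  <= gsum h M (fun z => phi z * E (W z)) + c * gsum h M (fun z => `|step4 h phi z|).
Proof.
have phi_re z : X < `|re z| -> phi z = 0.
  by move=> zX; apply: phiX; apply: le_trans (normr_re z); exact: ltW.
have phi_im z : X < `|im z| -> phi z = 0.
  by move=> zX; apply: phiX; apply: le_trans (normr_im z); exact: ltW.
have P1 := step4_parts u h0 XM phi_re phi_im.
have P2 := step4_parts F h0 XM phi_re phi_im.
have I1 : gsum h M (fun z => F z * step4 h phi z) + - c * gsum h M (fun z => `|step4 h phi z|)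
    <= gsum h M (fun z => u z * step4 h phi z).
  by rewrite -gsumZ -gsumD; apply: gsum_le => a b; rewrite mulNr; exact: u_step.
have I2 : - gsum h M (fun z => phi z * (if `[< V z >] then 0 else avg s (W z)))
    <= gsum h M (fun z => phi z * step4 h F z).
  rewrite -mulN1r -gsumZ; apply: gsum_le => a b; rewrite mulN1r; exact: F_step.
have I3 : gsum h M (fun z => phi z * step4 h u z)
  = gsum h M (fun z => phi z * E (W z)) + -1 * gsum h M (fun z => phi z * avg s (W z)).
  by rewrite -gsumZ -gsumD; apply: eq_gsum => z; rewrite Du; ring.
have I4 : gsum h M (fun z => phi z * avg s (W z))
  = gsum h M (fun z => phi z * (if `[< V z >] then 0 else avg s (W z)))
  + gsum h M (fun z => if `[< V z >] then avg s (W z) else 0).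
  rewrite -gsumD; apply: eq_gsum => z; case: asboolP => Vz.
    by rewrite phi1 // mulr0 add0r mul1r.
  by rewrite addr0.
by rewrite -P1 I3 I4 in I1; rewrite -P2 in I1; lra.
Qed.

End Kato.

(** * Distance functions and cutoffs *)

Section Distance.
Context {R : realType}.
Implicit Types (z w : R[i]) (V : set R[i]).

Definition dist V w : R := inf [set normc (w - v) | v in V].

Lemma dist_le V w v : V v -> dist V w <= normc (w - v).
Proof.
move=> Vv; apply: ge_inf; last by exists v.
by exists 0 => _ [u _ <-]; exact: normc_ge0.
Qed.

Lemma dist_ge V w (r : R) : V !=set0 -> (forall v, V v -> r <= normc (w - v)) ->
  r <= dist V w.
Proof.
move=> [v Vv] H; apply: lb_le_inf; first by exists (normc (w - v)), v.
by move=> _ [u Vu <-]; exact: H.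
Qed.

Section Nonempty.
Variable V : set R[i].
Hypothesis V0 : V !=set0.

Lemma dist_ge0 w : 0 <= dist V w.
Proof. by apply: dist_ge => // v _; exact: normc_ge0. Qed.

Lemma dist_lip z w : dist V z <= dist V w + normc (z - w).
Proof.
rewrite -lerBlDr; apply: dist_ge => // v Vv; rewrite lerBlDr.
apply: (le_trans (dist_le z Vv)); rewrite [leRHS]addrC; exact: normc_triangle.
Qed.

Definition cutoff (r : R) z : R := Num.max 0 (1 - (dist V z / r) ^+ 2).

Lemma cutoff_ge0 r z : 0 <= cutoff r z.
Proof. by rewrite le_max lexx. Qed.

Lemma cutoff_le1 r z : cutoff r z <= 1.
Proof. by rewrite ge_max ler01 gerBl sqr_ge0. Qed.

Lemma cutoff_in r z : V z -> cutoff r z = 1.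
Proof.
move=> Vz; have d0 : dist V z = 0.
  apply/eqP; rewrite eq_le dist_ge0 andbT.
  by have := dist_le z Vz; rewrite subrr ComplexField.Normc.normc0.
by rewrite /cutoff d0 mul0r expr0n subr0; apply/max_idPr.
Qed.

Lemma cutoff_out r z : 0 < r -> r <= dist V z -> cutoff r z = 0.
Proof.
move=> r0 rz; apply/max_idPl; rewrite subr_le0 -[1](expr1n R 2).
rewrite ler_sqr ?nnegrE ?divr_ge0 ?dist_ge0 ?(ltW r0) //.
by rewrite ler_pdivlMr // mul1r.
Qed.

(* [cutoff r] is the supremum over [v] in [V] of the truncated paraboloids
   [1 - |. - v|^2 / r^2], each of which has [step4] equal to [- 4 h^2 / r^2]. *)
Lemma step4_cutoff_ge (h r : R) z : 0 < r -> 0 <= h ->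
  - (4 * (h / r) ^+ 2) <= step4 h (cutoff r) z.
Proof.
move=> r0 h0; rewrite leNgt; apply/negP => lt.
have q0 := sqr_ge0 (h / r).
have [c0|c0] := leP (1 - (dist V z / r) ^+ 2) 0.
  have cE : cutoff r z = 0 by apply/max_idPl.
  move: lt; rewrite /step4 cE.
  have := cutoff_ge0 r (z + Complex h 0); have := cutoff_ge0 r (z - Complex h 0).
  have := cutoff_ge0 r (z + Complex 0 h); have := cutoff_ge0 r (z - Complex 0 h); lra.
have cE : cutoff r z = 1 - (dist V z / r) ^+ 2 by apply/max_idPr/ltW.
(* The infimum defining [dist V z] need not be attained. Instead, a defect [e > 0] would force
   [|z - v|^2 >= dist^2 + r^2 e / 4] for every [v] in [V], against the definition of the infimum. *)
pose e := - (4 * (h / r) ^+ 2) - step4 h (cutoff r) z.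
have e0 : 0 < e by rewrite /e; lra.
pose Y := dist V z ^+ 2 + r ^+ 2 * (e / 4).
have r20 : 0 < r ^+ 2 by rewrite exprn_gt0.
have d20 := sqr_ge0 (dist V z).
have Y0 : 0 <= Y by rewrite addr_ge0 // mulr_ge0 ?(ltW r20) //; lra.
have lb v z' : V v -> 1 - normc (z' - v) ^+ 2 / r ^+ 2 <= cutoff r z'.
  move=> Vv; rewrite le_max; apply/orP; right; rewrite lerB // -expr_div_n.
  rewrite ler_sqr ?nnegrE ?divr_ge0 ?dist_ge0 ?normc_ge0 ?(ltW r0) //.
  by rewrite ler_pM2r ?invr_gt0 //; exact: dist_le.
have H v : V v -> Num.sqrt Y <= normc (z - v).
  move=> Vv; rewrite -[leRHS]ger0_norm ?normc_ge0 // -sqrtr_sqr ler_wsqrtr //.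
  have := lb v (z + Complex h 0) Vv; have := lb v (z - Complex h 0) Vv.
  have := lb v (z + Complex 0 h) Vv; have := lb v (z - Complex 0 h) Vv.
  set a1 := cutoff r _; set a2 := cutoff r _; set a3 := cutoff r _; set a4 := cutoff r _.
  move=> h4 h3 h2 h1.
  have eE : e = - (4 * (h / r) ^+ 2) - (a4 + a3 + a2 + a1 - 4 * (1 - (dist V z / r) ^+ 2)).
    by rewrite -cE.
  have para : (1 - normc (z + Complex h 0 - v) ^+ 2 / r ^+ 2)
    + (1 - normc (z - Complex h 0 - v) ^+ 2 / r ^+ 2)
    + (1 - normc (z + Complex 0 h - v) ^+ 2 / r ^+ 2)
    + (1 - normc (z - Complex 0 h - v) ^+ 2 / r ^+ 2)
    = 4 - 4 * (normc (z - v) ^+ 2 / r ^+ 2) - 4 * (h / r) ^+ 2.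
    rewrite !normc_sqr; case: (z) (v) => x y [x' y'] /=.
    by field; rewrite gt_eqF.
  have main : e <= 4 * (normc (z - v) ^+ 2 / r ^+ 2) - 4 * (dist V z / r) ^+ 2 by lra.
  have dr : (dist V z / r) ^+ 2 = dist V z ^+ 2 / r ^+ 2 by rewrite expr_div_n.
  have : (Y - normc (z - v) ^+ 2) / r ^+ 2 <= 0.
    rewrite (_ : _ / _ = e / 4 + dist V z ^+ 2 / r ^+ 2 - normc (z - v) ^+ 2 / r ^+ 2).
      by rewrite -dr; lra.
    by rewrite /Y; field; rewrite gt_eqF.
  by rewrite pmulr_lle0 ?invr_gt0 // subr_le0.
have := dist_ge V0 H; rewrite leNgt => /negP; apply.
have d0 := dist_ge0 z.
have rY : 0 < r ^+ 2 * (e / 4) by apply: mulr_gt0 => //; lra.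
have Yp : 0 < Y by exact: ltr_wpDl.
by rewrite -[dist V z]ger0_norm // -sqrtr_sqr ltr_sqrt // ltrDl.
Qed.

(** The value 1 extends to distance [2 r] so that poles where it is smaller stay at distance at
    least [r] from the support of [cutoff r]. *)
Definition plateau (r : R) z : R := Num.max 0 (Num.min 1 (3 - dist V z / r)).

Lemma plateau_continuous r : 0 < r -> continuous (plateau r).
Proof.
move=> r0; apply: (@lipschitzC_continuous R r^-1) => u w.
have h1 : dist V u / r <= normc (w - u) / r + dist V w / r.
  rewrite -mulrDl ler_pM2r ?invr_gt0 //.
  by have := dist_lip u w; rewrite (normc_distC u w); lra.
have n0 : 0 <= normc (w - u) / r by rewrite divr_ge0 ?normc_ge0 // ltW.
rewrite mulrC /plateau.
set a := dist V w / r in h1 *; set b := dist V u / r in h1 *.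
set c := normc (w - u) / r in h1 n0 *.
case: (leP 1 (3 - a)) => ?; case: (leP 1 (3 - b)) => ?; case_max; lra.
Qed.

Lemma plateau_ge0 r z : 0 <= plateau r z.
Proof. by rewrite le_max lexx. Qed.

Lemma plateau_in r z : 0 < r -> dist V z <= 2 * r -> plateau r z = 1.
Proof.
move=> r0 dr; have : dist V z / r <= 2 by rewrite ler_pdivrMr.
by move=> h; rewrite /plateau (min_idPl _); [apply/max_idPr|lra].
Qed.

Lemma plateau_mono r r' z : 0 < r -> r <= r' -> plateau r z <= plateau r' z.
Proof.
move=> r0 rr; have h : dist V z / r' <= dist V z / r.
  by rewrite ler_wpM2l ?dist_ge0 // lef_pV2 ?posrE // (lt_le_trans r0).
rewrite /plateau.
case: (leP 1 (3 - dist V z / r)) => ?; case: (leP 1 (3 - dist V z / r')) => ?;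
  case_max; lra.
Qed.

Lemma plateau_out r z : 0 < r -> 3 * r <= dist V z -> plateau r z = 0.
Proof.
move=> r0 dr; have : 3 <= dist V z / r by rewrite ler_pdivlMr.
by move=> h; apply/max_idPl; rewrite ge_min; apply/orP; right; lra.
Qed.

Lemma plateau_le1 r z : plateau r z <= 1.
Proof. by rewrite ge_max ler01 ge_min lexx. Qed.

End Nonempty.
End Distance.

(** * Mass of the roots in a component *)

Section ComponentMass.
Context {R : realType}.
Implicit Types (z w : R[i]) (V : set R[i]).

Lemma avg_gsum (s : seq R[i]) h M (F : R[i] -> R[i] -> R) :
  avg s (fun w => gsum h M (F ^~ w)) = gsum h M (fun z => avg s (F z)).
Proof.
rewrite /gsum (avg_sum s (fun (a : 'I_(M + M).+1) w => \sum_(b < (M + M).+1) F (gpt h M a b) w)).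
apply: eq_bigr => a _.
exact: (avg_sum s (fun (b : 'I_(M + M).+1) w => F (gpt h M a b) w)).
Qed.

Lemma fun_gsum (S : set R[i]) E h M (F : R[i] -> R[i] -> R) :
  functional S E -> (forall z, continuous (F z)) ->
  E (fun w => gsum h M (F ^~ w)) = gsum h M (fun z => E (F z)).
Proof.
move=> fE cF; rewrite /gsum.
rewrite (fun_sum fE (F := fun (a : 'I_(M + M).+1) w => \sum_(b < (M + M).+1) F (gpt h M a b) w)).
  apply: eq_bigr => a _.
  exact: (fun_sum fE (F := fun (b : 'I_(M + M).+1) w => F (gpt h M a b) w)).
by move=> a; apply: cont_sum => b.
Qed.

Lemma gsum_continuous h M (F : R[i] -> R[i] -> R) : (forall z, continuous (F z)) ->
  continuous (fun w => gsum h M (F ^~ w)).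
Proof. by move=> cF; apply: cont_sum => a; apply: cont_sum => b. Qed.

Lemma step4_cst (h c : R) z : step4 h (fun=> c) z = 0.
Proof. by rewrite /step4; ring. Qed.

(** Summation by parts against 1 shows that the values of [step4] add up to zero, so their lower
    bound alone controls the sum of absolute values: [|x| <= x + 8 (h / r)^2]. No regularity of [V]
    is involved. *)
Lemma gsum_norm_step4_cutoff V (h r X : R) M : V !=set0 -> 0 < r -> 0 < h ->
  X < h * M%:R -> (forall z, X <= normc z -> cutoff V r z = 0) ->
  gsum h M (fun z => `|step4 h (cutoff V r) z|) <= 8 * ((M + M).+1%:R * (h / r)) ^+ 2.
Proof.
move=> V0 r0 h0 XM out.
have Z : gsum h M (fun z => step4 h (cutoff V r) z) = 0.
  have re0 z : X < `|re z| -> cutoff V r z = 0.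
    by move=> zX; apply: out; apply: le_trans (normr_re z); exact: ltW.
  have im0 z : X < `|im z| -> cutoff V r z = 0.
    by move=> zX; apply: out; apply: le_trans (normr_im z); exact: ltW.
  have := step4_parts (fun=> 1) h0 XM re0 im0.
  rewrite (@eq_gsum R h M _ (fun=> 0)); last by move=> z; rewrite step4_cst mulr0.
  rewrite gsum_cst mulr0 => /esym; apply: etrans; apply: eq_gsum => z.
  by rewrite mul1r.
apply: (@le_trans _ _ (gsum h M (fun z => step4 h (cutoff V r) z + 8 * (h / r) ^+ 2))).
  apply: gsum_le => a b; have := step4_cutoff_ge V0 (gpt h M a b) r0 (ltW h0).
  have := sqr_ge0 (h / r); rewrite ler_norml => ? ?; apply/andP; split; lra.
by rewrite gsumD Z add0r gsum_cst mulrCA -exprMn.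
Qed.

(** Here [|z|^2 + h^2 <= 3 h^2], so [step4_kap_ge] gives [ln (1 + 2/9) / 2], which is at least
    1/18. *)
Lemma step4_kap_near (h : R) z : 0 < h -> `|re z| <= h -> `|im z| <= h ->
  1 / 18 <= step4 h (kap h) z.
Proof.
move=> h0 rz iz; apply: le_trans (step4_kap_ge z h0 (lexx _)).
have n2 : normc z ^+ 2 <= 2 * h ^+ 2.
  have sq x : `|x| <= h -> x ^+ 2 <= h ^+ 2.
    by move=> xh; rewrite -real_normK ?num_real // ler_sqr ?nnegrE // ltW.
  by rewrite normc_sqr; have := sq _ rz; have := sq _ iz; lra.
have h20 : 0 < h ^+ 2 by rewrite exprn_gt0.
have n0 := sqr_ge0 (normc z).
set x := 2 * _ * _ / _.
have x1 : 2 / 9 <= x.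
  rewrite /x ler_pdivlMr; last by apply: exprn_gt0; lra.
  have : (normc z ^+ 2 + h ^+ 2) ^+ 2 <= (3 * h ^+ 2) ^+ 2.
    by rewrite ler_sqr ?nnegrE; lra.
  by lra.
have l1 : ln (1 + 2 / 9) <= ln (1 + x) by rewrite ler_ln ?posrE; lra.
have : 2 / 9 / 2 <= ln (1 + 2 / 9) :> R by apply: ln1D_ge; lra.
by lra.
Qed.

(** For [w] near [V] the total mass 512 is used. Otherwise every grid point in the support is at
    distance at least [r] from [w] and contributes at most [8 (h / r)^4]. *)
Lemma gsum_cutoff_kap_le V (h r : R) M w : V !=set0 -> 0 < h -> 0 < r ->
  gsum h M (fun z => cutoff V r z * step4 h (kap h) (z - w))
  <= 512 * plateau V r w + 8 * ((M + M).+1%:R * (h / r) ^+ 2) ^+ 2.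
Proof.
move=> V0 h0 r0; have nn : 0 <= 8 * ((M + M).+1%:R * (h / r) ^+ 2) ^+ 2 by posi.
have [dw|dw] := leP (dist V w) (2 * r).
  rewrite plateau_in // mulr1; apply: (@le_trans _ _ 512); last by lra.
  apply: le_trans (gsum_kap_le M w h0); apply: gsum_le => a b.
  by rewrite ler_piMl ?cutoff_le1 // step4_kap_ge0.
apply: (@le_trans _ _ (8 * ((M + M).+1%:R * (h / r) ^+ 2) ^+ 2)); last first.
  by rewrite lerDr mulr_ge0 // plateau_ge0.
rewrite exprMn mulrCA -(gsum_cst h); apply: gsum_le => a b.
set z := gpt h M a b.
have [zr|zr] := leP r (dist V z); first by rewrite cutoff_out // mul0r; posi.
have zw : r <= normc (z - w).
  by have := dist_lip V0 w z; rewrite normc_distC; lra.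
apply: (@le_trans _ _ (1 * (8 * (h ^+ 2 / (normc (z - w) ^+ 2 + h ^+ 2)) ^+ 2))).
  by apply: ler_pM; rewrite ?cutoff_ge0 ?cutoff_le1 ?step4_kap_ge0 ?step4_kap_le.
rewrite mul1r ler_pM2l // (expr_div_n h).
have h20 : 0 < h ^+ 2 by rewrite exprn_gt0.
have r20 : 0 < r ^+ 2 by rewrite exprn_gt0.
have zw2 : r ^+ 2 <= normc (z - w) ^+ 2 by rewrite ler_sqr ?nnegrE; lra.
have q : h ^+ 2 / (normc (z - w) ^+ 2 + h ^+ 2) <= h ^+ 2 / r ^+ 2.
  by rewrite ler_pM2l // lef_pV2 ?posrE; lra.
have q0 : 0 <= h ^+ 2 / (normc (z - w) ^+ 2 + h ^+ 2) by rewrite divr_ge0; lra.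
by rewrite ler_sqr ?nnegrE //; apply: le_trans q.
Qed.

Section Component.
Variables (K S : set R[i]) (B : R) (s : nat -> seq R[i]) (E : (R[i] -> R) -> R).
Hypothesis H : setting K S B s E.
Hypothesis S_int : S `&` K° = set0.
Variable V : set R[i].
Hypothesis VK : V `<=` K.
Hypothesis V_ball : forall z (r : R), cball z r `<=` K -> forall w, cball z r w ->
  V z <-> V w.
Hypothesis V_null : forall e : R, 0 < e -> exists2 r : R, 0 < r & E (plateau V r) <= e.

(** In [kato_ineq] each root in the small ball contributes at least 1/18 on the left through its
    nearest grid point. The right side consists of three errors of at most [e / 72]: the
    [omega]-mass near [V], the far tail of the kernel, and the term with [c]. *)
Lemma component_mass x (rho : R) : 0 < rho -> cball x (2 * rho) `<=` K -> V x ->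
  forall e : R, 0 < e ->
  \forall k \near \oo, avg (s k) (\1_(cball x rho) : R[i] -> R) <= e.
Proof.
move=> rho0 xK Vx e e0.
have V0 : V !=set0 by exists x.
have B0 : 0 < B := set_gt0 H.
have fE := set_functional H.
have KB := set_disk H.
have e1 : 0 < e / 72 / 512 by lra.
have [r1 r10 r1E] := V_null e1.
pose r := Num.min r1 (1 / 4).
have r0 : 0 < r by rewrite lt_min r10; lra.
have r4 : r <= 1 / 4 by rewrite ge_min lexx orbT.
have rE : E (plateau V r) <= e / 72 / 512.
  apply: le_trans r1E; apply: (fun_le fE); try exact: plateau_continuous.
  by move=> w _; apply: plateau_mono => //; rewrite ge_min lexx.
clearbody r.
pose A := 2 * B + 4.
have A0 : 0 < A by rewrite /A; lra.
have Ar0 : 0 < (A / r) ^+ 2 by rewrite exprn_gt0 // divr_gt0.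
(* [A] bounds the side [(2 M + 1) h] of the grid, so the sum of [|step4 h phi|] is at most
   [8 (A / r)^2]; [c] times this is [e / 72]. *)
pose c := e / 72 / 8 / (A / r) ^+ 2.
have c0 : 0 < c by apply: divr_gt0 => //; lra.
have [h1 h10 shal] := shallow_uniform H c0.
pose h2 := e / 72 / 8 * r ^+ 2 / (A / r) ^+ 2.
have h20 : 0 < h2.
  apply: divr_gt0 => //; apply: mulr_gt0; last exact: exprn_gt0.
  by lra.
(* [h1] makes [u] small near the complement, [rho / 4] keeps the grid point nearest to a root inside
   the ball of radius [2 rho], 1/4 keeps the stencil inside the disk of radius [B + 1], and [h2]
   controls the tail of the kernel. *)
pose h := Num.min (Num.min h1 (rho / 4)) (Num.min (1 / 4) h2).
have h0 : 0 < h by rewrite !lt_min h10 h20 /=; apply/andP; split; lra.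
have hh1 : h <= h1 by rewrite !ge_min lexx.
have hrho : h <= rho / 4 by rewrite !ge_min lexx orbT.
have h4 : h <= 1 / 4 by rewrite !ge_min lexx !orbT.
have hh2 : h <= h2 by rewrite !ge_min lexx !orbT.
clearbody h.
have B12 : 0 <= B + 1 / 2 by lra.
have [M [M1 M2 Mg]] := grid_near h0 B12.
set X := B + 1 / 2 in M1 M2 Mg.
have hX : X + h < B + 1 by rewrite /X; lra.
have nh : (M + M).+1%:R * h <= A.
  by rewrite -natr1 natrD /A /X in M2 *; lra.
have nhr : ((M + M).+1%:R * (h / r)) ^+ 2 <= (A / r) ^+ 2.
  rewrite ler_sqr ?nnegrE; [|by posi|by posi].
  by rewrite mulrA ler_pM2r ?invr_gt0.
have out z : X <= normc z -> cutoff V r z = 0.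
  move=> zX; apply: (cutoff_out V0) => //; apply: dist_ge => // v /VK /KB vB.
  by have := normc_sub_ge z v; rewrite /disk /mkset in vB; rewrite /X in zX; lra.
have nbr z z' : deep K h z -> normc (z' - z) <= h -> V z <-> V z'.
  move=> dz zz'; apply: (@V_ball z (2 * h)); first by move=> w; exact: dz.
  by rewrite /cball /=; lra.
near=> k.
have [s0 sB] : (0 < size (s k))%N /\ forall z, z \in s k -> normc z < B.
  by near: k; exact: set_roots H.
have shk : forall z z1 f1 f2, normc z < B + 1 -> ~ K z1 -> normc (z1 - z) < 4 * h ->
    log_like z h f1 -> log_like z h f2 -> `|avg (s k) f1 - E f2| <= c.
  by near: k; exact: shal.
have kl z := kap_log_like z h0.
have ml z := ln_max_log_like z h0.
have dup := @deep_upper R K S B (s k) E B0 KB S_int fE s0 sB h c h0.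
have u_le z : normc z < B + 1 -> ~ deep K h z ->
    `|avg (s k) (fun w => kap h (z - w)) - E (fun w => kap h (z - w))| <= c.
  move=> zB /existsNP[z1 /not_implyP[z1z Kz1]].
  by apply: (shk z z1) => //; lra.
have u_deep z : deep K h z -> - c <= E (fun w => kap h (z - w)) - avg (s k) (fun w => kap h (z - w)).
  move=> dz; have : avg (s k) (fun w => kap h (z - w)) - E (fun w => ln (Num.max (normc (w - z)) h)) <= c.
    apply: dup => // u z1 uB Kz1 z1u; apply: (le_trans (ler_norm _)).
    exact: (shk u z1).
  (* The maximum principle has mixed kernels; [kap] dominates the truncated logarithm, so putting it
     under [E] only raises [u]. *)
  have : E (fun w => ln (Num.max (normc (w - z)) h)) <= E (fun w => kap h (z - w)).
    apply: (fun_le fE); [by case: (ml z)|by case: (kl z)|].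
    by move=> w _; have [_ /(_ w)/andP[]] := kl z.
  by lra.
have kato := @kato_ineq R S V B X h c M (s k) E (cutoff V r) (deep K h) fE h0 M1 hX
  (ltW c0) (cutoff_ge0 V r) (cutoff_in V0 r) out nbr.
have {kato}kato := kato _ _.
have low : 1 / 18 * avg (s k) (\1_(cball x rho) : R[i] -> R)
    <= gsum h M (fun z => if `[< V z >] then avg (s k) (fun w => step4 h (kap h) (z - w)) else 0).
  rewrite -avgZ.
  rewrite (@eq_gsum R h M _ (fun z => avg (s k) (fun w => if `[< V z >] then step4 h (kap h) (z - w) else 0))).
    rewrite -avg_gsum; apply: avg_le => w /sB wB.
    have p z : 0 <= (if `[< V z >] then step4 h (kap h) (z - w) else 0).
      by case: ifP => // _; exact: step4_kap_ge0.
    rewrite indicE; case: (boolP (w \in _)) => wx; last first.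
      by rewrite mulr0; apply: sumr_ge0 => a _; apply: sumr_ge0 => b _; exact: p.
    rewrite inE /cball /mkset in wx.
    have wX : normc w <= X by rewrite /X; lra.
    have [a _ aP] := Mg (re w) (le_trans (normr_re w) wX).
    have [b _ bP] := Mg (im w) (le_trans (normr_im w) wX).
    rewrite mulr1 /gsum (bigD1 a) //= (bigD1 b) //= -addrA.
    set z := gpt h M a b; apply: (@le_trans _ _ (if `[< V z >] then step4 h (kap h) (z - w) else 0)).
      have aP' : `|re (z - w)| <= h.
        by rewrite -normrN; move: aP; rewrite /z /gpt; case: (w) => u v /=; rewrite opprB.
      have bP' : `|im (z - w)| <= h.
        by rewrite -normrN; move: bP; rewrite /z /gpt; case: (w) => u v /=; rewrite opprB.
      rewrite asboolT; first exact: step4_kap_near.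
      apply/(@V_ball x (2 * rho)) => //; rewrite /cball /mkset.
      have := normc_triangle w z x; have := normc_le_add (z - w); lra.
    rewrite lerDl addr_ge0 //; first by apply: sumr_ge0 => i _; exact: p.
    by apply: sumr_ge0 => i _; apply: sumr_ge0 => j _; exact: p.
  move=> z; case: asboolP => // _; by rewrite avg_cst.
have cW z : continuous (fun w => step4 h (kap h) (z - w)).
  rewrite (_ : (fun w => _) = fun w => step4 h (fun z => kap h (z - w)) z).
    by apply: (@step4_continuous R h (fun z w => kap h (z - w)) z) => z'; exact: kap_continuous.
  by apply/funext => w; rewrite /step4 ![z + _ - w]addrAC.
have up : gsum h M (fun z => cutoff V r z * E (fun w => step4 h (kap h) (z - w)))
    <= 512 * E (plateau V r) + 8 * ((M + M).+1%:R * (h / r) ^+ 2) ^+ 2.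
  have cp := plateau_continuous V0 r0.
  rewrite (@eq_gsum R h M _ (fun z => E (fun w => cutoff V r z * step4 h (kap h) (z - w)))).
    rewrite -(fun_gsum h M (F := fun z w => cutoff V r z * step4 h (kap h) (z - w)) fE); last first.
      by move=> z; exact: contZ.
    rewrite -(funZ fE) // -[8 * _](fun_cst fE) -(funD fE); [|exact: contZ|exact: cont_cst].
    apply: (fun_le fE).
    - by apply: gsum_continuous => z; exact: contZ.
    - by apply: contD; [exact: contZ|exact: cont_cst].
    - by move=> w _; exact: gsum_cutoff_kap_le.
  by move=> z; rewrite (funZ fE).
have Dphi := gsum_norm_step4_cutoff V0 r0 h0 M1 out.
have {kato}kato : gsum h M (fun z => if `[< V z >] then avg (s k) (fun w => step4 h (kap h) (z - w)) else 0)
   <= gsum h M (fun z => cutoff V r z * E (fun w => step4 h (kap h) (z - w)))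
     + c * gsum h M (fun z => `|step4 h (cutoff V r) z|).
  apply: kato => z zB.
    have [dz|dz] := pselect (deep K h z); first exact: u_deep.
    by have := u_le z zB dz; rewrite ler_norml => /andP[]; lra.
  by move=> dz; have := u_le z zB dz; rewrite ler_norml => /andP[]; lra.
have t1 : c * gsum h M (fun z => `|step4 h (cutoff V r) z|) <= e / 72.
  apply: (@le_trans _ _ (c * (8 * (A / r) ^+ 2))).
    by rewrite ler_pM2l // (le_trans Dphi) // ler_pM2l.
  by rewrite /c le_eqVlt; apply/orP; left; apply/eqP; field; rewrite !gt_eqF.
have t2 : 8 * ((M + M).+1%:R * (h / r) ^+ 2) ^+ 2 <= e / 72.
  have -> : 8 * ((M + M).+1%:R * (h / r) ^+ 2) ^+ 2
     = 8 * ((M + M).+1%:R * (h / r)) ^+ 2 * (h / r) ^+ 2 by ring.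
  have hr : (h / r) ^+ 2 <= h2 / r ^+ 2.
    rewrite expr_div_n ler_pM2r ?invr_gt0 ?exprn_gt0 // expr2.
    have : 0 <= h * (1 / 4 - h) by apply: mulr_ge0; lra.
    by lra.
  apply: (@le_trans _ _ (8 * (A / r) ^+ 2 * (h2 / r ^+ 2))).
    by apply: ler_pM; [by posi|exact: sqr_ge0|by rewrite ler_pM2l|exact: hr].
  by rewrite /h2 le_eqVlt; apply/orP; left; apply/eqP; field; rewrite !gt_eqF.
have := le_trans low kato; lra.
Unshelve. all: by end_near. Qed.
End Component.
End ComponentMass.

(** * The equilibrium measure *)

Section Measure.
Import HBNNSimple.
Context {R : realType}.
Implicit Types (z w : R[i]) (K V : set R[i]).

Lemma open_borelC (A : set R[i]) : open A -> measurable (A : set (borelC R)).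
Proof. by move=> oA; exact: sub_sigma_algebra. Qed.

Lemma closed_borelC (A : set R[i]) : closed A -> measurable (A : set (borelC R)).
Proof.
move=> cA; rewrite -[A]setCK; apply: measurableC; apply: open_borelC.
exact: closed_openC.
Qed.

Lemma continuous_borelC (f : R[i] -> R) (D : set (borelC R)) : measurable D ->
  continuous f -> measurable_fun D (f : borelC R -> R).
Proof.
move=> mD cf; apply: (measurability _ (RGenOpens.measurableE R)).
move=> _ [_ [a [b ->] <-]]; apply: measurableI => //; apply: open_borelC.
by move/continuousP: cf => /(_ _ (interval_open _ _)); exact.
Qed.

(* No measurability of [f] is assumed: the library does not provide the
   measurability of [potential omega], to which this is applied. *)
Lemma integral_atomNy d (T : measurableType d) (mu : {measure set T -> \bar R})
    (f : T -> \bar R) x : measurable [set x] -> mu [set x] != 0%E ->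
  f x = -oo%E -> (\int[mu]_y f y = -oo)%E.
Proof.
move=> mx mux fx; rewrite integralE.
(* In [\bar R] the value [-oo] absorbs [+oo] in a sum, so the positive part may be infinite. *)
have -> : (\int[mu]_y f^\- y = +oo)%E; last by rewrite addeC.
have mu0 : (0 < mu [set x])%E by rewrite lt_def mux measure_ge0.
apply/eqP; rewrite eq_le leey /=.
have lower (c : R) : 0 <= c -> (c%:E * mu [set x] <= \int[mu]_y f^\- y)%E.
  move=> c0; pose h := scale_nnsfun (indic_nnsfun R mx) c0.
  have -> : (c%:E * mu [set x] = \int[mu]_y (h y)%:E)%E.
    under eq_integral do rewrite /h /= EFinM.
    by rewrite ge0_integralZl_EFin //; [rewrite integral_indic // setIT|
      move=> y _; rewrite lee_fin|apply/measurable_EFinP].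
  rewrite integral_nnsfun // ge0_integralTE //.
  apply: ereal_sup_ubound; exists h; last by rewrite patch_setT.
  move=> y; rewrite /h /= /mindic indicE; case: (boolP (y \in _)) => [|_].
    by rewrite inE => ->; rewrite mulr1 funenegE fx /= leey.
  by rewrite mulr0 funeneg_ge0.
case: (\int[mu]_y f^\- y)%E lower => [r|//|] lower; last by have := lower 0 (lexx _); rewrite mul0e.
case: (mu [set x]) mu0 lower => [m| |] // m0 lower.
  rewrite lte_fin in m0.
  have c0 : 0 <= (`|r| + 1) / m by apply: divr_ge0; [exact: addr_ge0|exact: ltW].
  have := lower _ c0; rewrite -EFinM mulfVK ?gt_eqF // lee_fin => h.
  by exfalso; have := ler_norm r; lra.
by have := lower 1 ler01; rewrite mul1e.
Qed.

(** At an atom the potential is [-oo]; integrating it over the same atom makes the energy [-oo], so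
    the capacity would be 0. *)
Lemma equilibrium_no_atom K (omega : probability (borelC R) R) x :
  non_polar K -> equilibrium_measure K omega -> omega [set x] = 0%E.
Proof.
move=> npK [_ eqK]; apply/eqP; apply: contrapT => /negP ox0.
have mx : measurable ([set x] : set (borelC R)).
  apply: closed_borelC; rewrite -[[set x]]setCK; apply: open_closedC.
  apply: openCP => y yx; exists (normc (x - y)).
    by rewrite normc_gt0 subr_eq0 eq_sym; apply/eqP.
  by move=> w wy E; move: wy; rewrite /cball /= E ltxx.
have px : potential omega x = -oo%E.
  apply: integral_atomNy mx ox0 _.
  by rewrite /log_mod subrr ComplexField.Normc.normc0 le0_lneNy.
have eN : energy omega = -oo%E by exact: integral_atomNy mx ox0 px.
by move: npK; rewrite /non_polar /capacity -eqK eN /= ltxx.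
Qed.

Section EquilibriumIntegral.
Variables (K S : set R[i]) (omega : probability (borelC R) R).
Hypotheses (cK : compact K) (SK : S `<=` K).
Hypotheses (mS : measurable (S : set (borelC R))) (S1 : omega S = 1%E).

Definition integralC (f : R[i] -> R) : R :=
  Rintegral omega (S : set (borelC R)) (f : borelC R -> R).

Lemma continuous_integrableC (f : R[i] -> R) : continuous f ->
  omega.-integrable S (EFin \o (f : borelC R -> R)).
Proof.
move=> cf; apply: measurable_bounded_integrable => //.
- by apply: le_lt_trans (probability_le1 omega mS) _; rewrite ltry.
- exact: continuous_borelC.
- have cfK : compact (f @` K).
    by apply: continuous_compact => //; exact: continuous_subspaceT.
  have [M [Mr MP]] := compact_bounded cfK.
  exists M; split=> // x Mx y Sy; apply: MP Mx _ _; exists y => //; exact: SK.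
Qed.

Lemma integralC_functional : functional S integralC.
Proof.
split.
- by move=> f g cf cg; apply: RintegralD => //; exact: continuous_integrableC.
- by move=> c f cf; apply: RintegralZl => //; exact: continuous_integrableC.
- by move=> f g cf cg fg; apply: le_Rintegral => //; exact: continuous_integrableC.
- by rewrite /integralC Rintegral_cst // mul1r; exact: (congr1 fine S1).
Qed.

Lemma integralC_le_measure (A : set (borelC R)) (f : R[i] -> R) (e : R) :
  measurable A -> continuous f -> (forall w, f w <= 1) -> (forall w, S w -> ~ A w -> f w <= 0) ->
  (omega A <= e%:E)%E -> integralC f <= e.
Proof.
move=> mA cf f1 f0 Ae.
have iA : omega.-integrable S (EFin \o (\1_A : borelC R -> R)).
  by apply: (integrableS measurableT) => //; exact: integrable_indic.
apply: (@le_trans _ _ (Rintegral omega S (\1_A : borelC R -> R))).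
  apply: le_Rintegral => //; first exact: continuous_integrableC.
  move=> w Sw; rewrite /indic; case: (boolP (w \in A)) => wA; first exact: f1.
  by apply: f0 => //; move/negP: wA; rewrite inE.
have AS : (omega (A `&` S) <= omega A)%E.
  by apply: le_measure; rewrite ?inE //; exact: measurableI.
rewrite /Rintegral integral_indic // -lee_fin fineK; first exact: le_trans AS Ae.
rewrite ge0_fin_numE //; apply: le_lt_trans AS _; exact: le_lt_trans Ae (ltry _).
Qed.

Lemma null_bigcap (A : nat -> set (borelC R)) : (forall n, measurable (A n)) ->
  (forall n m, (n <= m)%N -> A m `<=` A n) -> omega (\bigcap_n A n) = 0%E ->
  forall e : R, 0 < e -> exists n, (omega (A n) <= e%:E)%E.
Proof.
move=> mA decA A0 e e0.
have mI : measurable (\bigcap_n A n) by exact: bigcapT_measurable.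
have fin0 : (omega (A 0%N) < +oo)%E.
  by apply: le_lt_trans (probability_le1 omega (mA 0%N)) _; rewrite ltry.
have ni : nonincreasing_seq A by move=> n m nm; apply/subsetPset; exact: decA.
have : omega \o A @ \oo --> 0%E by rewrite -A0; exact: nonincreasing_cvg_mu.
move=> /fine_cvgP[_ /cvgrPdist_le /(_ e e0)].
move=> [n _ /(_ n (leqnn n))] /=; rewrite sub0r normrN => h; exists n.
rewrite -[omega (A n)]fineK; last by exact: fin_num_measure.
by rewrite lee_fin; apply: le_trans h; exact: ler_norm.
Qed.

(** Continuity from above gives a radius for each point, and compactness of [K] a common one. A ball
    of half that radius with any centre either misses [S] or lies in the full ball about one of its
    points in [S]. *)
Lemma no_atom_uniform : (forall x, omega [set x] = 0%E) -> forall e : R, 0 < e ->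
  exists2 d : R, 0 < d & forall z, integralC (tent z d) <= e.
Proof.
move=> atom0 e e0.
have small x : exists2 d : R, 0 < d & (omega (cball x d) <= e%:E)%E.
  pose A n : set (borelC R) := cball x n.+1%:R^-1.
  have [|||n nP] := @null_bigcap A _ _ _ e e0.
  - by move=> n; apply: open_borelC; exact: open_cball.
  - move=> n m nm w; rewrite /A /cball /= => /lt_le_trans; apply.
    by rewrite lef_pV2 ?posrE // ler_nat.
  - rewrite (_ : \bigcap_n A n = [set x]) //; apply/seteqP; split => w; last first.
      move=> -> n _; rewrite /A /cball /= subrr ComplexField.Normc.normc0.
      by rewrite invr_gt0.
    move=> wA; apply/eqP; rewrite -subr_eq0 -[_ == 0]negbK -normc_gt0; apply/negP => p.
    have := wA (Num.truncn (normc (w - x))^-1) I; rewrite /A /cball /=.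
    apply/negP; rewrite -leNgt -[leRHS]invrK lef_pV2 ?posrE ?invr_gt0 //.
    by rewrite ltW // truncnS_gt.
  - by exists n.+1%:R^-1; rewrite ?invr_gt0.
pose P (d : R) x := (omega (cball x d) <= e%:E)%E.
have near_P x : K x -> \forall x' \near x & d \near 0^'+, P d x'.
  move=> Kx; have [d d0 dP] := small x.
  exists (cball x (d / 2), [set d' | d' < d / 2]) => /=.
    split; first by apply: nbhs_cball; rewrite divr_gt0.
    by apply: nbhs_right_lt; rewrite divr_gt0.
  move=> [x' d'] /= [xx' dd']; rewrite /P; apply: le_trans dP.
  apply: le_measure; rewrite ?inE; try by apply: open_borelC; exact: open_cball.
  move=> w; rewrite /cball /= => wx'.
  by have := normc_triangle x' w x; rewrite /cball /= in xx'; lra.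
have Hn := (iffLR (compact_near_coveringP _) cK) _ _ _ _ near_P.
near (0 : R)^'+ => d.
have d0 : 0 < d by near: d; exact: nbhs_right_gt.
have dP : K `<=` P d by near: d; exact: Hn.
exists (d / 4); first by rewrite divr_gt0.
move=> z; have d4 : 0 < d / 4 by rewrite divr_gt0.
have [[w Sw wz]|nw] := pselect (exists2 w, S w & normc (w - z) < d / 2).
  apply: (@integralC_le_measure (cball z (d / 2))).
  - by apply: open_borelC; exact: open_cball.
  - exact: tent_continuous.
  - by move=> v; exact: tent_le1.
  - move=> v _ nv; rewrite tent_out //; move/negP: nv; rewrite -leNgt; lra.
  apply: le_trans (dP w (SK Sw)).
  apply: le_measure; rewrite ?inE; try by apply: open_borelC; exact: open_cball.
  move=> v; rewrite /cball /= => vz.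
  by have := normc_triangle z v w; rewrite (normc_distC z w); lra.
apply: (@integralC_le_measure set0).
- exact: measurable0.
- exact: tent_continuous.
- by move=> v; exact: tent_le1.
- move=> v Sv _; rewrite tent_out // leNgt; apply/negP => h; apply: nw.
  by exists v => //; lra.
by rewrite measure0 lee_fin ltW.
Unshelve. all: by end_near. Qed.

(** The open neighbourhoods of [V] decrease to its closure. The factor 3 is the distance, in units
    of [r], at which [plateau] vanishes. *)
Lemma plateau_null V : V !=set0 -> omega (closure V) = 0%E -> forall e : R, 0 < e ->
  exists2 r : R, 0 < r & integralC (plateau V r) <= e.
Proof.
move=> V0 oV e e0.
pose A n : set (borelC R) := [set w : R[i] | dist V w < 3 * n.+1%:R^-1].
have mA n : measurable (A n).
  apply: open_borelC; apply: openCP => w wn.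
  exists (3 * n.+1%:R^-1 - dist V w); first by rewrite subr_gt0.
  move=> v; rewrite /cball /A /= ltrBrDl => vw.
  exact: le_lt_trans (dist_lip V0 v w) vw.
have [||n nP] := @null_bigcap A mA _ _ e e0.
- move=> n m nm w; rewrite /A /= => /lt_le_trans; apply.
  by rewrite ler_pM2l // lef_pV2 ?posrE // ler_nat.
- apply: (@subset_measure0 _ _ _ omega _ (closure V)) => //.
  + exact: bigcapT_measurable.
  + by apply: closed_borelC; exact: closed_closure.
  move=> w wA U /nbhsCP[d d0 dU].
  have [v Vv wv] : exists2 v, V v & normc (w - v) < d.
    apply: contrapT => /forall2NP H.
    have dw : d <= dist V w.
      by apply: dist_ge => // v Vv; rewrite leNgt; apply/negP; case: (H v).
    have := wA (Num.truncn (3 / d)) I; rewrite /A /=; apply/negP; rewrite -leNgt.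
    apply: le_trans dw; rewrite ler_pdivrMr // mulrC -ler_pdivrMr //.
    by rewrite ltW // truncnS_gt.
  by exists v; split=> //; apply: dU; rewrite normc_distC.
exists n.+1%:R^-1; first by rewrite invr_gt0.
apply: (@integralC_le_measure (A n)) => //.
- by apply: plateau_continuous; rewrite ?invr_gt0.
- by move=> w; exact: plateau_le1.
- move=> w _ /negP; rewrite -leNgt => h; rewrite plateau_out //.
Qed.

End EquilibriumIntegral.
End Measure.

(** * Regular sequences of polynomials *)

Section Regularity.
Context {R : realType}.
Implicit Types (z w : R[i]) (P Q : {poly R[i]}).

Lemma ln_max_norm_le (eta x y : R) : 0 < eta ->
  `|ln (Num.max x eta) - ln (Num.max y eta)| <= eta^-1 * `|x - y|.
Proof.
move=> e0; have m v : eta <= Num.max v eta by rewrite le_max lexx orbT.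
have xy : `|Num.max x eta - Num.max y eta| <= `|x - y|.
  have := ler_norm (x - y); have := ler_norm (- (x - y)); rewrite normrN.
  have := normr_ge0 (x - y); rewrite ler_norml.
  by case: (leP x eta) => ?; case: (leP y eta) => ?; move=> ? ? ?; apply/andP; split; lra.
apply: (@le_trans _ _ (eta^-1 * `|Num.max x eta - Num.max y eta|)); last first.
  by rewrite ler_pM2l ?invr_gt0.
rewrite ler_norml (ln_sub_le e0) ?m // andbT lerNl opprB.
by rewrite distrC (ln_sub_le e0) ?m.
Qed.

Lemma ln_max_horner_continuous P (eta : R) : 0 < eta ->
  continuous (fun w => ln (Num.max (normc P.[w]) eta)).
Proof.
move=> e0; apply: continuousCP => z e ep.
have [d d0 dP] := horner_continuous P z (mulr_gt0 e0 ep).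
exists d => // w /dP wz; apply: (le_lt_trans (ln_max_norm_le _ _ e0)).
rewrite mulrC ltr_pdivrMr // mulrC; apply: le_lt_trans wz.
have := normc_sub_ge P.[w] P.[z]; have := normc_sub_ge P.[z] P.[w].
by rewrite (normc_distC P.[z]) ler_norml => ? ?; apply/andP; split; lra.
Qed.

Lemma ln_normc_prod (r : seq R[i]) w : (forall z, z \in r -> w != z) ->
  ln (normc (\prod_(z <- r) (w - z))) = \sum_(z <- r) ln (normc (w - z)).
Proof.
elim: r => [|z r IH] H.
  by rewrite !big_nil ComplexField.Normc.normc1 ln1.
rewrite !big_cons ComplexField.Normc.normcM lnM ?posrE ?normc_gt0.
- by rewrite IH // => u ur; apply: H; rewrite inE ur orbT.
- by rewrite subr_eq0 H // inE eqxx.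
- rewrite prodf_seq_neq0; apply/allP => u ur /=.
  by rewrite subr_eq0 H // inE ur orbT.
Qed.

Lemma horner_roots P w : P.[w] = lead_coef P * \prod_(z <- roots_mult P) (w - z).
Proof.
rewrite /roots_mult; case: closed_field_poly_normal => r /= PE.
rewrite {1}PE hornerZ horner_prod; congr (_ * _).
by apply: eq_bigr => z _; rewrite hornerXsubC.
Qed.

Lemma size_roots P : P != 0 -> size (roots_mult P) = degree P.
Proof.
move=> P0; rewrite /roots_mult /degree; case: closed_field_poly_normal => r /= PE.
by rewrite PE size_scale ?lead_coef_eq0 // size_prod_XsubC.
Qed.

Lemma mem_roots P z : P != 0 -> (z \in roots_mult P) = root P z.
Proof.
move=> P0; rewrite /roots_mult; case: closed_field_poly_normal => r /= PE.
by rewrite PE rootZ ?lead_coef_eq0 // root_prod_XsubC.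
Qed.

Lemma ln_normc_horner P w : P != 0 -> ~~ root P w ->
  ln (normc P.[w]) = ln (normc (lead_coef P))
    + \sum_(z <- roots_mult P) ln (normc (w - z)).
Proof.
move=> P0 Pw; rewrite horner_roots ComplexField.Normc.normcM.
have zP z : z \in roots_mult P -> w != z.
  by rewrite mem_roots // => rz; apply: contraNneq Pw => ->.
rewrite lnM ?posrE ?normc_gt0 ?lead_coef_eq0 //; first by rewrite ln_normc_prod.
rewrite prodf_seq_neq0; apply/allP => u /zP uw /=.
by rewrite subr_eq0.
Qed.

Section RegularSequence.
Variables (K S : set R[i]) (B : R) (s : nat -> seq R[i]) (E : (R[i] -> R) -> R).
Hypotheses (B0 : 0 < B) (KB : K `<=` disk B) (cK : closed K) (SK : S `<=` K).
Hypothesis fE : functional S E.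
Hypothesis sP : \forall k \near \oo, (0 < size (s k))%N /\
  forall z, z \in s k -> normc z < B.
Variable b : nat -> R.
(* [b k] collects the leading coefficient of [q k] and the energy; it is
   eliminated by comparing polynomials with the same number of roots. *)
Hypothesis reg : forall e : R, 0 < e -> \forall k \near \oo,
  forall z d, B <= normc z -> 0 < d -> (forall w, K w -> d <= normc (w - z)) ->
  `|b k + avg (s k) (fun w => ln (normc (w - z)))
    - E (fun w => ln (Num.max (normc (w - z)) d))| <= e.

(** Regularity, read at the roots of a polynomial lying off the disk, is summed over them: each one
    contributes one [b k]. A continuous [F] stands in for the sum of logarithms, each truncated at
    the distance of its own root to [K]. *)
Lemma regular_roots (r : seq R[i]) : (forall z, z \in r -> B <= normc z) ->
  exists F : R[i] -> R, [/\ continuous F,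
    forall w, K w -> F w = \sum_(z <- r) ln (normc (w - z)) &
    forall e : R, 0 < e -> \forall k \near \oo,
      `|(size r)%:R * b k + avg (s k) (fun w => \sum_(z <- r) ln (normc (w - z))) - E F| <= e].
Proof.
elim: r => [|z r IH] rB.
  exists (fun=> 0); split; [exact: cont_cst|by move=> w _; rewrite big_nil|].
  move=> e e0; near=> k.
  have [s0 _] : (0 < size (s k))%N /\ forall z, z \in s k -> normc z < B by near: k.
  rewrite (fun_cst fE) mul0r add0r subr0 (_ : (fun w => _) = fun=> 0).
    by rewrite avg_cst // normr0 ltW.
  by apply/funext => w; rewrite big_nil.
have [F [cF KF rF]] := IH (fun u ur => rB u (mem_behead (s := z :: r) ur)).
have zB : B <= normc z by apply: rB; rewrite inE eqxx.
have [d d0 dP] : exists2 d : R, 0 < d & forall w, K w -> d <= normc (w - z).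
  apply: closed_dist_gt0 => //.
  by move=> /KB; rewrite /disk /mkset ltNge zB.
have cd := @continuous_ln_max R d z d0.
exists (fun w => ln (Num.max (normc (w - z)) d) + F w); split.
- exact: contD.
- by move=> w Kw; rewrite big_cons KF // (max_idPl _) // dP.
move=> e e0; have e2 : 0 < e / 2 by rewrite divr_gt0.
near=> k.
have h1 : `|b k + avg (s k) (fun w => ln (normc (w - z)))
    - E (fun w => ln (Num.max (normc (w - z)) d))| <= e / 2.
  have : forall z d, B <= normc z -> 0 < d -> (forall w, K w -> d <= normc (w - z)) ->
    `|b k + avg (s k) (fun w => ln (normc (w - z)))
    - E (fun w => ln (Num.max (normc (w - z)) d))| <= e / 2 by near: k; exact: reg.
  by apply.
have h2 : `|(size r)%:R * b k + avg (s k) (fun w => \sum_(z <- r) ln (normc (w - z))) - E F|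
    <= e / 2 by near: k; exact: rF.
rewrite (_ : (fun w => _) = fun w => ln (normc (w - z)) + \sum_(z <- r) ln (normc (w - z))).
  rewrite avgD (funD fE) //= -[(size r).+1%:R]natr1.
  move: h1 h2; rewrite !ler_norml => /andP[? ?] /andP[? ?]; apply/andP; split; lra.
by apply/funext => w; rewrite big_cons.
Unshelve. all: by end_near. Qed.

Lemma fun_eq (f g : R[i] -> R) : continuous f -> continuous g ->
  (forall w, S w -> f w = g w) -> E f = E g.
Proof.
move=> cf cg fg; apply/eqP; rewrite eq_le.
by rewrite !(fun_le fE) // => w Sw; rewrite fg.
Qed.

Lemma eq_avg (t : seq R[i]) (f g : R[i] -> R) : (forall w, w \in t -> f w = g w) ->
  avg t f = avg t g.
Proof. by move=> fg; apply/eqP; rewrite eq_le !avg_le // => w wt; rewrite fg. Qed.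

Lemma regular_poly P (eta : R) : P != 0 -> 0 < eta ->
  (forall w, normc w < B -> eta <= normc P.[w]) ->
  forall e : R, 0 < e -> \forall k \near \oo,
  `|(degree P)%:R * b k + avg (s k) (fun w => ln (Num.max (normc P.[w]) eta))
    - E (fun w => ln (Num.max (normc P.[w]) eta))| <= e.
Proof.
move=> P0 eta0 etaP e e0.
have nroot w : normc w < B -> ~~ root P w.
  move=> /etaP; apply: contraTN => /rootP ->.
  by rewrite ComplexField.Normc.normc0 -ltNge.
have rB z : z \in roots_mult P -> B <= normc z.
  by rewrite mem_roots // leNgt; apply: contraTN => /nroot.
have [F [cF KF rF]] := regular_roots rB.
have lnE w : normc w < B -> ln (Num.max (normc P.[w]) eta)
    = ln (normc (lead_coef P)) + \sum_(z <- roots_mult P) ln (normc (w - z)).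
  by move=> wB; rewrite -ln_normc_horner // ?nroot // (max_idPl _) // etaP.
have EG : E (fun w => ln (Num.max (normc P.[w]) eta)) = ln (normc (lead_coef P)) + E F.
  rewrite -[ln (normc (lead_coef P))](fun_cst fE) -(funD fE) //; last exact: cont_cst.
  apply: fun_eq; [exact: ln_max_horner_continuous|by apply: contD => //; exact: cont_cst|].
  by move=> w /SK Kw; rewrite lnE ?KF //; exact: KB.
near=> k.
have [s0 sB] : (0 < size (s k))%N /\ forall z, z \in s k -> normc z < B by near: k.
have : `|(size (roots_mult P))%:R * b k
   + avg (s k) (fun w => \sum_(z <- roots_mult P) ln (normc (w - z))) - E F| <= e.
  by near: k; exact: rF.
rewrite size_roots // EG => h.
have -> : avg (s k) (fun w => ln (Num.max (normc P.[w]) eta))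
    = ln (normc (lead_coef P)) + avg (s k) (fun w => \sum_(z <- roots_mult P) ln (normc (w - z))).
  by rewrite -[in RHS](@avg_cst _ (s k) (ln _)) // -avgD; apply: eq_avg => w /sB /lnE.
apply: le_trans h.
by rewrite le_eqVlt; apply/orP; left; apply/eqP; congr (`|_|); ring.
Unshelve. all: by end_near. Qed.

(* [ln |1 + t Q| - ln |1 - t Q|] is [2 t Re Q] up to [O(t^2)], and for small
   [t] the polynomials [1 + t Q], [1 - t Q] have no root in the disk. *)
Lemma regular_good Q : good s E (fun w => re Q.[w]).
Proof.
move: (B0) => B0' e e0.
(* For nonconstant [Q] the polynomials [1 + t Q] and [1 - t Q] have the degree of [Q]; constants are
   treated directly. *)
have [Q1|Q1] := leqP (size Q) 1.
  near=> k.
  have [s0 sB] : (0 < size (s k))%N /\ forall z, z \in s k -> normc z < B by near: k.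
  rewrite (_ : (fun w => _) = fun=> re Q`_0).
    by rewrite avg_cst // (fun_cst fE) subrr normr0 ltW.
  by apply/funext => w; rewrite [in LHS](size1_polyC Q1) hornerC.
have [M M0 MP] := horner_bounded Q B.
pose M1 := M + 1.
have M10 : 0 < M1 by rewrite /M1; lra.
have MM1 w : normc w < B -> normc Q.[w] <= M1 by move=> /MP; rewrite /M1; lra.
clearbody M1.
(* The first bound allows [ln_normc_1D_bound]; the second makes its two errors, [26 (t M1)^2]
   together, at most [t e / 2]. *)
pose t := Num.min (1 / 2 / M1) (e / 60 / M1 ^+ 2).
have t0 : 0 < t by rewrite lt_min !divr_gt0 ?exprn_gt0 //; lra.
have t1 : t * M1 <= 1 / 2 by rewrite -ler_pdivlMr // ge_min lexx.
have t2 : t * M1 ^+ 2 <= e / 60 by rewrite -ler_pdivlMr ?exprn_gt0 // ge_min lexx orbT.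
clearbody t.
pose P (u : R) := 1 + (u%:C)%C *: Q.
have Pw u w : (P u).[w] = 1 + (u%:C)%C * Q.[w] by rewrite hornerD hornerC hornerZ.
have small u w : `|u| = t -> normc w < B -> normc ((u%:C)%C * Q.[w]) <= t * M1.
  move=> ut wB; rewrite ComplexField.Normc.normcM normc_real ut ler_pM2l //.
  exact: MM1.
have lowP u : `|u| = t -> forall w, normc w < B -> 1 / 2 <= normc (P u).[w].
  move=> ut w wB; rewrite Pw; have := small u w ut wB.
  have := normc_sub_ge 1 (- ((u%:C)%C * Q.[w])).
  by rewrite opprK normcN ComplexField.Normc.normc1; lra.
have uC u : `|u| = t -> (u%:C)%C != 0 :> R[i].
  by move=> ut; rewrite -normc_gt0 normc_real ut.
have sizeP u : `|u| = t -> size (P u) = size Q.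
  move=> ut; rewrite /P addrC size_polyDl ?size_scale ?uC // size_poly1.
  exact: Q1.
have P0 u : `|u| = t -> P u != 0.
  by move=> ut; rewrite -size_poly_gt0 sizeP // (leq_trans _ Q1).
pose G u w := ln (Num.max (normc (P u).[w]) (1 / 2)).
have h12 : 0 < 1 / 2 :> R by lra.
have cG u : continuous (G u) by exact: ln_max_horner_continuous.
have Gre u w : `|u| = t -> normc w < B -> `|G u w - u * re Q.[w]| <= 13 * (t * M1) ^+ 2.
  move=> ut wB; rewrite /G (max_idPl _); last exact: lowP.
  rewrite Pw; have sm := small u w ut wB.
  have -> : u * re Q.[w] = re ((u%:C)%C * Q.[w]).
    by case: (Q.[w]) => x y /=; rewrite mul0r subr0.
  apply: (le_trans (ln_normc_1D_bound _)); first by lra.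
  by rewrite ler_pM2l // ler_sqr ?nnegrE ?normc_ge0 // mulr_ge0 // ltW.
have tt : `|t| = t by rewrite gtr0_norm.
have tN : `|- t| = t by rewrite normrN.
have Gdiff w : normc w < B -> `|2 * t * re Q.[w] - (G t w - G (- t) w)| <= t * (e / 2).
  move=> wB; have := Gre t w tt wB; have := Gre (- t) w tN wB.
  have : 26 * (t * M1) ^+ 2 <= t * (e / 2).
    rewrite (_ : 26 * _ = t * (26 * (t * M1 ^+ 2))); last by ring.
    by rewrite ler_pM2l //; lra.
  by rewrite !ler_norml => ? /andP[? ?] /andP[? ?]; apply/andP; split; lra.
have te : 0 < t * e / 2 by rewrite divr_gt0 // mulr_gt0.
have cR : continuous (fun w => re Q.[w]) := @re_horner_continuous R Q.
have cD : continuous (fun w => G t w - G (- t) w) by exact: contB.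
have ED : `|2 * t * E (fun w => re Q.[w]) - (E (G t) - E (G (- t)))| <= t * (e / 2).
  rewrite -(funZ fE) // -(funB fE) // -(funB fE) //; last exact: contZ.
  rewrite -[leRHS](fun_cst fE); apply: (fun_norm_le fE).
  - by apply: contB => //; exact: contZ.
  - exact: cont_cst.
  - by move=> w /SK /KB; exact: Gdiff.
have r1 := regular_poly (P0 t tt) h12 (lowP t tt) te.
have r2 := regular_poly (P0 (- t) tN) h12 (lowP (- t) tN) te.
near=> k.
have [s0 sB] : (0 < size (s k))%N /\ forall z, z \in s k -> normc z < B by near: k.
have r1' : `|(degree (P t))%:R * b k + avg (s k) (G t) - E (G t)| <= t * e / 2 by near: k; exact: r1.
have r2' : `|(degree (P (- t)))%:R * b k + avg (s k) (G (- t)) - E (G (- t))| <= t * e / 2.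
  by near: k; exact: r2.
have AD : `|2 * t * avg (s k) (fun w => re Q.[w]) - (avg (s k) (G t) - avg (s k) (G (- t)))| <= t * (e / 2).
  rewrite -[avg _ (G (- t))]mul1r -mulNr -!avgZ -avgD.
  rewrite -[X in `|_ - X|]mul1r -mulNr -avgZ -avgD -[leRHS](@avg_cst _ (s k)) //.
  by apply: avg_norm_le => w /sB wB; have := Gdiff w wB; rewrite !mulN1r.
(* Equal degrees make the unknown [b k] cancel in the difference. *)
have dE : degree (P t) = degree (P (- t)) by rewrite /degree !sizeP.
rewrite dE in r1'.
rewrite -(ler_pM2l (_ : 0 < 2 * t)) ?mulr_gt0 // -[X in X * `|_|](@gtr0_norm _ (2 * t)) ?mulr_gt0 //.
rewrite -normrM mulrBr.
move: ED AD r1' r2'; rewrite !ler_norml => /andP[? ?] /andP[? ?] /andP[? ?] /andP[? ?].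
by apply/andP; split; lra.
Unshelve. all: by end_near. Qed.

End RegularSequence.
End Regularity.

(** * Components of the interior and potentials *)

Section Components.
Context {R : realType}.
Implicit Types (z w : R[i]) (A : set R[i]).

Lemma segment_connectedC z w :
  connected [set z + (t%:C)%C * (w - z) | t in `[0, 1] : set R].
Proof.
apply: connected_continuous_connected; first exact: segment_connected.
apply: continuous_subspaceT => t A /nbhsCP[e e0 eA].
have n0 : 0 < normc (w - z) + 1 by rewrite ltr_wpDl ?normc_ge0.
apply/nbhs_normP; exists (e / (normc (w - z) + 1)) => /=; first by rewrite divr_gt0.
move=> u /=; rewrite ltr_pdivlMr // => ut; apply: eA.
rewrite opprD addrACA subrr add0r -mulrBl ComplexField.Normc.normcM -rmorphB normc_real.
rewrite distrC; apply: le_lt_trans ut; apply: ler_wpM2l => //.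
by rewrite lerDl.
Qed.

Lemma cball_component A z r w : cball z r `<=` A -> cball z r w ->
  connected_component A z w.
Proof.
move=> zA zw.
apply: (@connected_component_max _ A [set z + (t%:C)%C * (w - z) | t in `[0, 1] : set R] z _ _ _ w).
- by exists 0; rewrite ?mul0r ?addr0 //= in_itv /= lexx ler01.
- move=> _ [t /= ti <-]; apply: zA; rewrite /cball /= addrC addKr.
  move: ti; rewrite in_itv /= => /andP[t0 t1].
  rewrite ComplexField.Normc.normcM normc_real ger0_norm //.
  by apply: le_lt_trans zw; rewrite ler_piMl // normc_ge0.
- exact: segment_connectedC.
- by exists 1; rewrite ?mul1r ?subrKC //= in_itv /= lexx ler01.
Qed.

Lemma cball_interior A z r : cball z r `<=` A -> cball z r `<=` A°.
Proof.
by move=> zA w zw; apply: filterS zA _; apply: open_nbhs_nbhs; split=> //; exact: open_cball.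
Qed.

Lemma component_ball A a z r : cball z r `<=` A -> forall w, cball z r w ->
  connected_component A a z <-> connected_component A a w.
Proof.
move=> zA w zw; have C := cball_component zA zw; split => H.
  exact: connected_component_trans H C.
by apply: connected_component_trans H (connected_component_sym C).
Qed.

Lemma rational_point z (e : R) : 0 < e ->
  exists a b : rat, normc (Complex (ratr a) (ratr b) - z) < e.
Proof.
move=> e0; have near x : exists a : rat, `|ratr a - x| < e / 2.
  have xl : x - e / 2 < x + e / 2 by lra.
  have [a] := rat_in_itvoo xl; rewrite in_itv /= => /andP[a1 a2].
  by exists a; rewrite ltr_norml; apply/andP; split; lra.
have [a aP] := near (re z); have [b bP] := near (im z); exists a, b.
apply: (le_lt_trans (normc_le_add _)); rewrite [e]splitr.
by move: aP bP; case: z => x y /= aP bP; rewrite ltrD.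
Qed.

(** Every component of the open set [K°] contains a point with rational coordinates, so countably
    many null sets cover it. Rational points outside [K°] yield the empty component. *)
Lemma interior_null (K : set R[i]) (omega : probability (borelC R) R) :
  (forall V : set R[i], components K° V -> omega (closure V) = 0%E) ->
  omega (K° : set (borelC R)) = 0%E.
Proof.
move=> H; pose C (n : nat) : set (borelC R) :=
  if (unpickle n : option (rat * rat)%type) is Some ab
  then connected_component K° (Complex (ratr ab.1) (ratr ab.2)) else set0.
have oK : open K° := open_interior K.
have Cnull n : omega.-negligible (C n).
  rewrite /C; case: (unpickle n) => [[a b]|]; last exact: negligible_set0.
  set p := Complex _ _.
  have [Kp|Kp] := pselect (K° p); last first.
    by rewrite connected_component_out //; exact: negligible_set0.
  exists (closure (connected_component K° p)); split.
  - by apply: closed_borelC; exact: closed_closure.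
  - by apply: H; exists p.
  - exact: subset_closure.
apply/negligibleP; first exact: open_borelC.
apply: negligibleS (negligible_bigcup Cnull) => z Kz.
have /nbhsCP[e e0 eK] : nbhs z K° by apply: open_nbhs_nbhs.
have [a [b ab]] := rational_point z e0.
have pK := pickleK (a, b); move: (pickle (a, b)) pK => n pK.
exists n; first exact: I.
rewrite /C pK; apply: connected_component_sym; exact: (cball_component eK).
Qed.

End Components.

Section Potential.
Context {R : realType}.
Variables (K S : set R[i]) (omega : probability (borelC R) R).
Hypotheses (cK : compact K) (SK : S `<=` K).
Hypotheses (mS : measurable (S : set (borelC R))) (S1 : omega S = 1%E).

Lemma measurable_log_mod (z : R[i]) :
  measurable_fun setT (fun w : borelC R => log_mod (z - w)).
Proof.
have mn : measurable_fun setT (fun w : borelC R => normc (z - w)).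
  apply: continuous_borelC => //.
  rewrite (_ : (fun w => _) = fun w => normc (w - z)); first exact: continuous_dist.
  by apply/funext => v; rewrite normc_distC.
rewrite /log_mod /lne; apply: measurable_fun_ifT => //.
  by apply: measurable_fun_ler => //; exact: measurable_cst.
by apply/measurable_EFinP; apply: (measurableT_comp (@measurable_ln R) mn).
Qed.

Lemma potentialE (z : R[i]) (d : R) : 0 < d -> (forall w, K w -> d <= normc (w - z)) ->
  potential omega z = (integralC S omega (fun w => ln (Num.max (normc (w - z)) d)))%:E.
Proof.
move=> d0 dP; set g := fun w : R[i] => _.
have cg : continuous g by exact: continuous_ln_max.
have ig := continuous_integrableC omega cK SK mS cg.
rewrite /integralC /Rintegral fineK; last exact: integrable_fin_num.
rewrite integral_mkcond; apply: ae_eq_integral => //.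
- exact: measurable_log_mod.
- apply/(measurable_restrictT _ mS); exact: measurable_int ig.
exists (~` S); split.
- exact: measurableC.
- apply: etrans (probability_setC omega mS) _.
  by apply: etrans (congr1 (fun x => 1 - x)%E S1) _; rewrite subee.
- move=> w /= H Sw; apply: H => _; rewrite patchE mem_set //= /g.
  have dw := dP w (SK Sw); rewrite (max_idPl dw) /log_mod normc_distC lne_EFin //.
  by rewrite normc_distC; exact: lt_le_trans d0 dw.
Qed.

End Potential.

(** * The theorem *)

Section Assembly.
Context {R : realType}.
Implicit Types (z w : R[i]) (p : {poly R[i]}).

Lemma root_distributionE p (L : set R[i]) : p != 0 ->
  root_distribution p L = (avg (roots_mult p) (\1_L : R[i] -> R))%:E.
Proof.
move=> p0; rewrite /root_distribution /mscale /= /msum /avg EFinM size_roots //.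
congr (_ * _)%E; rewrite -sumEFin (big_nth 0) size_roots // big_mkord.
by [].
Qed.

Lemma regular_leading (K S : set R[i]) (omega : probability (borelC R) R)
    (q : nat -> {poly R[i]}) (B r : R) :
  compact K -> S `<=` K -> measurable (S : set (borelC R)) -> omega S = 1%E ->
  0 < B -> r <= B -> K `<=` disk B ->
  (\forall k \near \oo, q k != 0 /\ forall z, root (q k) z -> normc z < B) ->
  (forall e : R, 0 < e -> \forall k \near \oo, forall z, ~ disk r z ->
     (`| ((degree (q k))%:R^-1)%:E * log_mod (q k).[z] - green omega z | < e%:E)%E) ->
  exists b : nat -> R, forall e : R, 0 < e -> \forall k \near \oo,
    forall z d, B <= normc z -> 0 < d -> (forall w, K w -> d <= normc (w - z)) ->
    `|b k + avg (roots_mult (q k)) (fun w => ln (normc (w - z)))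
      - integralC S omega (fun w => ln (Num.max (normc (w - z)) d))| <= e.
Proof.
move=> cK SK mS S1 B0 rB KB qP reg.
have ndisk z : B <= normc z -> ~ disk r z.
  by move=> zB; rewrite /disk /mkset; apply/negP; rewrite -leNgt (le_trans rB).
have clK : closed K by apply: compact_closed => //; exact: norm_hausdorff.
pose z0 : R[i] := (B%:C)%C.
have z0B : B <= normc z0 by rewrite normc_real ler_norm.
have [d0 d00 d0P] : exists2 d : R, 0 < d & forall w, K w -> d <= normc (w - z0).
  by apply: closed_dist_gt0 => // /KB; rewrite /disk /mkset ltNge z0B.
(* The potential at [z0] is finite, so an infinite energy would make the distance in the regularity
   estimate [+oo]. *)
have Ifin : energy omega \is a fin_num.
  have : \forall k \near \oo, (`| ((degree (q k))%:R^-1)%:E * log_mod (q k).[z0]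
      - green omega z0 | < 1%:E)%E.
    by apply: filterS (reg 1 ltr01) => k; apply; exact: ndisk.
  move=> /filter_ex[k]; rewrite /green (potentialE cK SK mS S1 d00 d0P).
  case: (energy omega) => // .
    by case: (_ * _)%E.
  by case: (_ * _)%E.
have IE : energy omega = (fine (energy omega))%:E by rewrite fineK.
set I := fine _ in IE.
(* The mean of [log |q_k|] is this leading term plus the root average, and [green] is the potential
   minus [I]. *)
exists (fun k => (degree (q k))%:R^-1 * ln (normc (lead_coef (q k))) + I).
move=> e e0; near=> k => z d zB d1 dP.
have [qk0 qkB] : q k != 0 /\ forall z, root (q k) z -> normc z < B by near: k.
have : (`| ((degree (q k))%:R^-1)%:E * log_mod (q k).[z] - green omega z | < e%:E)%E.
  have : forall z, ~ disk r z -> (`| ((degree (q k))%:R^-1)%:E * log_mod (q k).[z] - green omega z | < e%:E)%E.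
    by near: k; exact: reg.
  by apply; exact: ndisk.
have nr : ~~ root (q k) z by apply/negP => /qkB; rewrite ltNge zB.
rewrite /green (potentialE cK SK mS S1 d1 dP) IE /log_mod lne_EFin; last first.
  by rewrite normc_gt0 -rootE.
rewrite ln_normc_horner // -EFinM -!EFinB abse_EFin lte_fin => /ltW.
have -> : avg (roots_mult (q k)) (fun w => ln (normc (w - z)))
    = (degree (q k))%:R^-1 * \sum_(w <- roots_mult (q k)) ln (normc (z - w)).
  rewrite /avg size_roots //; congr (_ * _); apply: eq_bigr => w _.
  by rewrite normc_distC.
set J := integralC _ _ _; apply: le_trans.
by rewrite le_eqVlt; apply/orP; left; apply/eqP; congr (`|_|); ring.
Unshelve. all: by end_near. Qed.

Lemma avg_indic_le (s : seq R[i]) (A1 A2 : set R[i]) : A1 `<=` A2 ->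
  avg s (\1_A1 : R[i] -> R) <= avg s (\1_A2 : R[i] -> R).
Proof.
move=> A12; apply: avg_le => w _; rewrite !indicE.
case: (boolP (w \in A1)) => [|_]; last exact: ler0n.
by rewrite inE => /A12 Aw; rewrite mem_set.
Qed.

Lemma avg_indicU (s : seq R[i]) (A1 A2 : set R[i]) :
  avg s (\1_(A1 `|` A2) : R[i] -> R) <= avg s (\1_A1 : R[i] -> R) + avg s (\1_A2 : R[i] -> R).
Proof.
rewrite -avgD; apply: avg_le => w _; rewrite !indicE in_setU.
by case: (w \in A1); case: (w \in A2); rewrite ?addr0 ?add0r ?lexx // lerDl.
Qed.

Definition asympt_null (s : nat -> seq R[i]) (A : set R[i]) : Prop :=
  forall e : R, 0 < e -> \forall k \near \oo, avg (s k) (\1_A : R[i] -> R) <= e.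

Lemma asympt_nullU s A1 A2 : asympt_null s A1 -> asympt_null s A2 ->
  asympt_null s (A1 `|` A2).
Proof.
move=> H1 H2 e e0; have e2 : 0 < e / 2 by rewrite divr_gt0.
near=> k; apply: (le_trans (avg_indicU _ _ _)); rewrite [e]splitr; apply: lerD.
  by near: k; exact: H1.
by near: k; exact: H2.
Unshelve. all: by end_near. Qed.

Lemma asympt_nullS s A1 A2 : A1 `<=` A2 -> asympt_null s A2 -> asympt_null s A1.
Proof.
move=> A12 H e /H; apply: filterS => k; apply: le_trans; exact: avg_indic_le.
Qed.

Lemma asympt_null_seq s (f : R[i] -> set R[i]) (r : seq R[i]) :
  (forall i, i \in r -> asympt_null s (f i)) ->
  asympt_null s [set w | exists2 i, i \in r & f i w].
Proof.
elim: r => [|i r IH] H.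
  apply: (@asympt_nullS _ _ set0); first by move=> w [].
  move=> e e0; near=> k; rewrite (_ : avg _ _ = 0) ?ltW //.
  by rewrite /avg big1 ?mulr0 // => w _; rewrite indicE in_set0.
apply: (@asympt_nullS _ _ (f i `|` [set w | exists2 i, i \in r & f i w])).
  move=> w [j]; rewrite inE => /orP[/eqP -> fw|jr fw]; first by left.
  by right; exists j.
apply: asympt_nullU; first by apply: H; rewrite inE eqxx.
by apply: IH => j jr; apply: H; rewrite inE jr orbT.
Unshelve. all: by end_near. Qed.

End Assembly.

Theorem theorem4 (R : realType) (K : set R[i])
    (omega : probability (borelC R) R) (q : nat -> {poly R[i]})
    (cK : compact K) (npK : non_polar K) (pcK : polynomially_convex K)
    (eqK : equilibrium_measure K omega)
    (omega_comp : forall V : set R[i],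
       components K° V -> omega (closure V) = 0%E)
    (degq : forall k, (0 < k)%N -> (0 < degree (q k))%N)
    (degqoo : degree (q k) @[k --> \oo] --> \oo)
    (regq : K_regular K omega q)
    (wcq : weakly_centers q K) :
  weakly_centers q (boundary K).
Proof.
have clK : closed K by apply: compact_closed => //; exact: norm_hausdorff.
have [_ [N [r2 [r20 qr2]]] qL] := wcq.
have [r [r0 Kr reg]] := regq.
pose B := Num.max r r2.
have B0 : 0 < B by rewrite lt_max r0.
have KB : K `<=` disk B.
  by move=> w /Kr; rewrite /disk /mkset => h; rewrite lt_max h.
have oK : open K° := open_interior K.
pose S := K `\` K°.
have SK : S `<=` K by move=> w [].
have mS : measurable (S : set (borelC R)).
  by apply: measurableD; [exact: closed_borelC|exact: open_borelC].
have oint := interior_null omega_comp.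
have S1 : omega S = 1%E.
  have mSc : measurable (~` S : set (borelC R)) by exact: measurableC.
  have mKc : measurable (~` K : set (borelC R)) by exact: open_borelC (closed_openC clK).
  have mKi : measurable (K° : set (borelC R)) by exact: open_borelC.
  have Sc0 : omega (~` S) = 0%E.
    apply: (@subset_measure0 _ _ _ omega _ (~` K `|` K°)) => //.
    - exact: measurableU.
    - by move=> w /not_andP[|/contrapT]; [left|right].
    - exact: etrans (measureU0 mKc mKi oint) eqK.1.
  have E1 := probability_setC omega mSc; rewrite setCK in E1; apply: etrans E1 _.
  by apply: etrans (congr1 (fun x => 1 - x)%E Sc0) _; rewrite sube0.
have fE := integralC_functional cK SK mS S1.
have qk0 k : (0 < k)%N -> q k != 0.
  by move=> /degq; apply: contraTneq => ->; rewrite /degree size_poly0.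
have rootsP : \forall k \near \oo, q k != 0 /\ forall z, root (q k) z -> normc z < B.
  (* Index 0 is excluded, since [q 0] may vanish. *)
  exists (maxn N 1) => // k /=; rewrite geq_max => /andP[Nk k0]; split; first exact: qk0.
  by move=> z /(qr2 k Nk); rewrite /disk /mkset => h; rewrite lt_max h orbT.
pose s k := roots_mult (q k).
have sP : \forall k \near \oo, (0 < size (s k))%N /\ forall z, z \in s k -> normc z < B.
  near=> k; have [q0 qB] : q k != 0 /\ forall z, root (q k) z -> normc z < B by near: k.
  rewrite /s size_roots //; split; last by move=> z; rewrite mem_roots //; exact: qB.
  by apply: degq; near: k; exact: nbhs_infty_gt.
have null_of L : root_distribution (q k) L @[k --> \oo] --> 0%E -> asympt_null s L.
  move=> /fine_cvgP[_ /cvgrPdist_le H] e e0.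
  near=> k; have q0 : q k != 0 by apply: qk0; near: k; exact: nbhs_infty_gt.
  have : `|0 - fine (root_distribution (q k) L)| <= e by near: k; exact: H.
  rewrite sub0r normrN root_distributionE //=; apply: le_trans; exact: ler_norm.
have of_null L : asympt_null s L -> root_distribution (q k) L @[k --> \oo] --> 0%E.
  move=> H; apply/fine_cvgP; split.
    near=> k; have q0 : q k != 0 by apply: qk0; near: k; exact: nbhs_infty_gt.
    by rewrite root_distributionE.
  apply/cvgrPdist_le => e e0.
  near=> k; have q0 : q k != 0 by apply: qk0; near: k; exact: nbhs_infty_gt.
  rewrite sub0r normrN /= root_distributionE //= ger0_norm.
    by near: k; exact: H.
  rewrite /avg mulr_ge0 ?invr_ge0 //; apply: sumr_ge0 => w _; rewrite indicE; exact: ler0n.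
have rB : r <= B by rewrite le_max lexx.
have [b bP] := regular_leading cK SK mS S1 B0 rB KB rootsP reg.
have H : setting K S B s (integralC S omega).
  split=> //.
  - by move=> L cL LK; exact: null_of (qL L cL LK).
  - exact: (regular_good B0 KB clK SK fE sP bP).
  - by apply: (no_atom_uniform cK SK mS) => x; exact: (equilibrium_no_atom x npK eqK).
have S_int : S `&` K° = set0 by apply/seteqP; split => // w [[]].
have KintK : K° `<=` K by exact: interior_subset.
(* The component estimate is local; only finitely many of these balls, and so finitely many
   components, are needed for a given [L]. *)
have local x : K° x -> exists2 rho : R, 0 < rho & asympt_null s (cball x rho).
  move=> Kx; have /nbhsCP[e e0 eK] : nbhs x K° by apply: open_nbhs_nbhs.
  exists (e / 2); first by rewrite divr_gt0.
  pose V := connected_component K° x.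
  have Vx : V x by exact: connected_component_refl.
  have VK : V `<=` K by move=> w /connected_component_sub /KintK.
  have Vball z (t : R) : cball z t `<=` K -> forall w, cball z t w -> V z <-> V w.
    by move=> /cball_interior; exact: component_ball.
  apply: (component_mass H S_int VK Vball _ _ _ Vx).
  - move=> t t0; apply: (plateau_null cK SK mS) => //; first by exists x.
    by apply: omega_comp; exists x.
  - by rewrite divr_gt0.
  - by move=> w; rewrite mulrCA mulfV // mulr1 => /eK /KintK.
split.
- apply: (@subclosed_compact _ _ K) => //; last by move=> w [+ _]; rewrite -(closure_id _).1.
  by apply: closedI; [exact: closed_closure|exact: open_closedC].
- by exists N, r2.
move=> L cL Lb; apply: of_null.
have LK w : L w -> K w -> K° w.
  move=> Lw Kw; apply: contrapT => nw.
  suff : (L `&` boundary K) w by rewrite Lb.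
  by split=> //; split=> //; exact: subset_closure.
have cLK : compact (L `&` K).
  by apply: (@subclosed_compact _ _ K) => //; exact: closedI.
have /choice[rho rhoP] x : exists t : R, K° x -> 0 < t /\ asympt_null s (cball x t).
  have [Kx|nKx] := pselect (K° x); last by exists 0.
  by have [t t0 tn] := local x Kx; exists t.
(* As [L] misses the boundary, [L] meets [K] in a compact subset of the interior. The rest of [L] is
   closed and disjoint from [K], where centering on [K] applies. *)
have : finite_subset_cover (L `&` K) (fun x => cball x (rho x)) (L `&` K).
  move: (cLK); rewrite compact_cover; apply; first by move=> x _; exact: open_cball.
  move=> x [Lx Kx]; exists x; first by split.
  have [t0 _] := rhoP x (LK x Lx Kx).
  by rewrite /cball /mkset subrr ComplexField.Normc.normc0.
move=> [D DLK LKD].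
pose U : set R[i] := [set w | exists2 i, i \in finmap.enum_fset D & cball i (rho i) w].
suff HU : asympt_null s (L `\` K° `|` U).
  apply: asympt_nullS HU.
  move=> w Lw; have [Kw|nKw] := pselect (K° w); last by left.
  by right; have [i /= iD iw] := LKD w (conj Lw (KintK w Kw)); exists i.
apply: asympt_nullU.
  apply: null_of; apply: qL; first by apply: closedI => //; exact: open_closedC.
  by apply/seteqP; split => // w [[Lw nKw] Kw]; apply: nKw; exact: LK.
apply: (asympt_null_seq (f := fun i => cball i (rho i))) => i iD.
have /set_mem[Li Ki] := DLK i iD.
by have [] := rhoP i (LK i Li Ki).
Unshelve. all: by end_near. Qed.
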